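(* Let $M$ be a complete Riemannian manifold of dimension $n\geq 2$ with metric $g$, let $\omega$ be a smooth positive function on $M$, and let $n/2<\beta\leq n+1$ be such that $d\mu_\beta=\omega^{-\beta}\,d\mathrm{vol}$ is a probability measure. Let $Lf=\omega\Delta f-(\beta-1)\langle d\omega,df\rangle$ be the symmetric diffusion operator associated with $\mu_\beta$, with spectral gap $\lambda_1(-L)$. Inequalities between symmetric tensors are in the sense of quadratic forms, $\mathrm{id}$ corresponding to $g$. (1) If there exists $\tilde c>0$ such that everywhere on $M$ $$\frac{n}{n-1}\,\omega\,\mathrm{Ric}+(\beta-1)\mathrm{Hess}(\omega)+\frac{n+1-\beta}{n-1}\,\big[\mathrm{Hess}(\omega)-\Delta\omega\,\mathrm{id}\big]\ \geq\ \tilde c\,\mathrm{id},$$ then $\lambda_1(-L)\geq\tilde c$. (2) If $\mathrm{Ric}\geq 0$ and there exist $0<\rho_-\leq\rho_+$ such that $\rho_-\,\mathrm{id}\leq\mathrm{Hess}(\omega)\leq\rho_+\,\mathrm{id}$ everywhere on $M$, then, with $\kappa=\rho_+/\rho_-$, for all $\beta\in\left[\frac{n(n+1)\kappa-2}{n(\kappa+1)-2},\,n+1\right]$, $$\lambda_1(-L)\geq\rho_-\left(\beta-1-\frac{n+1-\beta}{n-1}(n\kappa-1)\right).$$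
   Context: Here $\Delta$ is the Laplace-Beltrami operator (trace of the Hessian), $\mathrm{Ric}$ the Ricci tensor, and $d\mathrm{vol}$ the Riemannian volume measure. The operator $L$ is defined on $\mathcal{C}^\infty_c(M)$ and is symmetric in $L^2(\mu_\beta)$. Standing assumptions: $L$ is essentially self-adjoint on $\mathcal{C}_c^\infty(M)$ in $L^2(\mu_\beta)$, its unique self-adjoint extension, still denoted $L$, has domain $\mathcal{D}(L)\subset L^2(\mu_\beta)$, and the $L^2(\mu_\beta)$-semigroup generated by $L$ is ergodic. The spectral gap is $$\lambda_1(-L)=\inf\left\{\frac{\int_M -f\,Lf\,d\mu_\beta}{\mathrm{Var}_{\mu_\beta}(f)}\ :\ f\in\mathcal{D}(L),\ \mathrm{Var}_{\mu_\beta}(f)\neq 0\right\},$$ where $\mathrm{Var}_{\mu_\beta}(f)=\int f^2d\mu_\beta-(\int f\,d\mu_\beta)^2$. *)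

(* Defs.v *)
From HB Require Import structures.
From mathcomp Require Import all_boot all_order all_algebra.
From mathcomp Require Import all_classical all_reals all_analysis.

Set Implicit Arguments.
Unset Strict Implicit.
Unset Printing Implicit Defensive.

Import Order.TTheory GRing.Theory Num.Theory.
Import numFieldNormedType.Exports.

Local Open Scope classical_set_scope.
Local Open Scope ring_scope.

Section Euclidean.
Variables (R : realType) (n : nat).
Implicit Types (F H : 'rV[R]_n -> R) (U : set 'rV[R]_n) (x : 'rV[R]_n).

Definition pd (i : 'I_n) F x : R := 'D_(delta_mx 0 i) F x.

Fixpoint Ck (k : nat) U F : Prop :=
  (forall x, U x -> {for x, continuous F}) /\
  if k is k'.+1 then
    forall i, (forall x, U x -> derivable F x (delta_mx 0 i)) /\ Ck k' U (pd i F)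
  else True.

(* To be used with [U] open: all iterated partial derivatives exist and are
   continuous on [U]. *)
Definition smooth_on U F : Prop := forall k, Ck k U F.

(* Row convention: a tangent vector [v] (a row of components) is pushed forward
   to [v *m jac f x]. *)
Definition jac (f : 'rV[R]_n -> 'rV[R]_n) x : 'M[R]_n :=
  \matrix_(a, b) pd a (fun y => f y 0 b) x.

Definition qform (A : 'M[R]_n) (v : 'rV[R]_n) : R := (v *m A *m v^T) 0 0.

Definition qform_le (A B : 'M[R]_n) : Prop := forall v, qform A v <= qform B v.

(* In what follows [G x] is the matrix (g_ij(x)) of the metric in a coordinate
   domain, and [invmx (G x)] is (g^ij(x)). *)
Variable G : 'rV[R]_n -> 'M[R]_n.

Definition christoffel (k i j : 'I_n) x : R :=
  2^-1 * \sum_(l < n) invmx (G x) k l *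
    (pd i (fun y => G y j l) x + pd j (fun y => G y i l) x
     - pd l (fun y => G y i j) x).

(* R(d_i, d_j) d_l = \sum_k (riemann k l i j) d_k, with the convention
   R(X, Y) Z = D_X D_Y Z - D_Y D_X Z - D_[X, Y] Z. *)
Definition riemann (k l i j : 'I_n) x : R :=
  pd i (christoffel k j l) x - pd j (christoffel k i l) x
  + \sum_(m < n) (christoffel k i m x * christoffel m j l x
                  - christoffel k j m x * christoffel m i l x).

(* Ric(Y, Z) = tr (X |-> R(X, Y) Z): positive on round spheres. *)
Definition ricci_loc x : 'M[R]_n := \matrix_(j, l) \sum_(k < n) riemann k l k j x.

Definition hess_loc F x : 'M[R]_n :=
  \matrix_(i, j) (pd i (pd j F) x - \sum_(k < n) christoffel k i j x * pd k F x).

Definition laplace_loc F x : R :=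
  \sum_(i < n) \sum_(j < n) invmx (G x) i j * hess_loc F x i j.

Definition pairing_loc F H x : R :=
  \sum_(i < n) \sum_(j < n) invmx (G x) i j * pd i F x * pd j H x.

End Euclidean.

(* By Tonelli's theorem, for a nonnegative Borel function this is its integral
   against Lebesgue measure on R^n. *)
Fixpoint iter_integral (R : realType) (n : nat) :
    ('rV[R]_n -> \bar R) -> \bar R :=
  match n return ('rV[R]_n -> \bar R) -> \bar R with
  | 0 => fun F => F 0
  | n'.+1 => fun F =>
      (\int[@lebesgue_measure R]_t
         iter_integral (fun v : 'rV[R]_n' => F (row_mx t%:M v : 'rV[R]_(1 + n'))))%E
  end.

(* [cmap] and [cinv] are total functions; only their restrictions to the open
   sets [cdom] and [cimg], between which they are inverse homeomorphisms, are
   meaningful. *)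
Record chart (R : realType) (n : nat) (M : topologicalType) := Chart {
  cdom : set M;
  cimg : set 'rV[R]_n;
  cmap : M -> 'rV[R]_n;
  cinv : 'rV[R]_n -> M;
  cdom_open : open cdom;
  cimg_open : open cimg;
  cmap_img : forall x, cdom x -> cimg (cmap x);
  cinv_dom : forall p, cimg p -> cdom (cinv p);
  cmapK : forall x, cdom x -> cinv (cmap x) = x;
  cinvK : forall p, cimg p -> cmap (cinv p) = p;
  cmap_continuous : forall x, cdom x -> {for x, continuous cmap};
  cinv_continuous : forall p, cimg p -> {for p, continuous cinv} }.

(* A smooth manifold with a (not necessarily maximal) smooth atlas indexed by
   [chart_index].  [chart_at x] is a choice of a chart around [x]; the objects
   defined below with its help do not depend on this choice. *)
Record smooth_manifold (R : realType) (n : nat) := SmoothManifold {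
  carrier :> ptopologicalType;
  chart_index : Type;
  atlas : chart_index -> chart R n carrier;
  chart_at : carrier -> chart_index;
  manifold_hausdorff : hausdorff_space carrier;
  manifold_second_countable : @second_countable carrier;
  chart_atP : forall x, cdom (atlas (chart_at x)) x;
  transition_smooth : forall i j (b : 'I_n),
    smooth_on (cimg (atlas i) `&` cinv (atlas i) @^-1` cdom (atlas j))
      (fun p => cmap (atlas j) (cinv (atlas i) p) 0 b) }.

(* The metric is given by its matrix in each chart. *)
Record riemannian_metric (R : realType) (n : nat) (M : smooth_manifold R n) :=
  RiemannianMetric {
  gmat : chart_index M -> 'rV[R]_n -> 'M[R]_n;
  gmat_smooth : forall i a b, smooth_on (cimg (atlas i)) (fun p => gmat i p a b);
  gmat_sym : forall i p, cimg (atlas i) p -> (gmat i p)^T = gmat i p;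
  gmat_pos : forall i p v, cimg (atlas i) p -> v != 0 -> 0 < qform (gmat i p) v;
  gmat_transition : forall i j p,
    cimg (atlas i) p -> cdom (atlas j) (cinv (atlas i) p) ->
    let tau := cmap (atlas j) \o cinv (atlas i) in
    gmat i p = jac tau p *m gmat j (tau p) *m (jac tau p)^T }.

Notation borel M := (g_sigma_algebraType (@open M)).

Section Geometry.
Variables (R : realType) (n : nat) (M : smooth_manifold R n).
Variable g : riemannian_metric M.
Implicit Types (f h : M -> R) (x : M).

Definition smooth_fun f : Prop :=
  forall i, smooth_on (cimg (atlas i)) (f \o cinv (atlas i)).

Definition smooth_compact_support f : Prop :=
  smooth_fun f /\ compact (closure [set x | f x != 0]).

Definition local_rep f x : 'rV[R]_n -> R := f \o cinv (atlas (chart_at x)).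
Definition coord x : 'rV[R]_n := cmap (atlas (chart_at x)) x.
Definition local_metric x : 'rV[R]_n -> 'M[R]_n := gmat g (chart_at x).

(* Symmetric 2-tensors at [x] are given by their matrices in [chart_at x]. *)
Definition metric_at x : 'M[R]_n := local_metric x (coord x).
Definition Ric x : 'M[R]_n := ricci_loc (local_metric x) (coord x).
Definition Hess f x : 'M[R]_n :=
  hess_loc (local_metric x) (local_rep f x) (coord x).

Definition laplace f x : R :=
  laplace_loc (local_metric x) (local_rep f x) (coord x).
Definition dpairing f h x : R :=
  pairing_loc (local_metric x) (local_rep f x) (local_rep h x) (coord x).

Definition C1_path (c : R -> M) : Prop :=
  continuous c /\
  forall i t, cdom (atlas i) (c t) ->
    derivable (cmap (atlas i) \o c) t 1 /\
    {for t, continuous (fun s => 'D_1 (cmap (atlas i) \o c) s)}.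

(* The infimum of lengths over C^1 paths with possibly vanishing velocity is the
   same as over piecewise C^1 paths (slow down at the corners). *)
Definition path_length (c : R -> M) : \bar R :=
  (\int[@lebesgue_measure R]_(t in `[0%R, 1%R])
     (Num.sqrt (qform (metric_at (c t))
        ('D_1 (cmap (atlas (chart_at (c t))) \o c) t)))%:E)%E.

Definition riemannian_dist (x y : M) : \bar R :=
  ereal_inf [set path_length c | c in [set c | C1_path c /\ c 0 = x /\ c 1 = y]].

(* Completeness as a metric space. *)
Definition complete_manifold : Prop :=
  forall u : nat -> M,
    (forall e : R, 0 < e -> exists N, forall j k, (N <= j)%N -> (N <= k)%N ->
       (riemannian_dist (u j) (u k) < e%:E)%E) ->
    exists x : M, u @ \oo --> x.

Definition is_riemannian_volume
    (vol : {measure set (borel M) -> \bar R}) : Prop :=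
  forall i (A : set (borel M)), measurable A -> A `<=` cdom (atlas i) ->
    vol A = iter_integral (fun p =>
      (\1_(cimg (atlas i) `&` cinv (atlas i) @^-1` A) p
       * Num.sqrt (\det (gmat g i p)))%:E).

Definition diffusion_op (beta : R) (omega f : M -> R) (x : M) : R :=
  omega x * laplace f x - (beta - 1) * dpairing omega f x.

End Geometry.

(* Unbounded operators on L^2(mu) are given by their graphs, as relations
   between square integrable functions that respect a.e. equality. *)
Section L2.
Context {d : measure_display} {T : measurableType d} {R : realType}.
Variable mu : {measure set T -> \bar R}.
Implicit Types (f h u v : T -> R) (A : (T -> R) -> (T -> R) -> Prop).

Definition L2 f : Prop := f \in Lfun mu 2%:E.

Definition L2norm f : \bar R := 'N[mu]_(2%:E)[EFin \o f].

Definition L2inner f h : R := \int[mu]_x (f x * h x).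

Definition L2variance f : R :=
  \int[mu]_x (f x ^+ 2) - (\int[mu]_x f x) ^+ 2.

Definition op_closure A f h : Prop :=
  L2 f /\ L2 h /\
  exists u v : nat -> T -> R,
    (forall k, A (u k) (v k)) /\
    L2norm (u k \- f) @[k --> \oo] --> 0%E /\
    L2norm (v k \- h) @[k --> \oo] --> 0%E.

Definition op_adjoint A f h : Prop :=
  L2 f /\ L2 h /\ forall u v, A u v -> L2inner f v = L2inner h u.

Definition selfadjoint A : Prop := forall f h, A f h <-> op_adjoint A f h.

(* For a densely defined [A], such as [diffusion_core] below, the closure is
   then the unique self-adjoint extension. *)
Definition essentially_selfadjoint A : Prop := selfadjoint (op_closure A).

Definition spectral_gap A : \bar R :=
  ereal_inf [set r | exists f h,
    [/\ A f h, L2variance f != 0 &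
        r = ((\int[mu]_x (- f x * h x)) / L2variance f)%:E]].

(* [P] is a strongly continuous one-parameter semigroup of bounded operators on
   L^2(mu) whose infinitesimal generator is [A]. *)
Record semigroup_generated_by A (P : R -> (T -> R) -> (T -> R)) : Prop := {
  sg_L2 : forall t f, 0 <= t -> L2 f -> L2 (P t f);
  sg_linear : forall t (a : R) f h, 0 <= t -> L2 f -> L2 h ->
    {ae mu, forall x, P t (fun y => a * f y + h y) x = a * P t f x + P t h x};
  sg_bounded : forall t, 0 <= t -> exists C : R,
    forall f, L2 f -> (L2norm (P t f) <= C%:E * L2norm f)%E;
  sg0 : forall f, L2 f -> {ae mu, forall x, P 0 f x = f x};
  sgD : forall s t f, 0 <= s -> 0 <= t -> L2 f ->
    {ae mu, forall x, P (s + t) f x = P s (P t f) x};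
  sg_continuous : forall f, L2 f ->
    L2norm (P t f \- f) @[t --> (0 : R)^'+] --> 0%E;
  sg_generator : forall f h, L2 f -> L2 h ->
    (A f h <->
     L2norm (fun x => t^-1 * (P t f x - f x) - h x) @[t --> (0 : R)^'+] --> 0%E) }.

Definition ergodic (P : R -> (T -> R) -> (T -> R)) : Prop :=
  forall f, L2 f ->
    (forall t, 0 <= t -> {ae mu, forall x, P t f x = f x}) ->
    exists c : R, {ae mu, forall x, f x = c}.

End L2.

Section Generator.
Variables (R : realType) (n : nat) (M : smooth_manifold R n).
Variables (g : riemannian_metric M) (beta : R) (omega : M -> R).

(* The graph of L on C_c^oo(M), and of its closure in L^2(mu). *)
Definition diffusion_core (f h : borel M -> R) : Prop :=
  smooth_compact_support f /\ h = diffusion_op g beta omega f.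

Definition diffusion_generator (mu : {measure set (borel M) -> \bar R})
    (f h : borel M -> R) : Prop := op_closure mu diffusion_core f h.

End Generator.

(* Main.v *)
(* For compactly supported f the identity
     int (u L f + omega <du, df>) d mu = 0
   holds for every C^1 function u: in a chart the integrand is a divergence, and
   a finite cover by bump functions reduces the general case to that one.  Using
   it four times together with Bochner's formula, |Hess f|^2 >= (Delta f)^2 / n
   and Cauchy-Schwarz, the curvature condition yields
   c int (- f L f) <= int (L f)^2 on C_c^oo(M).  This passes to the closure of L.
   Since L is self-adjoint, the kernel of L is the orthogonal complement of its
   range; elements of the kernel are fixed by the semigroup, hence constant by
   ergodicity.  A centered f in D(L) is thus a limit of L h_k, and Cauchy-Schwarz
   for the form (- L f, h) gives
   (f, L h_k)^2 <= (- L f, f) (- L h_k, h_k) <= (- L f, f) |L h_k|^2 / c,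
   so c |f|^2 <= (- L f, f) in the limit.  Part (2) follows from part (1) because
   Delta omega <= n rho_+. *)

Require Import Defs.
From HB Require Import structures.
From mathcomp Require Import all_boot all_order all_algebra.
From mathcomp Require Import all_classical all_reals all_analysis.
From mathcomp Require Import measurable_realfun.
From mathcomp Require Import ring lra.

Set Implicit Arguments.
Unset Strict Implicit.
Unset Printing Implicit Defensive.

Import Order.TTheory GRing.Theory Num.Theory.
Import numFieldNormedType.Exports.

Local Open Scope classical_set_scope.
Local Open Scope ring_scope.

(** * Calculus on row vectors *)

Section PartialDerivatives.
Variables (R : realType) (n : nat).
Implicit Types (F H : 'rV[R]_n -> R) (U : set 'rV[R]_n) (x v : 'rV[R]_n).

(** Three obstacles shape the proof. Tensors are evaluated in a chart that varies with the point, so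
    integrating them in one chart needs chart independence of the pairing and of the Laplacian.
    Polarization writes the Hessian through first-order pairings alone, so second derivatives of the
    transition maps never enter. The tensor identities are proved in an abstract commutative ring
    with commuting derivations, where no differentiability has to be carried along, and are then
    read off in a chart. On the analytic side, the semigroup comes with a bound for each time but
    none uniform in time, so that kernel elements are fixed by it rests on the uniform boundedness
    principle near time 0. Functions are not identified almost everywhere, so the Hilbert space
    argument runs with a semidefinite inner product and with equalities up to seminorm 0. *)

Lemma is_derive_line F x v t : derivable F (t *: v + x) v ->
  is_derive t 1 (fun s : R => F (s *: v + x)) ('D_v F (t *: v + x)).
Proof.
move=> dF; have E : (fun h : R => h^-1 *: (((fun s : R => F (s *: v + x)) \o shift t) (h *: 1)
    - F (t *: v + x))) =
    (fun h : R => h^-1 *: ((F \o shift (t *: v + x)) (h *: v) - F (t *: v + x))).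
  by apply/funext => h /=; rewrite scaler1 scalerDl addrA.
by split; rewrite /derivable /derive E.
Qed.

Lemma line_continuous F x v t : derivable F (t *: v + x) v ->
  {for t, continuous (fun s : R => F (s *: v + x))}.
Proof.
move=> /is_derive_line [d _]; apply: differentiable_continuous.
exact/derivable1_diffP.
Qed.

Lemma MVT_line F x v (t : R) :
  (forall s, `|s| <= `|t| -> derivable F (s *: v + x) v) ->
  exists2 s, `|s| <= `|t| & F (t *: v + x) - F x = t * 'D_v F (s *: v + x).
Proof.
move=> dF.
have side (a b : R) : a <= b -> (forall s, a <= s <= b -> `|s| <= `|t|) ->
    exists2 s, `|s| <= `|t| &
     F (b *: v + x) - F (a *: v + x) = (b - a) * 'D_v F (s *: v + x).
  move=> ab abt.
  have [||s sab ->] := @MVT_segment R (fun s => F (s *: v + x))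
      (fun s => 'D_v F (s *: v + x)) a b ab.
  - move=> s; rewrite in_itv/= => /andP[s1 s2]; apply: is_derive_line.
    by apply/dF/abt; rewrite !ltW.
  - apply: continuous_in_subspaceT => s; rewrite inE/= in_itv/= => sab.
    by apply: line_continuous; apply/dF/abt.
  - by exists s; [apply: abt; move: sab; rewrite in_itv | rewrite mulrC].
have [t0|t0] := leP 0 t.
  have [|s st] := side 0 t t0.
    by move=> s /andP[s0 st]; rewrite !ger0_norm.
  by rewrite scale0r add0r subr0 => ->; exists s.
have [|s st] := side t 0 (ltW t0).
  by move=> s /andP[s0 st]; rewrite !ler0_norm// ?lerN2// ltW.
rewrite scale0r add0r => E; exists s => //.
by rewrite -opprB E sub0r mulNr opprK.
Qed.

Lemma near_open (T : topologicalType) (U : set T) (x : T) (P : T -> Prop) :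
  open U -> U x -> (forall y, U y -> P y) -> \near x, P x.
Proof.
move=> oU Ux UP; have : nbhs x U by rewrite nbhsE; exists U.
by apply: filterS.
Qed.

Lemma pd_ext U F H (i : 'I_n) x : open U -> U x -> (forall y, U y -> F y = H y) ->
  pd i F x = pd i H x.
Proof. by move=> oU Ux FH; apply: near_eq_derive; exact: near_open FH. Qed.

Lemma derivable_ext U F H (v x : 'rV[R]_n) : open U -> U x ->
  (forall y, U y -> F y = H y) -> derivable F x v -> derivable H x v.
Proof. by move=> oU Ux FH; apply: near_eq_derivable; exact: near_open FH. Qed.

Lemma continuous_ext (S : topologicalType) (V : set S) (T : topologicalType) (F H : S -> T) (x : S) :
  open V -> V x ->
  (forall y, V y -> F y = H y) -> {for x, continuous F} -> {for x, continuous H}.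
Proof.
move=> oU Ux FH; move=> cF; change (H @ x --> H x); rewrite -(FH _ Ux).
apply: cvg_trans cF; apply: near_eq_cvg.
by apply: near_open oU Ux _ => y Uy; rewrite FH.
Qed.

Lemma Ck_ext k U F H : open U -> (forall y, U y -> F y = H y) ->
  Ck k U F -> Ck k U H.
Proof.
move=> oU; elim: k F H => [|k IH] F H FH [cF dF]; split => //.
- by move=> x Ux; apply: continuous_ext oU Ux FH (cF _ Ux).
- by move=> x Ux; apply: continuous_ext oU Ux FH (cF _ Ux).
- move=> i; have [d1 d2] := dF i; split.
    by move=> x Ux; apply: (derivable_ext oU Ux FH); exact: d1.
  by apply: IH d2 => y Uy; exact: pd_ext oU Uy FH.
Qed.

Lemma CkS k U F : Ck k.+1 U F -> Ck k U F.
Proof.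
elim: k F => [|k IH] F [cF dF]; split => // i.
by have [d1 d2] := dF i; split => //; exact: IH.
Qed.

Lemma Ck_sub k U V F : V `<=` U -> Ck k U F -> Ck k V F.
Proof.
move=> VU; elim: k F => [|k IH] F [cF dF]; split => //.
- by move=> x /VU; exact: cF.
- by move=> x /VU; exact: cF.
- by move=> i; have [d1 d2] := dF i; split; [move=> x /VU; exact: d1|exact: IH].
Qed.

Lemma CkD k U F H : open U -> Ck k U F -> Ck k U H -> Ck k U (F \+ H).
Proof.
move=> oU; elim: k F H => [|k IH] F H [cF dF] [cH dH]; split => //.
- by move=> x Ux; exact: (cvgD (cF _ Ux) (cH _ Ux)).
- by move=> x Ux; exact: (cvgD (cF _ Ux) (cH _ Ux)).
- move=> i; have [dF1 dF2] := dF i; have [dH1 dH2] := dH i; split.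
    by move=> x Ux; exact: (derivableD (dF1 _ Ux) (dH1 _ Ux)).
  apply: Ck_ext oU _ (IH _ _ dF2 dH2) => x Ux /=.
  by rewrite /pd (deriveD (dF1 _ Ux) (dH1 _ Ux)).
Qed.

Lemma CkM k U F H : open U -> Ck k U F -> Ck k U H -> Ck k U (F \* H).
Proof.
move=> oU; elim: k F H => [|k IH] F H.
  move=> [cF dF] [cH dH]; split => // x Ux.
  by exact: (cvgM (cF _ Ux) (cH _ Ux)).
move=> CF CH; have [cF dF] := CF; have [cH dH] := CH; split.
  by move=> x Ux; exact: (cvgM (cF _ Ux) (cH _ Ux)).
move=> i; have [dF1 dF2] := dF i; have [dH1 dH2] := dH i; split.
  by move=> x Ux; exact: (derivableM (dF1 _ Ux) (dH1 _ Ux)).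
apply: (@Ck_ext k U ((F \* pd i H) \+ (H \* pd i F))) => //.
  move=> x Ux; rewrite /= /pd.
  by rewrite (deriveM (dF1 _ Ux) (dH1 _ Ux)).
by apply: CkD => //; apply: IH => //; exact: CkS.
Qed.

Lemma Ck_cst k U (c : R) : Ck k U (cst c).
Proof.
elim: k c => [|k IH] c; split => //; first by move=> x _; exact: cst_continuous.
  by move=> x _; exact: cst_continuous.
move=> i; split; first by move=> x _; exact: derivable_cst.
rewrite (_ : pd i (cst c) = cst 0)//.
by apply/funext => x; rewrite /pd derive_cst.
Qed.

Lemma CkV k U F : open U -> (forall x, U x -> F x != 0) ->
  Ck k U F -> Ck k U (fun x => (F x)^-1).
Proof.
move=> oU F0; elim: k F F0 => [|k IH] F F0.
  by move=> [cF _]; split => // x Ux; exact: (cvgV (F0 _ Ux) (cF _ Ux)).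
move=> CF; have [cF dF] := CF; split.
  by move=> x Ux; exact: (cvgV (F0 _ Ux) (cF _ Ux)).
move=> i; have [dF1 dF2] := dF i; split.
  by move=> x Ux; exact: (derivableV (F0 _ Ux) (dF1 _ Ux)).
apply: (@Ck_ext k U (cst (-1) \* (pd i F \* ((fun x => (F x)^-1) \* (fun x => (F x)^-1))))) => //.
  move=> x Ux; rewrite /= /pd.
  have := deriveV (F0 _ Ux) (dF1 _ Ux); rewrite -[X in 'D_ _ X x]/(fun x => (F x)^-1) => ->.
  by rewrite mulN1r scaleNr -exprVn /GRing.scale/= expr2 mulrC.
have CV := IH _ F0 (CkS CF).
by apply: CkM => //; [exact: Ck_cst|apply: CkM => //; apply: CkM].
Qed.

Lemma smooth_ext U F H : open U -> (forall y, U y -> F y = H y) ->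
  smooth_on U F -> smooth_on U H.
Proof. by move=> oU FH sF k; exact: Ck_ext oU FH (sF k). Qed.

Lemma smooth_pd U F i : smooth_on U F -> smooth_on U (pd i F).
Proof. by move=> sF k; have [_ /(_ i)[]] := sF k.+1. Qed.

Lemma smooth_sub U V F : V `<=` U -> smooth_on U F -> smooth_on V F.
Proof. by move=> VU sF k; exact: Ck_sub VU (sF k). Qed.

Lemma Ck_sum (I : Type) (r : seq I) (P : pred I) k U (F : I -> 'rV[R]_n -> R) : open U ->
  (forall i, P i -> Ck k U (F i)) -> Ck k U (fun x => \sum_(i <- r | P i) F i x).
Proof.
move=> oU CF; elim: r => [|i r IH].
  by apply: Ck_ext oU _ (@Ck_cst k U 0) => x _; rewrite big_nil.
have [Pi|Pi] := boolP (P i).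
  by apply: Ck_ext oU _ (CkD oU (CF i Pi) IH) => x _ /=; rewrite big_cons Pi.
by apply: Ck_ext oU _ IH => x _ /=; rewrite big_cons (negbTE Pi).
Qed.

Lemma Ck_prod (I : Type) (r : seq I) (P : pred I) k U (F : I -> 'rV[R]_n -> R) : open U ->
  (forall i, P i -> Ck k U (F i)) -> Ck k U (fun x => \prod_(i <- r | P i) F i x).
Proof.
move=> oU CF; elim: r => [|i r IH].
  by apply: Ck_ext oU _ (@Ck_cst k U 1) => x _; rewrite big_nil.
have [Pi|Pi] := boolP (P i).
  by apply: Ck_ext oU _ (CkM oU (CF i Pi) IH) => x _ /=; rewrite big_cons Pi.
by apply: Ck_ext oU _ IH => x _ /=; rewrite big_cons (negbTE Pi).
Qed.

End PartialDerivatives.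

(** [differentiable] speaks of a differential selected by [get]; one continuous linear candidate
    with the right remainder suffices, through [getPex]. *)
Lemma differentiable_littleo (K : numFieldType) (V W : normedModType K) (f : V -> W)
    (df : {linear V -> W}) (x : V) : continuous df ->
  (forall e : K, 0 < e -> \forall h \near (0 : V),
     `|f (h + x) - f x - df h| <= e * `|h|) -> differentiable f x.
Proof.
move=> cdf fdf.
have dxf : f \o shift x = cst (f x) + df +o_ (0 : V) id.
  apply/eqaddoP => e e0; have := fdf _ e0.
  apply: filterS => h H; change (`|f (h + x) - (f x + df h)| <= e * `|h|).
  by rewrite opprD addrA.
apply/diffP => /=.
apply: (@getPex _ (fun (df : {linear V -> W}) => continuous df /\
  forall y, f y = f (lim (nbhs x)) + df (y - lim (nbhs x))
                  +o_(y \near x) (y - lim (nbhs x)))).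
exists df; split => //.
apply: eqaddoEx => y.
rewrite lim_id // -[in LHS](subrK x y) -[LHS]/((f \o shift x) (y - x)) dxf.
congr (_ + _).
rewrite -(comp_centerK x id) -[X in the_littleo _ _ _ X](comp_centerK x).
by rewrite -[_ (y - x)]/((_ \o (center x)) y) -littleo_center0.
Qed.

(** * Continuous partial derivatives imply differentiability *)

Section C1Functions.
Variables (R : realType) (n : nat).
Implicit Types (F H : 'rV[R]_n -> R) (U : set 'rV[R]_n) (x v : 'rV[R]_n).

Lemma rV_coord_le v i : `|v 0 i| <= `|v|.
Proof.
rewrite [`|v|]/Num.norm/= mx_normrE.
exact: (le_bigmax_cond _ (j := (0, i)) (fun ij : 'I_1 * 'I_n => `|v ij.1 ij.2|)).
Qed.

Lemma rV_norm_le v (r : R) : 0 <= r -> (forall i, `|v 0 i| <= r) -> `|v| <= r.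
Proof.
move=> r0 vr; rewrite [`|v|]/Num.norm/= mx_normrE.
by apply: bigmax_le => //= -[i j] _ /=; rewrite (ord1 i).
Qed.

(** The walk from [x] to [h + x] changes one coordinate at a time, and [prefix_row k h + x] is its
    k-th corner. *)
Definition prefix_row (k : nat) v : 'rV[R]_n := \row_i (if (i < k)%N then v 0 i else 0).

Lemma prefix_row0 v : prefix_row 0 v = 0.
Proof. by apply/rowP => i; rewrite !mxE. Qed.

Lemma prefix_row_full v : prefix_row n v = v.
Proof. by apply/rowP => i; rewrite !mxE ltn_ord. Qed.

Lemma prefix_rowS (k : 'I_n) v :
  prefix_row k.+1 v = v 0 k *: delta_mx 0 k + prefix_row k v.
Proof.
apply/rowP => i; rewrite !mxE eqxx/= ltnS leq_eqVlt.
have [->|ik] := eqVneq i k; first by rewrite eqxx ltnn mulr1 addr0.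
by rewrite -(inj_eq val_inj) in ik; rewrite (negbTE ik)/= mulr0 add0r.
Qed.

Definition pd_linear F x v : R := \sum_i v 0 i * pd i F x.

Lemma pd_linear_linear F x : linear (pd_linear F x).
Proof.
move=> a u v; rewrite /pd_linear scaler_sumr -big_split/=; apply: eq_bigr => i _.
by rewrite !mxE mulrDl scalerAl.
Qed.

Let pack_linear (f : 'rV[R]_n -> R) (lf : linear f) : {linear 'rV[R]_n -> R}
  := HB.pack f (GRing.isLinear.Build _ _ _ _ _ lf).

(** Telescope along the corners given by [prefix_row]. On each edge the mean value theorem gives a
    partial derivative at a nearby point, and continuity compares it with the one at [x]. *)
Lemma C1_increment U F x : open U -> Ck 1 U F -> U x ->
  forall e : R, 0 < e -> \forall h \near (0 : 'rV[R]_n),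
    `|F (h + x) - F x - pd_linear F x h| <= e * `|h|.
Proof.
move=> oU [cF dF] Ux e e0.
(* There are n edges, each with error at most e' |h|; the divisor n + 1 also covers n = 0. *)
pose e' := e / n.+1%:R; have e'0 : 0 < e' by rewrite divr_gt0.
have : \forall y \near x, U y /\ forall i : 'I_n, `|pd i F x - pd i F y| < e'.
  have N1 : \forall y \near x, U y by apply: (near_open oU Ux).
  have N2 : \forall y \near x, forall i : 'I_n, `|pd i F x - pd i F y| < e'.
    apply: (@filter_forall _ _ (fun i y => `|pd i F x - pd i F y| < e') (nbhs x)) => i; have [_ [ci _]] := dF i.
    by have /cvgrPdist_lt /(_ _ e'0) := ci _ Ux.
  by apply: filterS2 N1 N2 => y; split.
move/nbhs_ballP => [d /= d0 dball].
apply/nbhs_ballP; exists d => // h; rewrite -ball_normE/= sub0r normrN => hd.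
have Ballh y : `|y| <= `|h| -> U (y + x) /\ forall i, `|pd i F x - pd i F (y + x)| < e'.
  move=> yh; apply: dball; rewrite -ball_normE /ball_/=.
  by rewrite opprD addrCA subrr addr0 normrN (le_lt_trans yh).
have step (k : 'I_n) : `|F (prefix_row k.+1 h + x) - F (prefix_row k h + x)
   - h 0 k * pd k F x| <= e' * `|h|.
  have small s : `|s| <= `|h 0 k| -> `|s *: delta_mx 0 k + prefix_row k h| <= `|h|.
    move=> sh; apply: rV_norm_le => // i; rewrite !mxE eqxx/=.
    have [->|ik] := eqVneq i k.
      by rewrite ltnn mulr1 addr0 (le_trans sh)// rV_coord_le.
    by rewrite mulr0 add0r; case: ifP => _; rewrite ?normr0// rV_coord_le.
  rewrite prefix_rowS -[_ + _ + x]addrA.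
  have [|s sh ->] := @MVT_line _ _ F (prefix_row k h + x) (delta_mx 0 k) (h 0 k).
    move=> s /small /Ballh; rewrite addrA => -[Us _].
    by have [d1 _] := dF k; exact: (d1 _ Us).
  rewrite -mulrBr normrM mulrC addrA ler_pM//; last exact: rV_coord_le.
  by rewrite distrC ltW//; case: (Ballh _ (small _ sh)).
rewrite (_ : F (h + x) - F x - _ = \sum_(k < n)
   (F (prefix_row k.+1 h + x) - F (prefix_row k h + x) - h 0 k * pd k F x)).
  apply: le_trans (ler_norm_sum _ _ _) _.
  apply: (@le_trans _ _ (\sum_(k < n) e' * `|h|)); first exact: ler_sum.
  rewrite sumr_const card_ord -mulrnAl ler_wpM2r// /e' -mulr_natr mulrAC.
  by rewrite ler_pdivrMr// ler_wpM2l ?ltW// ltr_nat.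
rewrite sumrB; congr (_ - _).
rewrite -(big_mkord xpredT (fun k => F (prefix_row k.+1 h + x) - F (prefix_row k h + x))).
by rewrite telescope_sumr// prefix_row_full prefix_row0 add0r.
Qed.

Lemma pd_linear_continuous F x : continuous (pd_linear F x).
Proof.
move=> v; rewrite /pd_linear.
pose G i (w : 'rV[R]_n) := w 0 i * pd i F x.
have CG i : Ck 0 setT (G i).
  split => // w _; apply: (@cvgMr_tmp R _ (nbhs w) _ (fun w : 'rV[R]_n => w 0 i)).
  exact: (@coord_continuous R 1 n 0 i w).
by have [+ _] := @Ck_sum R n 'I_n (index_enum 'I_n) xpredT 0 setT G openT (fun i _ => CG i); apply.
Qed.

Lemma C1_differentiable U F x : open U -> Ck 1 U F -> U x -> differentiable F x.
Proof.
move=> oU CF Ux; pose df := pack_linear (pd_linear_linear F x).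
have dfE v : df v = pd_linear F x v by [].
apply: (@differentiable_littleo R 'rV[R]_n R F df x).
  exact: pd_linear_continuous.
by move=> e e0; exact: C1_increment oU CF Ux _ e0.
Qed.

End C1Functions.

(** * The chain rule *)

Section ChainRule.
Variables (R : realType).

Lemma C1_derive n U (F : 'rV[R]_n -> R) x v : open U -> Ck 1 U F -> U x ->
  'd F x v = \sum_b v 0 b * pd b F x.
Proof.
move=> oU CF Ux; have dF := C1_differentiable oU CF Ux.
rewrite [in LHS](row_sum_delta v) linear_sum; apply: eq_bigr => b _.
by rewrite linearZ/= /pd deriveE.
Qed.

Lemma is_derive_comp_C1 n U (F : 'rV[R]_n -> R) (c : R -> 'rV[R]_n) (t : R) (dc : 'rV[R]_n) :
  open U -> Ck 1 U F -> U (c t) ->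
  (forall b, is_derive t 1 (fun s => c s 0 b) (dc 0 b)) ->
  is_derive t 1 (F \o c) (\sum_b dc 0 b * pd b F (c t)).
Proof.
move=> oU CF Ux Dc.
have dF := C1_differentiable oU CF Ux.
have dc1 : derivable c t 1.
  by apply/derivable_mxP => i j; rewrite (ord1 i); case: (Dc j).
have dcd : differentiable c t by exact/derivable1_diffP.
have dFc : differentiable (F \o c) t by exact: differentiable_comp.
split; first exact/derivable1_diffP.
rewrite deriveE// diff_comp//=.
have -> : 'd c t 1 = 'D_1 c t by rewrite deriveE.
rewrite (C1_derive _ oU CF Ux) derive_mx//.
by apply: eq_bigr => b _; rewrite mxE; case: (Dc b) => _ ->.
Qed.

Lemma is_derive_pd n (F : 'rV[R]_n -> R) x v : derivable F x v ->
  is_derive (0 : R) 1 (fun s => F (s *: v + x)) ('D_v F x).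
Proof. by move=> dF; have := @is_derive_line R n F x v 0; rewrite scale0r add0r; apply. Qed.

Lemma pd_is_derive n (F : 'rV[R]_n -> R) x v d :
  is_derive (0 : R) 1 (fun s => F (s *: v + x)) d -> is_derive x v F d.
Proof.
move=> [d1 d2]; have dF : derivable F x v by exact/derivable1P.
by split => //; have [_ <-] := is_derive_pd dF.
Qed.

(** Only the restriction of [tau] to a coordinate line matters, so the rule for curves applies. *)
Lemma pd_comp m n U (F : 'rV[R]_n -> R) (tau : 'rV[R]_m -> 'rV[R]_n) x a :
  open U -> Ck 1 U F -> U (tau x) ->
  (forall b, derivable (fun y => tau y 0 b) x (delta_mx 0 a)) ->
  is_derive x (delta_mx 0 a : 'rV_m) (F \o tau)
    (\sum_b pd a (fun y => tau y 0 b) x * pd b F (tau x)).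
Proof.
move=> oU CF Ux Dtau; apply: pd_is_derive.
pose c (s : R) := tau (s *: delta_mx 0 a + x).
have c0 : c 0 = tau x by rewrite /c scale0r add0r.
have := @is_derive_comp_C1 n U F c 0 (\row_b pd a (fun y => tau y 0 b) x) oU CF.
rewrite c0; under eq_bigr do rewrite mxE; apply => // b.
by rewrite mxE; exact: is_derive_pd.
Qed.

Lemma pd_comp1 n (F : 'rV[R]_n -> R) (phi : R -> R) x v (d : R) :
  derivable F x v -> is_derive (F x) 1 phi d ->
  is_derive x v (phi \o F) (d * 'D_v F x).
Proof.
move=> dF dphi; apply: pd_is_derive.
have := is_derive_pd dF; set f := fun s : R => F _ => df.
have f0 : f 0 = F x by rewrite /f scale0r add0r.
rewrite -f0 in dphi.
exact: (is_derive1_comp dphi df).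
Qed.

(** Serves the real powers in the densities and the profile of the bump functions, both handled at
    class C^1. *)
Lemma C1_comp1 n U (F : 'rV[R]_n -> R) (phi dphi : R -> R) : open U -> Ck 1 U F ->
  (forall x, U x -> is_derive (F x) 1 phi (dphi (F x))) ->
  (forall x, U x -> {for F x, continuous dphi}) ->
  Ck 1 U (phi \o F) /\ (forall i x, U x -> pd i (phi \o F) x = dphi (F x) * pd i F x).
Proof.
move=> oU [cF dF] Dphi cdphi.
have dE i x : U x -> is_derive x (delta_mx 0 i : 'rV_n) (phi \o F) (dphi (F x) * pd i F x).
  by move=> Ux; apply: pd_comp1; [exact: (dF i).1|exact: Dphi].
have pE i x : U x -> pd i (phi \o F) x = dphi (F x) * pd i F x.
  by move=> Ux; have [_ <-] := dE i x Ux.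
split => //; split.
  move=> x Ux; apply: continuous_comp; first exact: cF.
  apply: differentiable_continuous; apply/derivable1_diffP.
  by have [] := Dphi _ Ux.
move=> i; split; first by move=> x Ux; have [] := dE i x Ux.
apply: (@Ck_ext _ _ 0 U ((dphi \o F) \* pd i F)) => //.
  by move=> y Uy; rewrite pE.
apply: CkM => //; last by have [_ []] := dF i.
by split => // x Ux; apply: continuous_comp; [exact: cF|exact: cdphi].
Qed.

End ChainRule.

(** * Symmetry of second derivatives *)

Section Clairaut.
Variables (R : realType) (n : nat).
Implicit Types (F H : 'rV[R]_n -> R) (U : set 'rV[R]_n) (x v : 'rV[R]_n).

Lemma derivable_shift F x v w : derivable F (w + x) v ->
  is_derive x v (fun y => F (w + y)) ('D_v F (w + x)).
Proof.
have E : (fun h : R => h^-1 *: (((fun y => F (w + y)) \o shift x) (h *: v) - F (w + x))) =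
         (fun h : R => h^-1 *: ((F \o shift (w + x)) (h *: v) - F (w + x))).
  by apply/funext => h /=; rewrite addrCA.
by move=> dF; split; rewrite /derivable /derive E.
Qed.

Lemma norm_delta_mx_le (i : 'I_n) : `|delta_mx 0 i : 'rV[R]_n| <= 1.
Proof.
apply: rV_norm_le => // j; rewrite mxE eqxx/=.
by case: eqP; rewrite ?normr1 ?normr0.
Qed.

Lemma norm_scale_delta (s h : R) (i : 'I_n) : `|s| <= h ->
  `|s *: delta_mx 0 i : 'rV[R]_n| <= h.
Proof.
move=> sh; rewrite normrZ -[h]mulr1 ler_pM//; exact: norm_delta_mx_le.
Qed.

(** The mean value theorem is used twice: in direction i on the increment across
    [h *: delta_mx 0 j], then in direction j on [pd i F]. The intermediate point moves by at most h
    along each of the two axes, whence the radius h + h. *)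
Lemma second_difference U F x (i j : 'I_n) (h : R) : Ck 2 U F -> 0 < h ->
  (forall w, `|w| <= h + h -> U (w + x)) ->
  exists2 w, `|w| <= h + h &
   (F (h *: delta_mx 0 j + (h *: delta_mx 0 i + x)) - F (h *: delta_mx 0 i + x))
   - (F (h *: delta_mx 0 j + x) - F x) = h ^+ 2 * pd j (pd i F) (w + x).
Proof.
move=> [_ dF] h0 hU.
have [dFi [cFi dFij]] := dF i; have [dFij1 _] := dFij j.
pose G y := F (h *: delta_mx 0 j + y) - F y.
have GU s t : `|s| <= h -> `|t| <= h -> U (t *: delta_mx 0 j + (s *: delta_mx 0 i + x)).
  move=> sh th; rewrite addrA; apply: hU.
  by rewrite (le_trans (ler_normD _ _))// lerD// norm_scale_delta.
have hh : `|h| <= h by rewrite (ger0_norm (ltW h0)).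
have h00 : `|0 : R| <= h by rewrite normr0 (ltW h0).
have DG s : `|s| <= `|h| -> is_derive (s *: delta_mx 0 i + x) (delta_mx 0 i : 'rV_n) G
  (pd i F (h *: delta_mx 0 j + (s *: delta_mx 0 i + x)) - pd i F (s *: delta_mx 0 i + x)).
  rewrite (ger0_norm (ltW h0)) => sh.
  have U1 := GU s h sh hh; have := GU s 0 sh h00; rewrite scale0r add0r => U2.
  apply: is_deriveB; first by apply: derivable_shift; exact: dFi.
  by apply: derivableP; exact: dFi.
have [s /DG[]//|s sh] := @MVT_line R n G x (delta_mx 0 i) h.
have [_ ->] := DG s sh; rewrite (ger0_norm (ltW h0)) in sh.
have [t|t th ->] := @MVT_line R n (pd i F) (s *: delta_mx 0 i + x) (delta_mx 0 j) h.
  by rewrite (ger0_norm (ltW h0)) => th; apply: dFij1; exact: GU.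
rewrite (ger0_norm (ltW h0)) in th.
move=> E; exists (t *: delta_mx 0 j + s *: delta_mx 0 i).
  by rewrite (le_trans (ler_normD _ _))// lerD// norm_scale_delta.
by rewrite -[_ + _ + x]addrA expr2 -mulrA -E.
Qed.

Lemma dist_midpoint (a b z e : R) : `|a - z| < e / 2 -> `|b - z| < e / 2 -> `|a - b| <= e.
Proof.
rewrite !ltr_norml ler_norml => /andP[? ?] /andP[? ?].
by apply/andP; split; lra.
Qed.

Lemma pdC U F (i j : 'I_n) x : open U -> Ck 2 U F -> U x ->
  pd i (pd j F) x = pd j (pd i F) x.
Proof.
move=> oU CF Ux.
apply/eqP; rewrite -subr_eq0 -normr_le0; apply/ler_addgt0Pr => e e0; rewrite add0r.
have [_ dF] := CF.
have c1 : {for x, continuous (pd i (pd j F))}.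
  by have [_ [_ /(_ i)[_ [+ _]]]] := dF j; apply.
have c2 : {for x, continuous (pd j (pd i F))}.
  by have [_ [_ /(_ j)[_ [+ _]]]] := dF i; apply.
have e2 : 0 < e / 2 by rewrite divr_gt0.
have N1 : \forall y \near x, U y by apply: (near_open oU Ux).
have /cvgrPdist_lt /(_ _ e2) N2 := c1.
have /cvgrPdist_lt /(_ _ e2) N3 := c2.
have : nbhs x (U `&` ([set y | `|pd i (pd j F) x - pd i (pd j F) y| < e / 2] `&`
    [set y | `|pd j (pd i F) x - pd j (pd i F) y| < e / 2])).
  apply: filterI; first exact: N1.
  by apply: filterI; [exact: N2|exact: N3].
move/nbhs_ballP => [d /= d0 dball].
(* Makes h + h smaller than d. *)
pose h := d / 3; have h0 : 0 < h by rewrite divr_gt0.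
have hball w : `|w| <= h + h -> ball x d (w + x).
  move=> wh; rewrite -ball_normE /ball_/= opprD addrCA subrr addr0 normrN.
  by rewrite (le_lt_trans wh)// /h; lra.
have hU w : `|w| <= h + h -> U (w + x) by move=> /hball /dball /= [].
have [w wh E] := second_difference i j CF h0 hU.
have [w' wh' E'] := second_difference j i CF h0 hU.
(* The double difference of F is symmetric in i and j, so both mixed derivatives take a common value
   somewhere in the ball. *)
have EE : pd j (pd i F) (w + x) = pd i (pd j F) (w' + x).
  have h2 : h ^+ 2 != 0 by rewrite expf_eq0/= gt_eqF.
  apply: (mulfI h2); rewrite -E -E'.
  rewrite [in RHS]addrCA.
  by rewrite !opprB !addrA; ring.
have [/= _ [A _]] := dball _ (hball _ wh'); have [/= _ [_ B]] := dball _ (hball _ wh).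
rewrite EE in B.
exact: (dist_midpoint A B).
Qed.

End Clairaut.

(** * Bochner's formula in a commutative differential ring *)

(* [A] stands for the smooth functions on a chart, [D i] for the partial
   derivatives, [g] and [gi] for the matrices of the metric and of its inverse. *)
Section DifferentialRing.
Variables (A : comPzRingType) (n : nat) (D : 'I_n -> A -> A).
Hypothesis DD : forall i a b, D i (a + b) = D i a + D i b.
Hypothesis DM : forall i a b, D i (a * b) = D i a * b + a * D i b.
Hypothesis DC : forall i j a, D i (D j a) = D j (D i a).

Lemma D0 i : D i 0 = 0.
Proof. by apply: (@addrI _ (D i 0)); rewrite -DD !addr0. Qed.

Lemma DN i a : D i (- a) = - D i a.
Proof. by apply: (@addrI _ (D i a)); rewrite -DD !subrr D0. Qed.

Lemma D1 i : D i 1 = 0.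
Proof.
by apply: (@addrI _ (D i 1)); rewrite addr0 -[in RHS](mulr1 1) DM mulr1 mul1r.
Qed.

Lemma Dnat i k : D i k%:R = 0.
Proof. by elim: k => [|k IH]; rewrite ?D0// -addn1 natrD DD IH D1 addr0. Qed.

Lemma Dsum (I : Type) (r : seq I) (P : pred I) i (F : I -> A) :
  D i (\sum_(j <- r | P j) F j) = \sum_(j <- r | P j) D i (F j).
Proof. exact: (big_morph (D i) (DD i) (D0 i)). Qed.

Lemma Dprod (I : eqType) (r : seq I) i (F : I -> A) : uniq r ->
  D i (\prod_(j <- r) F j) = \sum_(k <- r) D i (F k) * \prod_(j <- r | j != k) F j.
Proof.
elim: r => [|x r IH] /=; first by rewrite !big_nil D1.
move=> /andP[xr ur]; rewrite !big_cons DM IH// mulr_sumr; congr (_ * _ + _).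
  rewrite eqxx/= big_seq [RHS]big_seq_cond; apply: eq_bigl => j.
  by have [jr|//] := boolP (j \in r); rewrite (memPn xr).
rewrite !big_seq; apply: eq_bigr => k kr; rewrite big_cons.
by rewrite eq_sym (memPn xr _ kr) mulrCA.
Qed.

Definition Dmx m p i (M : 'M[A]_(m, p)) : 'M[A]_(m, p) := \matrix_(a, b) D i (M a b).

Lemma DmxM m p q i (M : 'M[A]_(m, p)) (N : 'M[A]_(p, q)) :
  Dmx i (M *m N) = Dmx i M *m N + M *m Dmx i N.
Proof.
apply/matrixP => a b; rewrite !mxE Dsum -big_split/=.
by apply: eq_bigr => k _; rewrite DM !mxE.
Qed.

(** Jacobi's formula: the Leibniz rule differentiates one row at a time, and each resulting
    determinant is expanded along that row. *)
Lemma D_det i (M : 'M[A]_n) :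
  D i (\det M) = \sum_a \sum_b D i (M a b) * cofactor M a b.
Proof.
pose Ma a : 'M[A]_n := \matrix_(c, b) (if c == a then D i (M a b) else M c b).
transitivity (\sum_a \det (Ma a)); last first.
  apply: eq_bigr => a _; rewrite (expand_det_row _ a); apply: eq_bigr => b _.
  rewrite mxE eqxx; congr (_ * _); rewrite /cofactor; congr (_ * \det _).
  by apply/matrixP => c d; rewrite !mxE eq_sym (negbTE (neq_lift _ _)).
rewrite /determinant Dsum exchange_big/=; apply: eq_bigr => s _.
have sgn0 (b : bool) : D i ((-1) ^+ b) = 0.
  by case: b; rewrite ?expr1 ?expr0 ?DN D1 ?oppr0.
rewrite DM sgn0 mul0r add0r -mulr_sumr.
rewrite Dprod ?index_enum_uniq//; congr (_ * _); apply: eq_bigr => a _.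
rewrite [in RHS](bigD1 a)//= mxE eqxx; congr (_ * _); apply: eq_bigr => b ba.
by rewrite mxE (negbTE ba).
Qed.

Variables (g gi : 'M[A]_n) (half : A).
Hypothesis g_sym : g^T = g.
Hypothesis gi_sym : gi^T = gi.
Hypothesis giK : gi *m g = 1%:M.
Hypothesis halfE : half + half = 1.

Let gE i j : g i j = g j i. Proof. by rewrite -[in LHS]g_sym mxE. Qed.
Let giE i j : gi i j = gi j i. Proof. by rewrite -[in LHS]gi_sym mxE. Qed.

Let gK : g *m gi = 1%:M.
Proof. by rewrite -[LHS]trmxK trmx_mul g_sym gi_sym giK trmx1. Qed.

Definition chr k i j : A :=
  half * \sum_l gi k l * (D i (g j l) + D j (g i l) - D l (g i j)).

Lemma chrC k i j : chr k i j = chr k j i.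
Proof.
rewrite /chr; congr (_ * _); apply: eq_bigr => l _.
by rewrite (gE i j); congr (_ * (_ - _)); exact: addrC.
Qed.

(** The connection matrix in direction k: entry (i, j) is the i-th component of the covariant
    derivative of d_j along d_k. *)
Definition chr_mx k : 'M[A]_n := \matrix_(i, j) chr i k j.

Lemma g_chr k : g *m chr_mx k =
  \matrix_(m, j) (half * (D k (g j m) + D j (g k m) - D m (g k j))).
Proof.
pose T : 'M[A]_n := \matrix_(m, j) (half * (D k (g j m) + D j (g k m) - D m (g k j))).
have -> : chr_mx k = gi *m T.
  apply/matrixP => i j; rewrite !mxE /chr mulr_sumr; apply: eq_bigr => l _.
  by rewrite mxE mulrCA.
by rewrite mulmxA gK mul1mx.
Qed.

(** Metric compatibility of the Levi-Civita connection: after symmetrization four of the six terms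
    cancel in pairs, and the two halves add up to one. *)
Lemma Dmx_g k : Dmx k g = g *m chr_mx k + (g *m chr_mx k)^T.
Proof.
rewrite g_chr; apply/matrixP => i j; rewrite !mxE -mulrDr.
rewrite (gE j i) (gE k j) (gE k i).
rewrite (_ : _ + _ - _ + (_ + _ - _) = D k (g i j) + D k (g i j)); last by ring.
by rewrite mulrDr -mulrDl halfE mul1r.
Qed.

Lemma Dmx_gi k : Dmx k gi = - (chr_mx k *m gi) - (chr_mx k *m gi)^T.
Proof.
have : Dmx k (gi *m g) = 0.
  by rewrite giK; apply/matrixP => i j; rewrite !mxE Dnat.
rewrite DmxM => /eqP; rewrite addr_eq0 => /eqP E.
have -> : Dmx k gi = - (gi *m Dmx k g *m gi).
  by rewrite -[LHS]mulmx1 -gK mulmxA E mulNmx.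
rewrite Dmx_g [in LHS]trmx_mul g_sym mulmxDr mulmxDl opprD.
rewrite [X in - X + _](_ : _ = chr_mx k *m gi); last by rewrite mulmxA giK mul1mx.
rewrite [X in _ - X](_ : _ = gi *m (chr_mx k)^T); last by rewrite -!mulmxA gK mulmx1.
by rewrite trmx_mul gi_sym.
Qed.

Lemma D_gi k i j : D k (gi i j) =
  - \sum_l chr i k l * gi l j - \sum_l chr j k l * gi i l.
Proof.
have := congr1 (fun M : 'M[A]_n => M i j) (Dmx_gi k); rewrite !mxE => ->.
congr (- _ - _); apply: eq_bigr => l _; rewrite !mxE//.
by rewrite giE.
Qed.

(** Jacobi's formula with [\adj g = \det g *: gi], followed by the trace of metric compatibility. It
    makes the contracted Christoffel symbol the logarithmic derivative of the volume density. *)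
Lemma D_vol p : D p (\det g) = \det g * (\sum_l chr l l p + \sum_l chr l l p).
Proof.
have adj : \adj g = \det g *: gi.
  by rewrite -[LHS]mulmx1 -gK mulmxA mul_adj_mx mul_scalar_mx.
rewrite D_det.
transitivity (\det g * \sum_a \sum_b gi a b * D p (g a b)).
  rewrite mulr_sumr; apply: eq_bigr => a _; rewrite mulr_sumr; apply: eq_bigr => b _.
  have := congr1 (fun M : 'M[A]_n => M b a) adj; rewrite !mxE giE => ->.
  by rewrite mulrC mulrA.
congr (_ * _).
transitivity (\tr (gi *m Dmx p g)).
  rewrite /mxtrace; apply: eq_bigr => a _; rewrite mxE; apply: eq_bigr => b _.
  by rewrite mxE (gE b a).
rewrite Dmx_g mulmxDr mxtraceD mulmxA giK mul1mx trmx_mul g_sym.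
rewrite mxtrace_mulC -mulmxA gK mulmx1 mxtrace_tr /mxtrace.
by under eq_bigr do rewrite mxE chrC.
Qed.

Definition grad f m : A := \sum_j gi m j * D j f.

Definition hess f i j : A := D i (D j f) - \sum_k chr k i j * D k f.

(** Component m of the covariant derivative of the vector field V along d_i. *)
Definition cov (V : 'I_n -> A) i m : A := D i (V m) + \sum_p chr m i p * V p.

Definition lap f : A := \sum_i \sum_j gi i j * hess f i j.

Definition gam f h : A := \sum_i \sum_j gi i j * D i f * D j h.

Definition riem k l i j : A :=
  D i (chr k j l) - D j (chr k i l)
  + \sum_m (chr k i m * chr m j l - chr k j m * chr m i l).

Definition ric j l : A := \sum_k riem k l k j.

Lemma hessC f i j : hess f i j = hess f j i.
Proof. by rewrite /hess DC; under eq_bigr do rewrite chrC. Qed.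

Lemma cov_grad f i m : cov (grad f) i m = \sum_j gi m j * hess f i j.
Proof.
rewrite /cov /grad Dsum.
under eq_bigr do rewrite DM D_gi mulrDl !mulNr.
rewrite !big_split/= !sumrN.
rewrite (_ : \sum_p chr m i p * \sum_j gi p j * D j f =
   \sum_j (\sum_l chr m i l * gi l j) * D j f); last first.
  under eq_bigr do rewrite mulr_sumr; rewrite exchange_big/=.
  by apply: eq_bigr => j _; rewrite mulr_suml; apply: eq_bigr => l _; rewrite mulrA.
(* Of the two terms of [D_gi], the one acting on the upper index m cancels the connection term of
   [cov]; the other completes the second derivative of f to its Hessian. *)
have R4 (a b c : A) : - a - b + c + a = c - b by ring.
rewrite R4.
rewrite /hess; under [RHS]eq_bigr do rewrite mulrBr; rewrite sumrB; congr (_ - _).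
under eq_bigr do rewrite mulr_suml; rewrite exchange_big/=.
apply: eq_bigr => j _; rewrite mulr_sumr; apply: eq_bigr => l _.
by rewrite mulrCA mulrA.
Qed.

Lemma lap_cov f : lap f = \sum_l cov (grad f) l l.
Proof.
by rewrite /lap; apply: eq_bigr => i _; rewrite cov_grad.
Qed.

(** By [D_vol] the zeroth-order factor is the logarithmic derivative of the volume density, so this
    is the divergence form from which integration by parts starts. *)
Lemma lap_div f : lap f = \sum_l (D l (grad f l) + (\sum_m chr m m l) * grad f l).
Proof.
rewrite lap_cov /cov big_split [RHS]big_split/=; congr (_ + _).
rewrite exchange_big/=; apply: eq_bigr => l _; rewrite mulr_suml.
by apply: eq_bigr => m _.
Qed.

Lemma gam_gradl f h : gam f h = \sum_j grad f j * D j h.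
Proof.
rewrite /gam exchange_big; apply: eq_bigr => j _; rewrite /grad mulr_suml.
by apply: eq_bigr => i _; rewrite giE.
Qed.

Lemma D_gam k f h : D k (gam f h) =
  \sum_i grad h i * hess f k i + \sum_j grad f j * hess h k j.
Proof.
rewrite gam_gradl Dsum.
transitivity (\sum_j (cov (grad f) k j * D j h) + \sum_j grad f j * hess h k j).
  rewrite /cov /hess; under eq_bigr do rewrite DM.
  under [X in _ = X + _]eq_bigr do rewrite mulrDl.
  under [X in _ = _ + X]eq_bigr do rewrite mulrBr.
  rewrite sumrB !big_split/= -!addrA; congr (_ + _); rewrite addrCA.
  rewrite [X in X - _](_ : _ = \sum_j grad f j * \sum_k0 chr k0 k j * D k0 h).
    by rewrite subrr addr0.
  under eq_bigr do rewrite mulr_suml; rewrite exchange_big/=.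
  apply: eq_bigr => j _; rewrite mulr_sumr; apply: eq_bigr => l _.
  by rewrite mulrA [_ * grad f j]mulrC mulrA.
congr (_ + _); under eq_bigr do rewrite cov_grad mulr_suml.
rewrite exchange_big/=; apply: eq_bigr => i _; rewrite /grad mulr_suml.
by apply: eq_bigr => j _; rewrite giE mulrAC.
Qed.

Definition hess_grad f a b : A := \sum_k \sum_j grad a k * grad b j * hess f k j.

Lemma hess_gradC f a b : hess_grad f a b = hess_grad f b a.
Proof.
rewrite /hess_grad exchange_big/=; apply: eq_bigr => j _; apply: eq_bigr => i _.
by rewrite hessC [grad a i * _]mulrC.
Qed.

Lemma gam_gam a f b : gam a (gam f b) = hess_grad f a b + hess_grad b a f.
Proof.
rewrite gam_gradl /hess_grad -big_split/=; apply: eq_bigr => k _.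
rewrite D_gam mulrDr !mulr_sumr; congr (_ + _); apply: eq_bigr => j _;
  by rewrite mulrA.
Qed.

(** The right side involves only [gam], a first-order expression. Hence chart independence of the
    Laplacian follows from that of the pairing, and Hess omega (df, df) becomes accessible to
    integration by parts. *)
Lemma hess_polar f a b : hess_grad f a b + hess_grad f a b =
  gam a (gam f b) + gam b (gam f a) - gam f (gam a b).
Proof.
rewrite !gam_gam (hess_gradC f b a) (hess_gradC b a f) (hess_gradC a b f).
ring.
Qed.

(** Contracted commutation of covariant derivatives: the left side is the divergence, in the upper
    index, of the covariant derivative of V, and commuting the two derivatives produces the Ricci
    term. *)
Lemma ricci_identity (V : 'I_n -> A) i :
  \sum_l (D l (cov V i l) - \sum_m chr m l i * cov V m l + \sum_p chr l l p * cov V i p)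
   = \sum_l D i (cov V l l) + \sum_k ric i k * V k.
Proof.
(* The expansion is sorted by type: derivatives of Christoffel symbols ([dchr], [dchr']), second
   derivatives of V ([dd]), symbol times derivative of V ([s1], [s2]), and products of two symbols
   ([q1], [q2]). *)
pose dchr := \sum_l \sum_p D l (chr l i p) * V p.
pose dchr' := \sum_l \sum_p D i (chr l l p) * V p.
pose dd := \sum_l D l (D i (V l)).
pose s1 := \sum_l \sum_p chr l i p * D l (V p).
pose s2 := \sum_l \sum_p chr l l p * D i (V p).
pose q1 := \sum_l \sum_p chr l l p * \sum_q chr p i q * V q.
pose q2 := \sum_l \sum_m chr m l i * \sum_q chr l m q * V q.
have E1 : \sum_l D l (cov V i l) = dd + (dchr + s1).
  rewrite /cov /dd /dchr /s1 -!big_split/=; apply: eq_bigr => l _.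
  rewrite DD Dsum -big_split/=; congr (_ + _); apply: eq_bigr => p _; exact: DM.
have E2 : \sum_l D i (cov V l l) = dd + (dchr' + s2).
  rewrite /cov /dd /dchr' /s2 -!big_split/=; apply: eq_bigr => l _.
  rewrite DD Dsum -big_split/= DC; congr (_ + _); apply: eq_bigr => p _; exact: DM.
have E3 : \sum_l \sum_p chr l l p * cov V i p = s2 + q1.
  rewrite /cov /s2 /q1 -!big_split/=; apply: eq_bigr => l _.
  by rewrite -big_split/=; apply: eq_bigr => p _; rewrite mulrDr.
have E4 : \sum_l \sum_m chr m l i * cov V m l = s1 + q2.
  rewrite /cov /s1 /q2 [X in _ = X + _]exchange_big -!big_split/=; apply: eq_bigr => l _.
  rewrite -big_split/=; apply: eq_bigr => p _.
  by rewrite mulrDr (chrC p l i).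
have E5 : \sum_k ric i k * V k = dchr - dchr' + (q1 - q2).
  rewrite /ric /riem /dchr /dchr' /q1 /q2.
  under eq_bigr do rewrite mulr_suml; rewrite exchange_big/=.
  rewrite [X in _ = _ + (_ - X)]exchange_big/= -!sumrB -big_split/=.
  apply: eq_bigr => l _; rewrite -!sumrB.
  transitivity (\sum_p (D l (chr l i p) * V p - D i (chr l l p) * V p) +
     \sum_p \sum_m (chr l l m * chr m i p - chr l i m * chr m l p) * V p).
    rewrite -big_split/=; apply: eq_bigr => p _.
    by rewrite -mulr_suml -mulrBl -mulrDl.
  congr (_ + _); rewrite exchange_big/=; apply: eq_bigr => m _.
  rewrite !mulr_sumr -sumrB; apply: eq_bigr => p _.
  by rewrite !mulrA -mulrBl (chrC l m i).
rewrite big_split sumrB/= E1 E2 E3 E4 E5; ring.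
Qed.

(** Half the gradient of |X|^2 is the covariant derivative of X contracted with X, by symmetry of
    the Hessian. Its divergence consists of the trace of the squared covariant derivative and of a
    term treated by [ricci_identity]. *)
Lemma bochner f : lap (gam f f) =
  (gam f (lap f) + \sum_i \sum_k grad f i * grad f k * ric i k
   + \sum_l \sum_i cov (grad f) l i * cov (grad f) i l) *+ 2.
Proof.
pose X := grad f; pose H := cov X.
have gradu l : grad (gam f f) l = (\sum_i X i * H i l) *+ 2.
  rewrite {1}/grad; under eq_bigr do rewrite D_gam -mulr2n mulrnAr mulr_sumr.
  rewrite sumrMnl exchange_big/=; congr (_ *+ 2); apply: eq_bigr => i _.
  rewrite /H cov_grad mulr_sumr; apply: eq_bigr => k _.
  by rewrite mulrCA (hessC f k i).
have -> : lap (gam f f) = (\sum_l (D l (\sum_i X i * H i l) +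
     (\sum_m chr m m l) * \sum_i X i * H i l)) *+ 2.
  rewrite lap_div -sumrMnl; apply: eq_bigr => l _.
  by rewrite gradu mulrnAr mulrnDl !mulr2n DD.
congr (_ *+ 2).
(* Trading partial for covariant derivatives of X supplies the connection terms that complete the
   left side of [ricci_identity]. *)
have DX l i : D l (X i) = H l i - \sum_p chr i l p * X p by rewrite /H /cov addrK.
transitivity (\sum_l \sum_i H l i * H i l + \sum_i X i *
   (\sum_l (D l (H i l) - \sum_m chr m l i * H m l + \sum_p chr l l p * H i p))).
  have T1 : \sum_l D l (\sum_i X i * H i l) = \sum_l \sum_i H l i * H i l
     - \sum_l \sum_i (\sum_p chr i l p * X p) * H i l + \sum_i X i * \sum_l D l (H i l).
    under [X in _ = _ + X]eq_bigr do rewrite mulr_sumr.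
    rewrite [X in _ = _ + X]exchange_big/= -sumrB -big_split/=; apply: eq_bigr => l _.
    rewrite Dsum -sumrB -big_split/=; apply: eq_bigr => i _.
    by rewrite DM DX mulrBl.
  have T2 : \sum_l \sum_i (\sum_p chr i l p * X p) * H i l =
     \sum_i X i * \sum_l \sum_m chr m l i * H m l.
    under [RHS]eq_bigr do rewrite mulr_sumr.
    rewrite [RHS]exchange_big/=; apply: eq_bigr => l _.
    under eq_bigr do rewrite mulr_suml; rewrite exchange_big/=; apply: eq_bigr => p _.
    rewrite mulr_sumr; apply: eq_bigr => m _.
    by rewrite -mulrA mulrCA.
  have T3 : \sum_l (\sum_m chr m m l) * \sum_i X i * H i l =
     \sum_i X i * \sum_l \sum_p chr l l p * H i p.
    under eq_bigr do rewrite mulr_sumr; rewrite exchange_big/=; apply: eq_bigr => i _.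
    rewrite [in RHS]exchange_big/= mulr_sumr; apply: eq_bigr => l _.
    by rewrite mulrCA; congr (_ * _); exact: mulr_suml.
  rewrite big_split/= T1 T2 T3.
  rewrite [X in _ = _ + X](_ : _ = \sum_i X i * (\sum_l D l (H i l)) -
     \sum_i X i * (\sum_l \sum_m chr m l i * H m l) +
     \sum_i X i * (\sum_l \sum_p chr l l p * H i p)); first by ring.
  rewrite -sumrB -big_split/=; apply: eq_bigr => i _.
  by rewrite big_split sumrB/= mulrDr mulrBr.
rewrite addrC; congr (_ + _).
under eq_bigr do rewrite ricci_identity mulrDr.
rewrite big_split/=; congr (_ + _).
  rewrite gam_gradl; apply: eq_bigr => i _; congr (_ * _).
  by rewrite lap_cov Dsum.
apply: eq_bigr => i _; rewrite mulr_sumr; apply: eq_bigr => k _.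
by rewrite mulrCA mulrC.
Qed.

End DifferentialRing.

(** * Calculus in a chart *)

Section SmoothMatrices.
Variables (R : realType) (n : nat).
Variables (U : set 'rV[R]_n) (oU : open U).

Lemma smooth_det m k (M : 'rV[R]_n -> 'M[R]_m) :
  (forall a b, Ck k U (fun x => M x a b)) -> Ck k U (fun x => \det (M x)).
Proof.
move=> CM; rewrite /determinant; apply: Ck_sum => // s _.
apply: (@CkM _ _ k U (cst _)) => //; first exact: Ck_cst.
by apply: Ck_prod.
Qed.

Lemma smooth_invmx m k (M : 'rV[R]_n -> 'M[R]_m) :
  (forall x, U x -> \det (M x) != 0) ->
  (forall a b, Ck k U (fun x => M x a b)) ->
  forall a b, Ck k U (fun x => invmx (M x) a b).
Proof.
move=> M0 CM a b.
apply: (@Ck_ext _ _ k U ((fun x => (\det (M x))^-1) \* (fun x => cofactor (M x) b a))) => //.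
  move=> x Ux /=; rewrite /invmx unitmxE unitfE M0//.
  by rewrite !mxE.
apply: CkM => //; first by apply: CkV => //; exact: smooth_det.
rewrite /cofactor; apply: (@CkM _ _ k U (cst _)) => //; first exact: Ck_cst.
(* A cofactor is a determinant of size m - 1, so m has to be a successor before its entries can be
   named. *)
case: m M M0 CM a b => [|m] M M0 CM a b; first by case: a => -[].
apply: smooth_det => c d.
by apply: Ck_ext oU _ (CM (lift b c) (lift a d)) => x _; rewrite !mxE.
Qed.

End SmoothMatrices.

Section SmoothRing.
Variables (R : realType) (n : nat) (U : set 'rV[R]_n) (oU : open U).

(* The functions are cut off outside [U], so that equality in this ring is
   equality on [U]. *)
Record smf (oU : open U) := Smf {
  smf_fun :> 'rV[R]_n -> R;
  smf_smooth : smooth_on U smf_fun;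
  smf_out : forall x, ~ U x -> smf_fun x = 0 }.

Local Notation S := (smf oU).

Lemma smf_eq (a b : S) : (forall x, U x -> a x = b x) -> a = b.
Proof.
move=> ab; have E : smf_fun a = smf_fun b.
  apply/funext => x; have [Ux|nUx] := pselect (U x); first exact: ab.
  by rewrite !smf_out.
case: a b E {ab} => [f sf of_] [h sh oh] /= E.
subst h; congr Smf; exact: Prop_irrelevance.
Qed.

Definition cut (F : 'rV[R]_n -> R) (x : 'rV[R]_n) : R := if x \in U then F x else 0.

Lemma cutE F x : U x -> cut F x = F x.
Proof. by move=> Ux; rewrite /cut mem_set. Qed.

Lemma cut_smooth F : smooth_on U F -> smooth_on U (cut F).
Proof. by apply: smooth_ext => // x Ux; rewrite cutE. Qed.

Lemma cut_out F x : ~ U x -> cut F x = 0.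
Proof. by move=> Ux; rewrite /cut memNset. Qed.

Lemma mk_smf_ex F : smooth_on U F -> {a : S | forall x, U x -> a x = F x}.
Proof.
by move=> sF; exists (Smf oU (cut_smooth sF) (@cut_out F)) => x; exact: cutE.
Qed.

(* Obtained through opaque terms, so that unification never unfolds derivatives. *)
Definition mk_smf F (sF : smooth_on U F) : S := sval (mk_smf_ex sF).

Lemma mk_smfE F (sF : smooth_on U F) x : U x -> mk_smf sF x = F x.
Proof. exact: (svalP (mk_smf_ex sF)). Qed.

Lemma smoothD F H : smooth_on U F -> smooth_on U H -> smooth_on U (F \+ H).
Proof. by move=> sF sH k; exact: CkD. Qed.

Lemma smoothM F H : smooth_on U F -> smooth_on U H -> smooth_on U (F \* H).
Proof. by move=> sF sH k; exact: CkM. Qed.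

Lemma smooth_cst (c : R) : smooth_on U (cst c).
Proof. by move=> k; exact: Ck_cst. Qed.

Definition smf_add (a b : S) := mk_smf (smoothD (smf_smooth a) (smf_smooth b)).
Definition smf_mul (a b : S) := mk_smf (smoothM (smf_smooth a) (smf_smooth b)).
Definition smf_cst (c : R) : S := mk_smf (smooth_cst c).
Definition smf_opp (a : S) := smf_mul (smf_cst (-1)) a.

Lemma smf_addE a b x : U x -> smf_add a b x = a x + b x. Proof. exact: mk_smfE. Qed.
Lemma smf_mulE a b x : U x -> smf_mul a b x = a x * b x. Proof. exact: mk_smfE. Qed.
Lemma smf_cstE c x : U x -> smf_cst c x = c. Proof. exact: mk_smfE. Qed.
Lemma smf_oppE a x : U x -> smf_opp a x = -1 * a x.
Proof. by move=> Ux; rewrite smf_mulE// smf_cstE. Qed.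
Let smf_opE := (smf_addE, smf_oppE, smf_mulE, smf_cstE).

HB.instance Definition _ := gen_eqMixin S.
HB.instance Definition _ := gen_choiceMixin S.

Lemma smf_addA : associative smf_add.
Proof. by move=> a b c; apply: smf_eq => x Ux; rewrite !smf_opE// addrA. Qed.
Lemma smf_addC : commutative smf_add.
Proof. by move=> a b; apply: smf_eq => x Ux; rewrite !smf_opE// addrC. Qed.
Lemma smf_add0 : left_id (smf_cst 0) smf_add.
Proof. by move=> a; apply: smf_eq => x Ux; rewrite !smf_opE// add0r. Qed.
Lemma smf_addN : left_inverse (smf_cst 0) smf_opp smf_add.
Proof.
move=> a; apply: smf_eq => x Ux; by rewrite !smf_opE// mulN1r addNr.
Qed.
HB.instance Definition _ := GRing.isZmodule.Build S smf_addA smf_addC smf_add0 smf_addN.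

Lemma smf_mulA : associative smf_mul.
Proof. by move=> a b c; apply: smf_eq => x Ux; rewrite !smf_opE// mulrA. Qed.
Lemma smf_mulC : commutative smf_mul.
Proof. by move=> a b; apply: smf_eq => x Ux; rewrite !smf_opE// mulrC. Qed.
Lemma smf_mul1 : left_id (smf_cst 1) smf_mul.
Proof. by move=> a; apply: smf_eq => x Ux; rewrite !smf_opE// mul1r. Qed.
Lemma smf_mulD : left_distributive smf_mul smf_add.
Proof.
move=> a b c; apply: smf_eq => x Ux.
by rewrite !smf_opE// mulrDl.
Qed.
HB.instance Definition _ := GRing.Zmodule_isComPzRing.Build S
  smf_mulA smf_mulC smf_mul1 smf_mulD.

Section Eval.
Variables (x : 'rV[R]_n) (Ux : U x).

Lemma smfDE (a b : S) : (a + b) x = a x + b x.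
Proof. exact: mk_smfE. Qed.
Lemma smfME (a b : S) : (a * b) x = a x * b x.
Proof. exact: mk_smfE. Qed.
Lemma smf0E : (0 : S) x = 0.
Proof. exact: mk_smfE. Qed.
Lemma smf1E : (1 : S) x = 1.
Proof. exact: mk_smfE. Qed.
Lemma smfNE (a : S) : (- a) x = - a x.
Proof. by apply: (@addrI _ (a x)); rewrite -smfDE !subrr smf0E. Qed.
Lemma smf_cross (a b c d : S) : (a * b - c * d) x = a x * b x - c x * d x.
Proof. by rewrite smfDE smfNE (smfME a) (smfME c). Qed.
Lemma smf_sumE (I : Type) (r : seq I) (P : pred I) (F : I -> S) :
  (\sum_(i <- r | P i) F i) x = \sum_(i <- r | P i) F i x.
Proof. exact: (big_morph (fun a : S => a x) smfDE smf0E). Qed.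
Lemma smf_prodE (I : Type) (r : seq I) (P : pred I) (F : I -> S) :
  (\prod_(i <- r | P i) F i) x = \prod_(i <- r | P i) F i x.
Proof. exact: (big_morph (fun a : S => a x) smfME smf1E). Qed.
Lemma smf_detE m (M : 'M[S]_m) : (\det M) x = \det (\matrix_(i, j) M i j x).
Proof.
have sgnE (b : bool) : ((-1) ^+ b : S) x = (-1) ^+ b.
  by case: b; rewrite ?expr1 ?expr0 ?smfNE smf1E.
rewrite /determinant smf_sumE; apply: eq_bigr => s _; rewrite smfME smf_prodE sgnE.
by congr (_ * _); apply: eq_bigr => i _; rewrite mxE.
Qed.
Lemma smfMnE (a : S) k : (a *+ k) x = a x *+ k.
Proof. by elim: k => [|k IH]; rewrite ?smf0E// !mulrS smfDE IH. Qed.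
End Eval.

Lemma smfD_ex : {D : 'I_n -> S -> S | forall i (a : S) x, U x -> D i a x = pd i a x}.
Proof.
exists (fun i (a : S) => mk_smf (@smooth_pd R n U a i (smf_smooth a))) => i a x.
exact: mk_smfE.
Qed.

Definition smfD : 'I_n -> S -> S := sval smfD_ex.

Lemma smfDE_pd i (a : S) x : U x -> smfD i a x = pd i a x.
Proof. exact: (svalP smfD_ex i a x). Qed.

Lemma smf_derivable i (a : S) x : U x -> derivable a x (delta_mx 0 i).
Proof. by move=> Ux; have [_ /(_ i)[+ _]] := smf_smooth a 1; apply. Qed.

Lemma smfD_add i (a b : S) : smfD i (a + b) = smfD i a + smfD i b.
Proof.
apply: smf_eq => x Ux; rewrite smfDE// !smfDE_pd//.
have -> : pd i (a + b)%R x = pd i (a \+ b) x by apply: (pd_ext _ oU) => // y Uy; rewrite smfDE.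
by rewrite /pd (deriveD (@smf_derivable i a x Ux) (@smf_derivable i b x Ux)).
Qed.

Lemma smfD_mul i (a b : S) : smfD i (a * b) = smfD i a * b + a * smfD i b.
Proof.
apply: smf_eq => x Ux; rewrite smfDE// !smfME// !smfDE_pd//.
have -> : pd i (a * b)%R x = pd i (a \* b) x by apply: (pd_ext _ oU) => // y Uy; rewrite smfME.
rewrite /pd (deriveM (@smf_derivable i a x Ux) (@smf_derivable i b x Ux)).
by rewrite addrC; congr (_ + _); exact: mulrC.
Qed.

Lemma smfD_C i j (a : S) : smfD i (smfD j a) = smfD j (smfD i a).
Proof.
have E k l x : U x -> smfD k (smfD l a) x = pd k (pd l a) x.
  move=> Ux; rewrite smfDE_pd//; apply: (pd_ext k oU Ux) => y Uy.
  exact: smfDE_pd.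
apply: smf_eq => x Ux.
exact (etrans (E i j x Ux) (etrans (pdC i j oU (smf_smooth a 2) Ux) (esym (E j i x Ux)))).
Qed.

Section Metric.
Variable G : 'rV[R]_n -> 'M[R]_n.
Hypothesis G_smooth : forall a b, smooth_on U (fun x => G x a b).
Hypothesis G_sym : forall x, U x -> (G x)^T = G x.
Hypothesis G_det : forall x, U x -> \det (G x) != 0.

Let G_unit x : U x -> G x \in unitmx.
Proof. by move=> Ux; rewrite unitmxE unitfE G_det. Qed.

Lemma invmx_smooth a b : smooth_on U (fun x => invmx (G x) a b).
Proof. by move=> k; apply: smooth_invmx => //; move=> c d; exact: G_smooth. Qed.

Definition gmx : 'M[S]_n := \matrix_(a, b) mk_smf (G_smooth a b).
Definition gimx : 'M[S]_n := \matrix_(a, b) mk_smf (invmx_smooth a b).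
Definition hlf : S := smf_cst 2^-1.

Lemma gmx_sym : gmx^T = gmx.
Proof.
apply/matrixP => i j; rewrite !mxE; apply: smf_eq => x Ux.
by rewrite !mk_smfE// -[in LHS](G_sym Ux) mxE.
Qed.

Lemma gimx_sym : gimx^T = gimx.
Proof.
apply/matrixP => i j; rewrite !mxE; apply: smf_eq => x Ux.
by rewrite !mk_smfE// -[in LHS](G_sym Ux) -trmx_inv mxE.
Qed.

Lemma gimxK : gimx *m gmx = 1%:M.
Proof.
apply/matrixP => i j; rewrite !mxE; apply: smf_eq => x Ux.
rewrite smf_sumE//; have := congr1 (fun M : 'M[R]_n => M i j) (mulVmx (G_unit Ux)).
rewrite !mxE => E; rewrite smfMnE// smf1E// -E; apply: eq_bigr => k _.
by rewrite smfME// !mxE !mk_smfE.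
Qed.

Lemma hlfE : hlf + hlf = 1.
Proof.
apply: smf_eq => x Ux; rewrite smfDE// smf1E// mk_smfE//=.
by rewrite -[2^-1]div1r -splitr.
Qed.

Lemma gmxE a b x : U x -> gmx a b x = G x a b.
Proof. by move=> Ux; rewrite mxE mk_smfE. Qed.

Lemma gimxE a b x : U x -> gimx a b x = invmx (G x) a b.
Proof. by move=> Ux; rewrite mxE mk_smfE. Qed.

Local Notation chrS := (chr smfD gmx gimx hlf).

Lemma christoffelE k i j x : U x -> chrS k i j x = christoffel G k i j x.
Proof.
move=> Ux; rewrite /chr /christoffel smfME// smf_sumE// mk_smfE//.
congr (_ * _); apply: eq_bigr => l _; rewrite smfME// gimxE//.
congr (_ * _); rewrite smfDE// smfNE// smfDE// !smfDE_pd//.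
by congr (_ + _ - _); apply: (pd_ext _ oU) => // y Uy; rewrite gmxE.
Qed.

Lemma ricci_locE j l x : U x ->
  ric smfD gmx gimx hlf j l x = ricci_loc G x j l.
Proof.
move=> Ux; rewrite /ric /ricci_loc mxE smf_sumE//; apply: eq_bigr => k _.
rewrite /riem /riemann smfDE// smfDE// smfNE// smf_sumE// !smfDE_pd//.
congr (_ - _ + _); try by apply: (pd_ext _ oU) => // y Uy; rewrite christoffelE.
by apply: eq_bigr => m _; rewrite smf_cross// !christoffelE.
Qed.

Section Functions.
Variables (F : 'rV[R]_n -> R) (sF : smooth_on U F).

Lemma pd_mk i x : U x -> pd i (mk_smf sF) x = pd i F x.
Proof. by move=> Ux; apply: (pd_ext _ oU) => // y Uy; rewrite mk_smfE. Qed.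

Lemma smfD_mk i x : U x -> smfD i (mk_smf sF) x = pd i F x.
Proof. by move=> Ux; rewrite smfDE_pd// pd_mk. Qed.

Lemma smfD2_mk i j x : U x -> smfD i (smfD j (mk_smf sF)) x = pd i (pd j F) x.
Proof.
by move=> Ux; rewrite smfDE_pd//; apply: (pd_ext _ oU) => // y Uy; rewrite smfD_mk.
Qed.

Lemma hessE i j x : U x ->
  hess smfD gmx gimx hlf (mk_smf sF) i j x = hess_loc G F x i j.
Proof.
move=> Ux; rewrite /hess mxE smfDE// smfNE// smf_sumE// smfD2_mk//; congr (_ - _).
by apply: eq_bigr => k _; rewrite smfME// christoffelE// smfD_mk.
Qed.

Lemma lapE x : U x -> lap smfD gmx gimx hlf (mk_smf sF) x = laplace_loc G F x.
Proof.
move=> Ux; rewrite /lap /laplace_loc smf_sumE//; apply: eq_bigr => i _.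
rewrite smf_sumE//; apply: eq_bigr => j _.
by rewrite smfME// hessE// gimxE.
Qed.

Definition grad_loc x : 'rV[R]_n := \row_m \sum_j invmx (G x) m j * pd j F x.

Lemma gradE m x : U x -> grad smfD gimx (mk_smf sF) m x = grad_loc x 0 m.
Proof.
move=> Ux; rewrite /grad mxE smf_sumE//; apply: eq_bigr => j _.
by rewrite smfME// gimxE// smfD_mk.
Qed.

Lemma laplace_smooth : smooth_on U (laplace_loc G F).
Proof.
by apply: (smooth_ext oU _ (smf_smooth (lap smfD gmx gimx hlf (mk_smf sF)))) => y; exact: lapE.
Qed.

Lemma grad_smooth m : smooth_on U (fun x => grad_loc x 0 m).
Proof.
by apply: (smooth_ext oU _ (smf_smooth (grad smfD gimx (mk_smf sF) m))) => y; exact: gradE.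
Qed.

End Functions.

Section FunctionPairs.
Variables (F H : 'rV[R]_n -> R) (sF : smooth_on U F) (sH : smooth_on U H).

Lemma gamE x : U x ->
  gam smfD gimx (mk_smf sF) (mk_smf sH) x = pairing_loc G F H x.
Proof.
move=> Ux; rewrite /gam /pairing_loc smf_sumE//; apply: eq_bigr => i _.
rewrite smf_sumE//; apply: eq_bigr => j _.
by rewrite !smfME// gimxE// !smfD_mk.
Qed.

Lemma pairing_smooth : smooth_on U (pairing_loc G F H).
Proof.
by apply: (smooth_ext oU _ (smf_smooth (gam smfD gimx (mk_smf sF) (mk_smf sH)))) => y; exact: gamE.
Qed.

End FunctionPairs.
Arguments gamE {F H} sF sH [x].

Lemma mk_pairing F H (sF : smooth_on U F) (sH : smooth_on U H) (sFH : smooth_on U (pairing_loc G F H)) :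
  gam smfD gimx (mk_smf sF) (mk_smf sH) = mk_smf sFH.
Proof. by apply: smf_eq => x Ux; rewrite gamE// mk_smfE. Qed.

Lemma mk_laplace F (sF : smooth_on U F) (sL : smooth_on U (laplace_loc G F)) :
  lap smfD gmx gimx hlf (mk_smf sF) = mk_smf sL.
Proof. by apply: smf_eq => x Ux; rewrite lapE// mk_smfE. Qed.

Lemma hess_locC F x i j : smooth_on U F -> U x -> hess_loc G F x i j = hess_loc G F x j i.
Proof.
move=> sF Ux; rewrite -(hessE sF i j Ux) -(hessE sF j i Ux).
by rewrite (@hessC _ _ _ smfD_C gmx gimx hlf gmx_sym).
Qed.

Lemma laplace_loc_div F x : smooth_on U F -> U x ->
  laplace_loc G F x = \sum_l (pd l (fun y => grad_loc F y 0 l) x +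
    (\sum_m christoffel G m m l x) * grad_loc F x 0 l).
Proof.
move=> sF Ux; rewrite -(lapE sF)//.
rewrite (lap_div smfD_add smfD_mul gmx_sym gimx_sym gimxK hlfE) smf_sumE//.
apply: eq_bigr => l _; rewrite smfDE// smfME// smf_sumE// gradE// smfDE_pd//.
congr (_ + _ * _); last by apply: eq_bigr => m _; rewrite christoffelE.
by apply: (pd_ext _ oU) => // y Uy; rewrite gradE.
Qed.

Lemma pd_det_metric p x : U x -> pd p (fun y => \det (G y)) x =
  \det (G x) * (\sum_m christoffel G m m p x *+ 2).
Proof.
move=> Ux; have := congr1 (fun a : S => a x)
  (D_vol smfD_add smfD_mul gmx_sym gimx_sym gimxK hlfE p).
have detE y : U y -> (\det gmx) y = \det (G y).
  move=> Uy; rewrite smf_detE//; congr (\det _); apply/matrixP => i j.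
  by rewrite mxE gmxE.
rewrite smfDE_pd// smfME// detE// smfDE// smf_sumE// sumrMnl mulr2n.
under eq_bigr do rewrite christoffelE//; move=> <-.
by apply: (pd_ext _ oU) => // y Uy; rewrite detE.
Qed.

(** The Hessian with one index raised; the trace of its square is |Hess F|^2. *)
Definition cov_loc F x : 'M[R]_n := hess_loc G F x *m (invmx (G x)).

Lemma bochner_loc F x : smooth_on U F -> U x ->
  laplace_loc G (pairing_loc G F F) x =
  (pairing_loc G F (laplace_loc G F) x + qform (ricci_loc G x) (grad_loc F x)
    + \tr (cov_loc F x *m cov_loc F x)) *+ 2.
Proof.
move=> sF Ux.
have sL := laplace_smooth sF; have sP := pairing_smooth sF sF.
rewrite -(lapE sP)// -(mk_pairing sF sF sP).
rewrite (bochner smfD_add smfD_mul smfD_C gmx_sym gimx_sym gimxK hlfE) smfMnE//.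
rewrite smfDE// smfDE// (mk_laplace sF sL) gamE//; congr ((_ + _ + _) *+ 2).
  rewrite smf_sumE// /qform mxE; under [RHS]eq_bigr do rewrite mxE mulr_suml.
  rewrite [RHS]exchange_big/=; apply: eq_bigr => i _; rewrite smf_sumE//.
  apply: eq_bigr => k _; rewrite smfME// smfME// !gradE// ricci_locE//.
  by rewrite [(grad_loc F x)^T _ _]mxE mulrAC.
have covE i j : cov smfD gmx gimx hlf (grad smfD gimx (mk_smf sF)) i j x = cov_loc F x i j.
  rewrite (cov_grad smfD_add smfD_mul gmx_sym gimx_sym gimxK hlfE) smf_sumE// mxE.
  apply: eq_bigr => k _; rewrite smfME// gimxE// hessE// mulrC; congr (_ * _).
  by rewrite -[in LHS](G_sym Ux) -trmx_inv mxE.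
rewrite smf_sumE// /mxtrace; apply: eq_bigr => l _; rewrite smf_sumE// mxE.
by apply: eq_bigr => i _; rewrite smfME// !covE.
Qed.

Lemma hess_polar_loc F a b x : smooth_on U F -> smooth_on U a -> smooth_on U b -> U x ->
  (grad_loc a x *m hess_loc G F x *m (grad_loc b x)^T) 0 0 *+ 2 =
  pairing_loc G a (pairing_loc G F b) x + pairing_loc G b (pairing_loc G F a) x
   - pairing_loc G F (pairing_loc G a b) x.
Proof.
move=> sF sa sb Ux.
have sFb := pairing_smooth sF sb; have sFa := pairing_smooth sF sa.
have sab := pairing_smooth sa sb.
have := congr1 (fun c : S => c x) (hess_polar smfD_add smfD_mul smfD_C gmx_sym gimx_sym gimxK hlfE
  (mk_smf sF) (mk_smf sa) (mk_smf sb)).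
rewrite (mk_pairing sF sb sFb) (mk_pairing sF sa sFa) (mk_pairing sa sb sab).
rewrite smfDE// [in RHS]smfDE// [in RHS]smfDE// smfNE// !gamE// => <-.
rewrite -mulr2n; congr (_ *+ 2); rewrite smf_sumE// mxE.
under eq_bigr do rewrite mxE mulr_suml.
rewrite exchange_big/=; apply: eq_bigr => i _; rewrite smf_sumE//; apply: eq_bigr => j _.
by rewrite smfME// smfME// !gradE// hessE// [(grad_loc b x)^T _ _]mxE mulrAC.
Qed.

End Metric.
End SmoothRing.

(** * Positive definite forms and orthonormal frames *)

Section PositiveForms.
Variable R : realType.

(** Gram-Schmidt by induction on blocks: the Schur complement S of the corner entry is again
    positive definite, and a frame of S extends to one of G. The rows of [E] are the orthonormal
    vectors. *)
Lemma posdef_frame n (G : 'M[R]_n) : G^T = G -> (forall v, v != 0 -> 0 < qform G v) ->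
  exists E : 'M[R]_n, E *m G *m E^T = 1%:M.
Proof.
elim: n G => [|n IH] G Gs Gp; first by exists 0; rewrite !flatmx0; apply/matrixP => -[].
pose a := G 0 0; pose b : 'rV[R]_n := @ursubmx R 1 n 1 n G.
pose D : 'M[R]_n := @drsubmx R 1 n 1 n G.
have GE : G = block_mx a%:M b b^T D :> 'M[R]_(1 + n).
  rewrite -[LHS](@submxK R 1 n 1 n); congr block_mx.
    by apply/matrixP => i j; rewrite !ord1 !mxE eqxx mulr1n /a; congr (G _ _); exact: val_inj.
  by rewrite -[in LHS]Gs; apply/matrixP => i j; rewrite !mxE.
have a0 : 0 < a.
  have := Gp (delta_mx 0 0); rewrite /qform -rowE trmx_delta -colE !mxE; apply.
  by apply/eqP => /matrixP/(_ 0 0); rewrite !mxE eqxx => /eqP; rewrite oner_eq0.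
pose S := D - a^-1 *: (b^T *m b).
have Ss : S^T = S.
  have DD : D^T = D by rewrite /D -[in RHS]Gs; apply/matrixP => i j; rewrite !mxE.
  by rewrite /S linearB/= linearZ/= trmx_mul trmxK DD.
have qE (u : 'rV[R]_(1 + n)) :
    qform G u = (u *m (block_mx a%:M b b^T D : 'M[R]_(1 + n)) *m u^T) 0 0.
  by rewrite /qform GE.
have Sp v : v != 0 -> 0 < qform S v.
  (* The lift of v that is G-orthogonal to the first basis vector; G takes on it the value of S on
     v. *)
  move=> v0; pose w : 'rV[R]_(1 + n) := row_mx (- a^-1 *: (v *m b^T)) v.
  have w0 : w != 0.
    apply: contra v0 => /eqP w0; have := row_mxKr (- a^-1 *: (v *m b^T)) v.
    by rewrite -/w w0 => <-; apply/eqP/matrixP => i j; rewrite !mxE.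
  suff -> : qform S v = qform G w by exact: Gp.
  rewrite qE /w mul_row_block tr_row_mx mul_row_col.
  rewrite mul_mx_scalar scalerA mulrN mulfV ?gt_eqF// scaleN1r addNr mul0mx add0r.
  by rewrite -scalemxAl -mulmxA scaleNr scalemxAr -mulmxN -mulmxDr addrC.
have [E' E'S] := IH S Ss Sp.
pose s := (Num.sqrt a)^-1.
have s2 : s * a * s = 1.
  rewrite /s -{2}(sqr_sqrtr (ltW a0)) expr2.
  have sa : Num.sqrt a != 0 by rewrite gt_eqF// sqrtr_gt0.
  by rewrite mulKf// mulfV.
pose E : 'M[R]_(1 + n) := block_mx s%:M 0 (- a^-1 *: (E' *m b^T)) E'.
exists E; suff : E *m (block_mx a%:M b b^T D : 'M[R]_(1 + n)) *m E^T = 1%:M by rewrite GE.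
have -> : E *m (block_mx a%:M b b^T D : 'M[R]_(1 + n)) =
    block_mx (s * a)%:M (s *: b) 0 (E' *m S).
  rewrite /E mulmx_block !mul0mx !addr0 !mul_scalar_mx scale_scalar_mx.
  congr block_mx.
    by rewrite -scalemxAl mul_mx_scalar scalerA mulNr mulVf ?gt_eqF// scaleN1r addNr.
  by rewrite /S mulmxBr -scalemxAr mulmxA -scalemxAl scaleNr addrC.
rewrite /E tr_block_mx mulmx_block !mul0mx !add0r E'S.
rewrite tr_scalar_mx trmx0 !mulmx0 !addr0 scalar_mx_block; congr block_mx.
- by rewrite mul_scalar_mx scale_scalar_mx s2.
- rewrite linearZ/= trmx_mul trmxK mul_scalar_mx scalerA -scalemxAl -scalerDl.
  by rewrite mulrN mulfK ?gt_eqF// addNr scale0r.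
Qed.

Section Frame.
Variables (n : nat) (G : 'M[R]_n).
Hypotheses (Gs : G^T = G) (Gp : forall v, v != 0 -> 0 < qform G v).

Lemma posdef_unit : G \in unitmx.
Proof.
have [E /(congr1 (fun M => \det M))] := posdef_frame Gs Gp.
rewrite !det_mulmx det1 det_tr => d; rewrite unitmxE unitfE; apply/eqP => d0.
by move/eqP: d; rewrite d0 mulr0 mul0r eq_sym oner_eq0.
Qed.

Lemma posdef_det_gt0 : 0 < \det G.
Proof.
have [E /(congr1 (fun M => \det M))] := posdef_frame Gs Gp.
rewrite !det_mulmx det1 det_tr => d.
have E0 : \det E != 0.
  by apply/eqP => d0; move/eqP: d; rewrite d0 mulr0 eq_sym oner_eq0.
have : 0 < \det E ^+ 2 * \det G by rewrite (_ : _ * _ = 1) ?ltr01// -d; ring.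
by rewrite pmulr_rgt0// exprn_even_gt0.
Qed.

(** Turns traces against [invmx G] into ordinary traces in an orthonormal frame. *)
Lemma invmx_frame : exists E : 'M[R]_n, invmx G = E^T *m E.
Proof.
have [E EG] := posdef_frame Gs Gp; exists E.
have GU := posdef_unit.
have : E^T *m (E *m G) = 1%:M by exact: mulmx1C.
rewrite mulmxA => H; rewrite -[RHS]mulmx1 -(mulmxV GU) mulmxA H mul1mx//.
Qed.

Lemma invmx_sym : (invmx G)^T = invmx G.
Proof. by rewrite trmx_inv Gs. Qed.

Lemma sqr_sum_le (m : nat) (a : 'I_m -> R) :
  (\sum_i a i) ^+ 2 <= m%:R * \sum_i a i ^+ 2.
Proof.
case: m a => [|m] a; first by rewrite !big_ord0 mul0r expr0n.
set s := \sum_i a i; pose t := s / m.+1%:R.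
have m0 : m.+1%:R != 0 :> R by rewrite pnatr_eq0.
have : 0 <= \sum_i (a i - t) ^+ 2 by apply: sumr_ge0 => i _; exact: sqr_ge0.
have -> : \sum_i (a i - t) ^+ 2 = \sum_i a i ^+ 2 - s ^+ 2 / m.+1%:R.
  transitivity (\sum_i (a i ^+ 2 - (t + t) * a i + t ^+ 2)).
    by apply: eq_bigr => i _; ring.
  rewrite big_split sumrB/= -mulr_sumr -/s sumr_const card_ord -(mulr_natr (t ^+ 2)) /t.
  by field; rewrite -natr1 in m0.
rewrite subr_ge0 ler_pdivrMr ?ltr0n// mulrC; exact.
Qed.

(** In an orthonormal frame: Cauchy-Schwarz on the diagonal entries, after which the squares of the
    off-diagonal entries of the symmetric matrix [W] are dropped. *)
Lemma tr_sqr_ge (S : 'M[R]_n) : S^T = S ->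
  (\tr (S *m invmx G)) ^+ 2 <= n%:R * \tr (S *m invmx G *m (S *m invmx G)).
Proof.
move=> Ss; have [E GE] := invmx_frame; pose W := E *m S *m E^T.
have Ws : W^T = W by rewrite /W !trmx_mul trmxK Ss mulmxA.
have -> : \tr (S *m invmx G) = \tr W by rewrite GE mulmxA mxtrace_mulC mulmxA.
have -> : \tr (S *m invmx G *m (S *m invmx G)) = \tr (W *m W).
  rewrite GE [in LHS]mulmxA [in LHS]mulmxA [in LHS]mxtrace_mulC.
  by rewrite /W !mulmxA.
clearbody W; apply: le_trans (sqr_sum_le _) _; rewrite ler_wpM2l//; apply: ler_sum => i _.
rewrite mxE (bigD1 i)//= -expr2 lerDl; apply: sumr_ge0 => j _.
by rewrite -[in W i j]Ws [W^T _ _]mxE -expr2 sqr_ge0.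
Qed.

Lemma tr_psd_ge0 (S : 'M[R]_n) : qform_le 0 S -> 0 <= \tr (S *m invmx G).
Proof.
move=> S0; have [E ->] := invmx_frame.
rewrite mulmxA mxtrace_mulC mulmxA; apply: sumr_ge0 => i _.
have := S0 (row i E); rewrite /qform mulmx0 mul0mx mxE => /le_trans; apply.
rewrite (_ : _ 0 0 = (E *m S *m E^T) i i)//.
rewrite -row_mul tr_row [LHS]mxE [RHS]mxE; apply: eq_bigr => k _.
by rewrite [row _ _ _ _]mxE [col _ _ _ _]mxE.
Qed.

Lemma qform_inv_ge0 v : 0 <= qform (invmx G) v.
Proof.
have [E ->] := invmx_frame.
rewrite /qform (_ : _ *m v^T = (v *m E^T) *m (v *m E^T)^T); last first.
  by rewrite trmx_mul trmxK !mulmxA.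
rewrite mxE; apply: sumr_ge0 => i _.
by rewrite [(_ *m _)^T _ _]mxE -expr2 sqr_ge0.
Qed.

Lemma form_CS u v :
  ((u *m invmx G *m v^T) 0 0) ^+ 2 <= qform (invmx G) u * qform (invmx G) v.
Proof.
set p := _ 0 0; set q := qform _ u; set r := qform _ v.
have sw : (v *m invmx G *m u^T) 0 0 = p.
  rewrite /p -[in LHS](trmxK (v *m _ *m _)) mxE !trmx_mul trmxK invmx_sym.
  by rewrite mulmxA.
have expand s t : qform (invmx G) (s *: u + t *: v) = s ^+ 2 * q + (s * t) * p *+ 2 + t ^+ 2 * r.
  rewrite /qform linearD/= !linearZ/= !mulmxDl !mulmxDr -!scalemxAl -!scalemxAr !scalerA.
  have mxD (A B : 'M[R]_1) : (A + B) 0 0 = A 0 0 + B 0 0 by rewrite mxE.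
  have mxZ c (A : 'M[R]_1) : (c *: A) 0 0 = c * A 0 0 by rewrite mxE.
  by rewrite !mxD !mxZ sw -/p -/(qform _ u) -/(qform _ v) -/q -/r; ring.
have q0 : 0 <= q by exact: qform_inv_ge0.
have [qz|qn] := eqVneq q 0.
  have r0 : 0 <= r by exact: qform_inv_ge0.
  have [->|pn] := eqVneq p 0; first by rewrite expr0n/= mulr_ge0.
  (* If q = 0 and p is not 0, the form is affine along u; the coefficient is chosen so that its
     value is -1. *)
  have := qform_inv_ge0 (- (r + 1) / (p * 2) *: u + 1 *: v).
  rewrite expand qz mulr0 add0r mulr1 expr1n mul1r.
  rewrite (_ : _ + r = -1); first by rewrite ler0N1.
  by field.
have := qform_inv_ge0 (- p *: u + q *: v); rewrite expand.
rewrite (_ : _ + _ + _ = q * (q * r - p ^+ 2)); last by ring.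
by rewrite pmulr_rge0 ?lt_def ?qn// subr_ge0.
Qed.

End Frame.

End PositiveForms.

(** * Changes of charts *)

Section MatrixForms.
Variables (R : realType) (n : nat) (G : 'rV[R]_n -> 'M[R]_n).
Implicit Types F H : 'rV[R]_n -> R.

Definition pd_row F x : 'rV[R]_n := \row_i pd i F x.

Lemma pairing_mx F H x :
  pairing_loc G F H x = (pd_row F x *m invmx (G x) *m (pd_row H x)^T) 0 0.
Proof.
rewrite /pairing_loc exchange_big mxE; apply: eq_bigr => j _.
rewrite !mxE mulr_suml; apply: eq_bigr => i _.
by rewrite mxE [_ * pd i F x]mulrC.
Qed.

Lemma grad_mx F x : (G x)^T = G x -> grad_loc G F x = pd_row F x *m invmx (G x).
Proof.
move=> Gs; apply/rowP => m; rewrite !mxE; apply: eq_bigr => j _.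
by rewrite mxE mulrC -[in LHS]Gs -trmx_inv mxE.
Qed.

Lemma laplace_mx F x : (G x)^T = G x ->
  laplace_loc G F x = \tr (hess_loc G F x *m invmx (G x)).
Proof.
move=> Gs; rewrite /laplace_loc /mxtrace; apply: eq_bigr => i _; rewrite mxE.
apply: eq_bigr => j _; rewrite mulrC; congr (_ * _).
by rewrite -[in LHS]Gs -trmx_inv mxE.
Qed.

Lemma pairing_ext (U : set 'rV[R]_n) F H F' H' x : open U -> U x ->
  (forall y, U y -> F y = F' y) -> (forall y, U y -> H y = H' y) ->
  pairing_loc G F H x = pairing_loc G F' H' x.
Proof.
move=> oU Ux FF HH; rewrite /pairing_loc; apply: eq_bigr => i _; apply: eq_bigr => j _.
by rewrite (pd_ext i oU Ux FF) (pd_ext j oU Ux HH).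
Qed.

Lemma laplace_ext (U : set 'rV[R]_n) F F' x : open U -> U x ->
  (forall y, U y -> F y = F' y) -> laplace_loc G F x = laplace_loc G F' x.
Proof.
move=> oU Ux FF; rewrite /laplace_loc; apply: eq_bigr => i _; apply: eq_bigr => j _.
have E1 : pd i (pd j F) x = pd i (pd j F') x.
  by apply: (pd_ext i oU Ux) => y Uy; exact: pd_ext oU Uy FF.
suff -> : hess_loc G F x i j = hess_loc G F' x i j by [].
rewrite [LHS]mxE [RHS]mxE E1; congr (_ - _); apply: eq_bigr => k _.
by rewrite (pd_ext k oU Ux FF).
Qed.

End MatrixForms.

Section ChartChange.
Variables (R : realType) (n : nat) (V U : set 'rV[R]_n) (oV : open V) (oU : open U).
Variables (tau : 'rV[R]_n -> 'rV[R]_n) (G G' : 'rV[R]_n -> 'M[R]_n).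
Hypothesis tauU : forall p, V p -> U (tau p).
Hypothesis tau_smooth : forall b, smooth_on V (fun p => tau p 0 b).
Hypothesis G_smooth : forall a b, smooth_on V (fun x => G x a b).
Hypothesis G_sym : forall x, V x -> (G x)^T = G x.
Hypothesis G_det : forall x, V x -> \det (G x) != 0.
Hypothesis G'_smooth : forall a b, smooth_on U (fun x => G' x a b).
Hypothesis G'_sym : forall x, U x -> (G' x)^T = G' x.
Hypothesis G'_det : forall x, U x -> \det (G' x) != 0.
Hypothesis GG' : forall p, V p -> G p = jac tau p *m G' (tau p) *m (jac tau p)^T.
Implicit Types F H : 'rV[R]_n -> R.

Let tau_derivable p b a : V p -> derivable (fun y => tau y 0 b) p (delta_mx 0 a).
Proof. by move=> Vp; have [_ /(_ a)[+ _]] := tau_smooth b 1; apply. Qed.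

Lemma pd_chart F p a : Ck 1 U F -> V p ->
  is_derive p (delta_mx 0 a : 'rV_n) (F \o tau) (\sum_b jac tau p a b * pd b F (tau p)).
Proof.
move=> sF Vp.
have := @pd_comp R n n U F tau p a oU sF (tauU Vp) (fun b => @tau_derivable p b a Vp).
by congr (is_derive _ _ _ _); apply: eq_bigr => b _; rewrite mxE.
Qed.

Lemma pd_row_chart F p : Ck 1 U F -> V p ->
  pd_row (F \o tau) p = pd_row F (tau p) *m (jac tau p)^T.
Proof.
move=> sF Vp; apply/rowP => a; rewrite [LHS]mxE.
have [_ E] := pd_chart a sF Vp; rewrite /pd E mxE.
by apply: eq_bigr => b _; rewrite [in RHS]mxE [in RHS]mxE mulrC.
Qed.

Lemma jac_unit p : V p -> jac tau p \in unitmx.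
Proof.
move=> Vp; have := G_det Vp; rewrite GG'// !det_mulmx !mulf_eq0 !negb_or.
by case/andP => /andP[J0 _] _; rewrite unitmxE unitfE.
Qed.

Let G'_unit p : V p -> G' (tau p) \in unitmx.
Proof. by move=> Vp; rewrite unitmxE unitfE; exact/G'_det/tauU. Qed.

Let G_unit p : V p -> G p \in unitmx.
Proof. by move=> Vp; rewrite unitmxE unitfE; exact/G_det. Qed.

Lemma invmx_chart p : V p ->
  (jac tau p)^T *m invmx (G p) *m jac tau p = invmx (G' (tau p)).
Proof.
move=> Vp; set J := jac tau p; set K := invmx (G p).
have JU : J \in unitmx := jac_unit Vp.
have H : K *m (J *m G' (tau p)) = invmx J^T.
  by rewrite -[LHS]mulmx1 -(mulmxV (_ : J^T \in unitmx)) ?unitmx_tr// mulmxA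
    -[K *m _ *m _]mulmxA -GG'// mulVmx ?G_unit// mul1mx.
rewrite -[RHS]mul1mx -(mulmxV (_ : J^T \in unitmx)) ?unitmx_tr// -H.
by rewrite !mulmxA -[RHS]mulmxA mulmxV ?G'_unit// mulmx1.
Qed.

Lemma pairing_chart F H p : Ck 1 U F -> Ck 1 U H -> V p ->
  pairing_loc G (F \o tau) (H \o tau) p = pairing_loc G' F H (tau p).
Proof.
move=> sF sH Vp; rewrite !pairing_mx !pd_row_chart// -invmx_chart//.
by rewrite trmx_mul trmxK !mulmxA.
Qed.

Lemma coord_pd (a b : 'I_n) (q : 'rV[R]_n) : pd b (fun q : 'rV[R]_n => q 0 a) q = (b == a)%:R.
Proof.
have := @derive_mx R 'rV[R]_n 1 n id q (delta_mx 0 b) (@derivable_id _ _ _ _).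
rewrite derive_id => /matrixP/(_ 0 a); rewrite !mxE eqxx/=.
by rewrite /pd [b == a]eq_sym => <-.
Qed.

Lemma coord_smooth (W : set 'rV[R]_n) a : smooth_on W (fun q : 'rV[R]_n => q 0 a).
Proof.
move=> [|k]; split => //; try by move=> x _; exact: coord_continuous.
move=> i; split.
  move=> x _; have /derivable_mxP := @derivable_id R 'rV[R]_n x (delta_mx 0 i).
  exact.
rewrite (_ : pd i _ = cst (i == a)%:R); first exact: Ck_cst.
by apply/funext => x; rewrite coord_pd.
Qed.

(** The coordinate functions [y a] of the target chart have gradients that span, so polarized
    pairings with them determine the whole Hessian. Pairings are invariant by [pairing_chart]. *)
Lemma laplace_chart F p : smooth_on U F -> smooth_on V (F \o tau) -> V p ->
  laplace_loc G (F \o tau) p = laplace_loc G' F (tau p).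
Proof.
move=> sF sFt Vp.
pose y a (q : 'rV[R]_n) := q 0 a.
have sy a : smooth_on U (y a) by exact: coord_smooth.
have syt a : smooth_on V (y a \o tau) by exact: tau_smooth.
have Utp := tauU Vp.
pose S := hess_loc G (F \o tau) p; pose S' := hess_loc G' F (tau p).
pose K := invmx (G p); pose K' := invmx (G' (tau p)); pose J := jac tau p.
have Ks : K^T = K by rewrite trmx_inv G_sym.
have K's : K'^T = K' by rewrite trmx_inv G'_sym.
have sP (A B : 'rV[R]_n -> R) : smooth_on U A -> smooth_on U B ->
    smooth_on U (pairing_loc G' A B).
  exact: (pairing_smooth oU G'_smooth G'_det).
have pairE (A B C : 'rV[R]_n -> R) q : smooth_on U A -> smooth_on U B -> smooth_on U C -> V q ->
    pairing_loc G (A \o tau) (pairing_loc G (B \o tau) (C \o tau)) q =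
    pairing_loc G' A (pairing_loc G' B C) (tau q).
  move=> sA sB sC Vq.
  have E1 z : V z -> (A \o tau) z = (A \o tau) z by [].
  have E2 z : V z -> pairing_loc G (B \o tau) (C \o tau) z = (pairing_loc G' B C \o tau) z.
    exact: pairing_chart (sB 1) (sC 1).
  by rewrite (pairing_ext G oV Vq E1 E2); exact: pairing_chart (sA 1) (sP B C sB sC 1) Vq.
(* Both sides are combinations of nested pairings of F, [y a] and [y b], and each of these is
   invariant. *)
have key a b : (grad_loc G (y a \o tau) p *m S *m (grad_loc G (y b \o tau) p)^T) 0 0 =
    (grad_loc G' (y a) (tau p) *m S' *m (grad_loc G' (y b) (tau p))^T) 0 0.
  have m2 (u v : R) : u *+ 2 = v *+ 2 -> u = v by move=> ?; lra.
  apply: m2; rewrite (hess_polar_loc oV G_smooth G_sym G_det sFt (syt a) (syt b) Vp).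
  rewrite (hess_polar_loc oU G'_smooth G'_sym G'_det sF (sy a) (sy b) Utp).
  by rewrite (pairE _ _ _ _ (sy a) sF (sy b) Vp) (pairE _ _ _ _ (sy b) sF (sy a) Vp)
    (pairE _ _ _ _ sF (sy a) (sy b) Vp).
have gradt a : grad_loc G (y a \o tau) p = row a (J^T *m K).
  rewrite grad_mx ?G_sym// (pd_row_chart (sy a 1) Vp) row_mul; congr (_ *m _).
  apply/rowP => c; rewrite !mxE (bigD1 a)//= mxE coord_pd eqxx mul1r mxE big1 ?addr0//.
  by rewrite mxE. 
  by move=> d da; rewrite mxE coord_pd (negbTE da) mul0r.
have gradl a : grad_loc G' (y a) (tau p) = row a K'.
  rewrite grad_mx ?G'_sym// rowE; congr (_ *m _).
  by apply/rowP => c; rewrite !mxE coord_pd eqxx.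
(* The entrywise identities assembled into one equality of matrices; the traces then agree by
   cyclicity and [GG']. *)
have KEY : J^T *m K *m S *m (J^T *m K)^T = K' *m S' *m K'^T.
  apply/matrixP => a b; have := key a b; rewrite !gradt !gradl.
  rewrite -[row a (_ *m _) *m S]row_mul -[row a K' *m S']row_mul !tr_row => E.
  transitivity ((row a (J^T *m K *m S) *m col b (J^T *m K)^T) 0 0).
    by rewrite [LHS]mxE [RHS]mxE; apply: eq_bigr => k _; rewrite [row _ _ _ _]mxE [col _ _ _ _]mxE.
  rewrite E [LHS]mxE [RHS]mxE; apply: eq_bigr => k _.
  by rewrite [row _ _ _ _]mxE [col _ _ _ _]mxE.
rewrite laplace_mx ?G_sym// laplace_mx ?G'_sym// -/S -/S' -/K -/K'.
have -> : S' *m K' = G' (tau p) *m (K' *m S' *m K'^T).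
  by rewrite K's !mulmxA mulmxV ?G'_unit// mul1mx.
rewrite -KEY trmx_mul trmxK Ks.
transitivity (\tr (G p *m K *m S *m K)); first by rewrite mulmxV ?G_unit// mul1mx.
by rewrite [in LHS]GG'// -!mulmxA mxtrace_mulC -!mulmxA.
Qed.

End ChartChange.

Section Charts.
Variables (R : realType) (n : nat) (M : smooth_manifold R n).
Variable g : riemannian_metric M.
Implicit Types (i j : chart_index M) (f h u : M -> R).

Definition overlap i j := cimg (atlas i) `&` cinv (atlas i) @^-1` cdom (atlas j).

Lemma overlap_open i j : open (overlap i j).
Proof.
rewrite openE => p [ip jp]; apply: filterI; first by apply: open_nbhs_nbhs; split => //; exact: cimg_open.
have := cinv_continuous ip; apply; apply: open_nbhs_nbhs; split => //; exact: cdom_open.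
Qed.

Definition transition i j p := cmap (atlas j) (cinv (atlas i) p).

Lemma transition_img i j p : overlap i j p -> cimg (atlas j) (transition i j p).
Proof. by case=> _; exact: cmap_img. Qed.

Lemma transition_rep i j f p : overlap i j p ->
  (f \o cinv (atlas i)) p = ((f \o cinv (atlas j)) \o transition i j) p.
Proof. by case=> _ jp; rewrite /= /transition cmapK. Qed.

Lemma chart_overlap i j x : cdom (atlas i) x -> cdom (atlas j) x ->
  overlap i j (cmap (atlas i) x).
Proof. by move=> ix jx; split; [exact: cmap_img|rewrite /preimage/= cmapK]. Qed.

Lemma chart_transition i j x : cdom (atlas i) x ->
  transition i j (cmap (atlas i) x) = cmap (atlas j) x.
Proof. by move=> ix; rewrite /transition cmapK. Qed.

Lemma gmat_det_gt0 i p : cimg (atlas i) p -> 0 < \det (gmat g i p).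
Proof. by move=> ip; apply: posdef_det_gt0 => [|v]; [exact: gmat_sym|exact: gmat_pos]. Qed.

Lemma gmat_det i p : cimg (atlas i) p -> \det (gmat g i p) != 0.
Proof. by move=> /gmat_det_gt0; rewrite lt_def => /andP[]. Qed.

(** Test functions are kept at class C^1 because the bump functions built below have no more
    regularity. *)
Definition C1_fun u : Prop := forall i, Ck 1 (cimg (atlas i)) (u \o cinv (atlas i)).

Lemma smooth_C1 f : smooth_fun f -> C1_fun f.
Proof. by move=> sf i; exact: sf. Qed.

Lemma C1M u h : C1_fun u -> C1_fun h -> C1_fun (u \* h).
Proof.
move=> Cu Ch i; have := CkM (@cimg_open _ _ _ (atlas i)) (Cu i) (Ch i); exact.
Qed.

Lemma C1D u h : C1_fun u -> C1_fun h -> C1_fun (u \+ h).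
Proof.
move=> Cu Ch i; have := CkD (@cimg_open _ _ _ (atlas i)) (Cu i) (Ch i); exact.
Qed.

Lemma C1_cst (c : R) : C1_fun (fun=> c).
Proof. by move=> i; exact: Ck_cst. Qed.

Lemma smooth_funM f h : smooth_fun f -> smooth_fun h -> smooth_fun (f \* h).
Proof. by move=> sf sh i k; have := CkM (@cimg_open _ _ _ (atlas i)) (sf i k) (sh i k); exact. Qed.

Lemma C1_continuous u : C1_fun u -> continuous u.
Proof.
move=> Cu x; have ix := chart_atP x; set i := chart_at x in ix.
have [cu _] := Cu i.
apply: (@continuous_ext M (cdom (atlas i)) R
  ((u \o cinv (atlas i)) \o cmap (atlas i)) u x) => //.
- exact: cdom_open.
- by move=> y iy /=; rewrite cmapK.
- apply: continuous_comp; first exact: cmap_continuous.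
  by apply: cu; exact: cmap_img.
Qed.

(** Replaces the chart chosen at x by any chart containing x, so that one fixed chart can serve on
    the whole support of a bump. *)
Lemma dpairingE i x u h : C1_fun u -> C1_fun h -> cdom (atlas i) x ->
  dpairing g u h x =
  pairing_loc (gmat g i) (u \o cinv (atlas i)) (h \o cinv (atlas i)) (cmap (atlas i) x).
Proof.
move=> Cu Ch ix; pose j := chart_at x.
have jx : cdom (atlas j) x := chart_atP x.
have Vp := chart_overlap jx ix.
rewrite /dpairing /local_metric /local_rep /Defs.coord -/j.
rewrite (pairing_ext _ (@overlap_open j i) Vp
   (fun y Vy => @transition_rep j i u y Vy) (fun y Vy => @transition_rep j i h y Vy)).
rewrite -[in RHS](chart_transition i jx).
apply: (@pairing_chart R n (overlap j i) (cimg (atlas i)) (@cimg_open _ _ _ (atlas i))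
  (transition j i) (gmat g j) (gmat g i)) => //.
- by move=> p; exact: transition_img.
- by move=> b; exact: transition_smooth.
- by move=> p [jp _]; exact: gmat_det.
- by move=> p; exact: gmat_det.
- by move=> p [jp ip]; exact: gmat_transition.
Qed.

Lemma laplaceE i x f : smooth_fun f -> cdom (atlas i) x ->
  laplace g f x = laplace_loc (gmat g i) (f \o cinv (atlas i)) (cmap (atlas i) x).
Proof.
move=> sf ix; pose j := chart_at x.
have jx : cdom (atlas j) x := chart_atP x.
have Vp := chart_overlap jx ix.
rewrite /laplace /local_metric /local_rep /Defs.coord -/j.
rewrite (laplace_ext _ (@overlap_open j i) Vp (fun y Vy => @transition_rep j i f y Vy)).
rewrite -[in RHS](chart_transition i jx).
have VU : overlap j i `<=` cimg (atlas j) by move=> p [].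
apply: (@laplace_chart R n (overlap j i) (cimg (atlas i)) (@overlap_open j i) (@cimg_open _ _ _ (atlas i))
  (transition j i) (gmat g j) (gmat g i)) => //.
- by move=> p; exact: transition_img.
- by move=> b; exact: transition_smooth.
- by move=> a b; apply: (smooth_sub VU); exact: gmat_smooth.
- by move=> p [jp _]; exact: gmat_sym.
- by move=> p [jp _]; exact: gmat_det.
- by move=> a b; exact: gmat_smooth.
- by move=> p; exact: gmat_sym.
- by move=> p; exact: gmat_det.
- by move=> p [jp ip]; exact: gmat_transition.
- apply: (smooth_ext (@overlap_open j i) _ (smooth_sub VU (sf j))) => y Vy.
  exact: transition_rep.
Qed.

Lemma dpairing_rep i u h p : C1_fun u -> C1_fun h -> cimg (atlas i) p ->
  (dpairing g u h \o cinv (atlas i)) p =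
  pairing_loc (gmat g i) (u \o cinv (atlas i)) (h \o cinv (atlas i)) p.
Proof.
by move=> Cu Ch ip; rewrite /= (dpairingE (i := i))// ?cinvK//; exact: cinv_dom.
Qed.

Lemma laplace_rep i f p : smooth_fun f -> cimg (atlas i) p ->
  (laplace g f \o cinv (atlas i)) p = laplace_loc (gmat g i) (f \o cinv (atlas i)) p.
Proof.
by move=> sf ip; rewrite /= (laplaceE (i := i))// ?cinvK//; exact: cinv_dom.
Qed.

Lemma smooth_dpairing f h : smooth_fun f -> smooth_fun h -> smooth_fun (dpairing g f h).
Proof.
move=> sf sh i.
apply: (smooth_ext (@cimg_open _ _ _ (atlas i)) _
  (pairing_smooth (@cimg_open _ _ _ (atlas i)) (gmat_smooth g i) (@gmat_det i) (sf i) (sh i))).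
by move=> y iy; rewrite dpairing_rep//; exact: smooth_C1.
Qed.

Lemma smooth_laplace f : smooth_fun f -> smooth_fun (laplace g f).
Proof.
move=> sf i.
apply: (smooth_ext (@cimg_open _ _ _ (atlas i)) _
  (laplace_smooth (@cimg_open _ _ _ (atlas i)) (gmat_smooth g i) (@gmat_det i) (sf i))).
by move=> y iy; rewrite laplace_rep.
Qed.

Lemma dpairingC u h x : dpairing g u h x = dpairing g h u x.
Proof.
rewrite /dpairing /pairing_loc exchange_big/=; apply: eq_bigr => b _; apply: eq_bigr => a _.
rewrite mulrAC; congr (_ * _ * _).
rewrite /local_metric /Defs.coord.
by rewrite -[in LHS](@gmat_sym _ _ _ g _ _ (cmap_img (chart_atP x))) -trmx_inv mxE.
Qed.

Lemma dpairing_mull u v h x : C1_fun u -> C1_fun v ->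
  dpairing g (u \* v) h x = u x * dpairing g v h x + v x * dpairing g u h x.
Proof.
move=> Cu Cv; pose i := chart_at x; have ix : cdom (atlas i) x := chart_atP x.
have ip := cmap_img ix.
rewrite /dpairing /pairing_loc !mulr_sumr -big_split/=; apply: eq_bigr => a _.
rewrite !mulr_sumr -big_split/=; apply: eq_bigr => b _.
have [_ /(_ a)[/(_ _ ip) du _]] := Cu i; have [_ /(_ a)[/(_ _ ip) dv _]] := Cv i.
have -> : pd a (local_rep (u \* v) x) (Defs.coord x) =
    u x * pd a (local_rep v x) (Defs.coord x) + v x * pd a (local_rep u x) (Defs.coord x).
  have := deriveM du dv.
  rewrite -[_ * _]/((u \o cinv (atlas i)) \* (v \o cinv (atlas i))) /pd => ->.
  by rewrite /local_rep /= cmapK.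
by ring.
Qed.

End Charts.

(** * The pointwise curvature inequality *)

(* The letters are, at a point: [w] = omega, [l] = Delta f, [p] = <d omega, df>,
   [q] = |df|^2, [r] = |d omega|^2, [d] = <df, d Delta f>, [e] = Delta |df|^2,
   [u] = <d omega, d |df|^2>, [v] = <df, d <d omega, df>>, [ric] = Ric(df, df),
   [hX] = Hess omega (df, df), [tr] = |Hess f|^2 and [Dw] = Delta omega. *)
Lemma curvature_algebra (R : realType) (n beta c w l p q r d e u v ric hX tr Dw : R) :
  2 <= n -> 1 <= beta -> beta <= n + 1 -> 0 < w ->
  l ^+ 2 <= n * tr -> p ^+ 2 <= r * q ->
  e = (d + ric + tr) *+ 2 -> hX *+ 2 = v *+ 2 - u ->
  c * q <= n / (n - 1) * w * ric + (beta - 1) * hX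
     + (n + 1 - beta) / (n - 1) * (hX - Dw * q) ->
  forall a, a = (n + 1 - beta) / (n - 1) ->
  0 <= (w * l - (beta - 1) * p) ^+ 2 - c * (w * q)
    - (n / (n - 1) * ((w * l) * (w * l - (beta - 1) * p) + w * (w * d + l * p))
       - n / (2 * (n - 1)) * (w * (w * e - (beta - 1) * u) + w * u)
       - (beta - 1 + a) * (p * (w * l - (beta - 1) * p) + w * v)
       + a * (q * (w * Dw - (beta - 1) * r) + w * u)).
Proof.
move=> n2 b1 bn w0 ltr CS E hE T a aE.
have n0 : n != 0 by rewrite gt_eqF//; lra.
have n1 : n - 1 != 0 by rewrite gt_eqF//; lra.
have n1' : 0 < n - 1 by lra.
have hXE : hX = v - u / 2 by lra.
have ricE : ric = e / 2 - d - tr by rewrite E -mulr_natr; field.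
set Q := n / (n - 1) * w * ric + (beta - 1) * hX + (n + 1 - beta) / (n - 1) * (hX - Dw * q) in T.
(* Three nonnegative terms remain: the curvature condition, |Hess f|^2 >= (Delta f)^2 / n and
   Cauchy-Schwarz. The factor n / (n - 1) pays for the part of (Delta f)^2 absorbed by |Hess f|^2.
   Cancelling the products [l * p], or matching [u] and [v] to Hess omega, both force a = (n + 1 -
   beta) / (n - 1). *)
rewrite [X in 0 <= X](_ : _ = w * (Q - c * q) + n / (n - 1) * w ^+ 2 * (tr - l ^+ 2 / n)
   + a * (beta - 1) * (r * q - p ^+ 2)); last first.
  by rewrite /Q aE ricE hXE; field; rewrite n0 n1.
have a0 : 0 <= a by rewrite aE divr_ge0//; lra.
rewrite !addr_ge0//.
- by rewrite mulr_ge0 ?(ltW w0)// subr_ge0.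
- have np : 0 < n by lra.
  apply: mulr_ge0; last by rewrite subr_ge0 ler_pdivrMr// mulrC.
  by rewrite mulr_ge0 ?sqr_ge0// divr_ge0//; lra.
- by rewrite mulr_ge0// ?subr_ge0// mulr_ge0//; lra.
Qed.

Section Qform.
Variables (R : realType) (n : nat).
Implicit Types (A B : 'M[R]_n) (v : 'rV[R]_n).

Lemma qformD A B v : qform (A + B) v = qform A v + qform B v.
Proof. by rewrite /qform mulmxDr mulmxDl mxE. Qed.

Lemma qformZ a A v : qform (a *: A) v = a * qform A v.
Proof. by rewrite /qform -scalemxAr -scalemxAl mxE. Qed.

Lemma qformN A v : qform (- A) v = - qform A v.
Proof. by rewrite -scaleN1r qformZ mulN1r. Qed.

Lemma qformB A B v : qform (A - B) v = qform A v - qform B v.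
Proof. by rewrite -scaleN1r qformD qformZ mulN1r. Qed.

Lemma qform0 v : qform 0 v = 0.
Proof. by rewrite /qform mulmx0 mul0mx mxE. Qed.

End Qform.

Section Curvature.
Variables (R : realType) (n : nat) (M : smooth_manifold R n).
Variable g : riemannian_metric M.
Variables (omega : M -> R) (omega_smooth : smooth_fun omega).
Implicit Types (f h u : M -> R) (x : M).

Definition gradv f x : 'rV[R]_n := grad_loc (local_metric g x) (local_rep f x) (Defs.coord x).

Lemma coord_img x : cimg (atlas (chart_at x)) (Defs.coord x).
Proof. exact: cmap_img (chart_atP x). Qed.

Lemma local_metric_sym x : (metric_at g x)^T = metric_at g x.
Proof. exact: gmat_sym (coord_img x). Qed.

Lemma local_metric_pos x v : v != 0 -> 0 < qform (metric_at g x) v.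
Proof. exact: gmat_pos (coord_img x). Qed.

Lemma dpairing_mx u h x : dpairing g u h x =
  (pd_row (local_rep u x) (Defs.coord x) *m invmx (metric_at g x) *m
    (pd_row (local_rep h x) (Defs.coord x))^T) 0 0.
Proof. exact: pairing_mx. Qed.

(** The inner [dpairing] changes charts from point to point; near x it agrees with the expression in
    the single chart at x, and that suffices to differentiate it. *)
Lemma dpairing_nested f u h x : smooth_fun u -> smooth_fun h ->
  dpairing g f (dpairing g u h) x = pairing_loc (local_metric g x) (local_rep f x)
   (pairing_loc (local_metric g x) (local_rep u x) (local_rep h x)) (Defs.coord x).
Proof.
move=> su sh; set i := chart_at x.
apply: (pairing_ext _ (@cimg_open _ _ _ (atlas i)) (coord_img x)) => // y iy.
exact: (dpairing_rep g (smooth_C1 su) (smooth_C1 sh) iy).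
Qed.

Lemma metric_gradv f x : qform (metric_at g x) (gradv f x) = dpairing g f f x.
Proof.
rewrite dpairing_mx /qform /gradv grad_mx; last exact: local_metric_sym.
rewrite trmx_mul (invmx_sym (local_metric_sym x)) !mulmxA.
rewrite -[pd_row _ _ *m _ *m metric_at g x]mulmxA mulVmx ?mulmx1//.
exact: posdef_unit (local_metric_sym x) (@local_metric_pos x).
Qed.

Lemma dpairing_CS f h x : dpairing g f h x ^+ 2 <= dpairing g f f x * dpairing g h h x.
Proof.
rewrite !dpairing_mx.
exact: (form_CS (local_metric_sym x) (@local_metric_pos x)).
Qed.

Lemma dpairing_ge0 f x : 0 <= dpairing g f f x.
Proof.
by rewrite dpairing_mx; exact: (qform_inv_ge0 (local_metric_sym x) (@local_metric_pos x)).
Qed.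

(** The witness [t] is |Hess f|^2, of which only the comparison with the Laplacian matters. *)
Lemma bochner_manifold f x : smooth_fun f -> exists2 t : R,
  laplace g f x ^+ 2 <= n%:R * t &
  laplace g (dpairing g f f) x =
   (dpairing g f (laplace g f) x + qform (Ric g x) (gradv f x) + t) *+ 2.
Proof.
move=> sf; set i := chart_at x.
have oU := @cimg_open _ _ _ (atlas i).
have Up := coord_img x.
pose C := cov_loc (local_metric g x) (local_rep f x) (Defs.coord x).
have gs := @gmat_sym _ _ _ g i.
exists (\tr (C *m C)).
  have hs : (Hess g f x)^T = Hess g f x.
    apply/matrixP => a b; rewrite mxE.
    exact: (hess_locC oU (gmat_smooth g i) gs (@gmat_det _ _ _ g i)).
  rewrite /laplace laplace_mx; last exact: local_metric_sym.
  exact: (tr_sqr_ge (local_metric_sym x) (@local_metric_pos x) hs).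
have E : laplace_loc (local_metric g x)
    (pairing_loc (local_metric g x) (local_rep f x) (local_rep f x)) (Defs.coord x) =
    (pairing_loc (local_metric g x) (local_rep f x)
      (laplace_loc (local_metric g x) (local_rep f x)) (Defs.coord x)
      + qform (Ric g x) (gradv f x) + \tr (C *m C)) *+ 2.
  exact: (bochner_loc oU (gmat_smooth g i) gs (@gmat_det _ _ _ g i) (sf i) Up).
have L1 : laplace g (dpairing g f f) x = laplace_loc (local_metric g x)
    (pairing_loc (local_metric g x) (local_rep f x) (local_rep f x)) (Defs.coord x).
  apply: (laplace_ext _ oU Up) => y iy.
  exact: (dpairing_rep g (smooth_C1 sf) (smooth_C1 sf) iy).
have L2 : dpairing g f (laplace g f) x = pairing_loc (local_metric g x) (local_rep f x)
      (laplace_loc (local_metric g x) (local_rep f x)) (Defs.coord x).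
  apply: (pairing_ext _ oU Up) => [y _|y iy]; first exact: erefl.
  exact: (laplace_rep g sf iy).
by rewrite L2; exact: (etrans L1 E).
Qed.

Lemma hess_gradv f x : smooth_fun f -> qform (Hess g omega x) (gradv f x) *+ 2 =
  dpairing g f (dpairing g omega f) x *+ 2 - dpairing g omega (dpairing g f f) x.
Proof.
move=> sf; set i := chart_at x.
have oU := @cimg_open _ _ _ (atlas i).
have := hess_polar_loc oU (gmat_smooth g i) (@gmat_sym _ _ _ g i) (@gmat_det _ _ _ g i)
  (omega_smooth i) (sf i) (sf i) (coord_img x).
by rewrite -!dpairing_nested// => ->; rewrite mulr2n.
Qed.

Variable beta : R.
Local Notation L := (diffusion_op g beta omega).

(* omega^beta times the divergence of u omega^(1 - beta) grad f. *)
Definition ibp_term u f x : R := u x * L f x + omega x * dpairing g u f x.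

Lemma curvature_ineq f x (c : R) : (2 <= n)%N -> 1 <= beta -> beta <= n%:R + 1 ->
  smooth_fun f -> 0 < omega x ->
  qform_le (c *: metric_at g x)
        ((n%:R / (n%:R - 1) * omega x) *: Ric g x
         + (beta - 1) *: Hess g omega x
         + ((n%:R + 1 - beta) / (n%:R - 1)) *:
             (Hess g omega x - laplace g omega x *: metric_at g x)) ->
  0 <= L f x ^+ 2 - c * (omega x * dpairing g f f x)
    - (n%:R / (n%:R - 1) * ibp_term (omega \* laplace g f) f x
       - n%:R / (2 * (n%:R - 1)) * ibp_term omega (dpairing g f f) x
       - (beta - 1 + (n%:R + 1 - beta) / (n%:R - 1)) * ibp_term (dpairing g omega f) f x
       + (n%:R + 1 - beta) / (n%:R - 1) * ibp_term (dpairing g f f) omega x).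
Proof.
move=> n2 b1 bn sf w0 /(_ (gradv f x)).
rewrite !(qformD, qformN, qformZ) metric_gradv => T.
have [t ltr BE] := bochner_manifold x sf.
have := curvature_algebra (_ : 2 <= n%:R) b1 bn w0 ltr (dpairing_CS omega f x) BE
  (hess_gradv x sf) T.
rewrite ler_nat => /(_ n2 _ erefl) /=.
rewrite /ibp_term /diffusion_op /=.
rewrite dpairing_mull; [|exact: smooth_C1|exact/smooth_C1/smooth_laplace].
rewrite (dpairingC g (laplace g f) f) (dpairingC g (dpairing g omega f) f).
by rewrite (dpairingC g (dpairing g f f) omega).
Qed.

Lemma laplace_le f x (r : R) : qform_le (Hess g f x) (r *: metric_at g x) ->
  laplace g f x <= n%:R * r.
Proof.
move=> H; rewrite /laplace laplace_mx; last exact: local_metric_sym.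
have := @tr_psd_ge0 _ _ _ (local_metric_sym x) (@local_metric_pos x) (r *: metric_at g x - Hess g f x).
rewrite mulmxBl linearB/= -scalemxAl linearZ/= mulmxV; last first.
  exact: posdef_unit (local_metric_sym x) (@local_metric_pos x).
rewrite mxtrace1 subr_ge0 mulrC; apply => v.
by rewrite qform0 qformB subr_ge0; exact: H.
Qed.

End Curvature.

(** * Lebesgue measure in a chart *)

Section IntegralTransfer.
Local Open Scope ereal_scope.
Context d1 d2 (T1 : measurableType d1) (T2 : measurableType d2) (R : realType).
Variables (m1 : {measure set T1 -> \bar R}) (m2 : {measure set T2 -> \bar R}).
Variables (D1 : set T1) (D2 : set T2) (mD1 : measurable D1) (mD2 : measurable D2).
Variables (phi : T2 -> T1) (mphi : measurable_fun D2 phi).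
Variables (w : T2 -> R) (mw : measurable_fun D2 w) (w0 : forall y, D2 y -> (0 <= w y)%R).
Hypothesis transfer : forall A, measurable A ->
  m1 (A `&` D1) = \int[m2]_(y in D2) (\1_A (phi y) * w y)%:E.

Import HBNNSimple.

Let mcomp (h : {nnsfun T1 >-> R}) : measurable_fun D2 (h \o phi).
Proof. by apply: measurableT_comp. Qed.

(** The hypothesis [transfer] is the case of indicators; linearity extends it to simple functions,
    and monotone convergence then to nonnegative ones. *)
Lemma transfer_nnsfun (h : {nnsfun T1 >-> R}) :
  \int[m1]_(x in D1) (h x)%:E = \int[m2]_(y in D2) ((h (phi y))%:E * (w y)%:E).
Proof.
transitivity (\int[m1]_(x in D1)
   (\sum_(r \in range h) (r * \1_(h @^-1` [set r]) x)%:E)).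
  by apply: eq_integral => t tE; rewrite /= fimfunE -fsumEFin.
rewrite ge0_integral_fsum//; last 2 first.
- by move=> r; apply/measurable_EFinP/measurable_funTS; exact: measurable_funM.
- by move=> r y Ey; exact: nnfun_muleindic_ge0.
transitivity (\int[m2]_(y in D2) (\sum_(r \in range h)
    (r * (\1_(h @^-1` [set r]) (phi y) * w y))%:E)); last first.
  apply: eq_integral => y /[!inE] yD.
  rewrite fsumEFin// -EFinM; congr EFin.
  rewrite [in RHS]fimfunE fsbig_finite//= [in RHS]fsbig_finite//= mulr_suml.
  by apply: eq_bigr => r _; rewrite mulrA.
rewrite ge0_integral_fsum//; last 2 first.
- move=> r; apply/measurable_EFinP; apply: measurable_funM => //.
  by apply: measurable_funM => //; exact: measurableT_comp.
- move=> r y yD; rewrite mulrA EFinM mule_ge0//; first exact: nnfun_muleindic_ge0.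
  by rewrite lee_fin; exact: w0.
apply: eq_fsbigr => r rh.
have r0 : (0 <= r)%R by move: rh; rewrite inE => -[t _ <-].
rewrite integralZl_indic_nnsfun// integral_indic// transfer//.
under [RHS]eq_integral do rewrite EFinM.
rewrite ge0_integralZl//.
- by apply/measurable_EFinP; apply: measurable_funM => //; exact: measurableT_comp.
- by move=> y yD; rewrite lee_fin mulr_ge0//; exact: w0.
Qed.

Lemma ge0_transfer (F : T1 -> \bar R) : measurable_fun setT F -> (forall x, 0 <= F x) ->
  \int[m1]_(x in D1) F x = \int[m2]_(y in D2) (F (phi y) * (w y)%:E).
Proof.
move=> mF F0; pose h := nnsfun_approx measurableT mF.
have cvgh x : EFin \o h ^~ x @ \oo --> F x by exact: cvg_nnsfun_approx.
have -> : \int[m1]_(x in D1) F x =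
    lim (\int[m1]_(x in D1) (EFin \o h n) x @[n --> \oo]).
  rewrite -monotone_convergence//.
  - by apply: eq_integral => x _; apply/esym/cvg_lim => //; exact: cvgh.
  - by move=> n; apply/measurable_EFinP; exact: measurable_funTS.
  - by move=> n x _; rewrite lee_fin.
  - by move=> x _ a b ab; rewrite lee_fin; exact/lefP/nd_nnsfun_approx.
have -> : \int[m2]_(y in D2) (F (phi y) * (w y)%:E) =
    lim (\int[m2]_(y in D2) ((EFin \o h n) (phi y) * (w y)%:E) @[n --> \oo]).
  rewrite -monotone_convergence//.
  - apply: eq_integral => y _; apply/esym/cvg_lim => //.
    by apply: cvgeZr => //; exact: cvgh.
  - move=> n; apply: emeasurable_funM; last exact/measurable_EFinP.
    by apply/measurable_EFinP; exact: mcomp.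
  - by move=> n y yD; rewrite mule_ge0 ?lee_fin//; exact: w0.
  - move=> y yD a b ab; rewrite lee_wpmul2r ?lee_fin//; first exact: w0.
    exact/lefP/nd_nnsfun_approx.
congr (lim (_ @ \oo)); apply/funext => n; exact: transfer_nnsfun.
Qed.

(** Positive and negative parts are transferred separately, and multiplication by the nonnegative
    weight respects the splitting. *)
Lemma integral_transfer (F : T1 -> R) : measurable_fun setT F ->
  \int[m1]_(x in D1) (F x)%:E = \int[m2]_(y in D2) (F (phi y) * w y)%:E.
Proof.
move=> mF; have mFE : measurable_fun setT (EFin \o F) by exact/measurable_EFinP.
rewrite integralE [RHS]integralE.
rewrite ge0_transfer//; last exact: measurable_funepos.
rewrite ge0_transfer//; last exact: measurable_funeneg.
congr (_ - _); apply: eq_integral => y /[!inE] yD; have wy := w0 yD.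
- rewrite !funeposE -!EFin_max -EFinM; congr EFin.
  by rewrite maxr_pMl// mul0r.
- rewrite !funenegE -!EFinN -!EFin_max -EFinM; congr EFin.
  by rewrite maxr_pMl// mul0r mulNr.
Qed.

End IntegralTransfer.

Section BorelSets.
Variable R : realType.

Lemma borel_open (T : ptopologicalType) (A : set (borel T)) : open (A : set T) -> measurable A.
Proof. by move=> oA; exact: sub_sigma_algebra. Qed.

Lemma borel_measurable_continuous (T : ptopologicalType) (D : set (borel T)) (f : borel T -> R) :
  open (D : set T) -> (forall x : T, D x -> {for x, continuous (f : T -> R)}) ->
  measurable_fun D f.
Proof.
move=> oD cf; apply: (measurability _ (RGenOpens.measurableE R)).
move=> _ [_ [a [b ->]] <-]; apply: borel_open.
rewrite openE => x [Dx fx]; apply: filterI.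
  by apply: open_nbhs_nbhs.
by apply: (cf x Dx); apply: open_nbhs_nbhs; split => //; exact: interval_open.
Qed.

Lemma borel_measurable_map (T : ptopologicalType) d (T2 : measurableType d)
    (D : set T2) (f : T2 -> borel T) :
  (forall O : set T, open O -> measurable (D `&` f @^-1` O)) -> measurable_fun D f.
Proof.
move=> H; apply: (@measurability _ _ T2 (borel T) D f (@open T)) => //.
by move=> _ [B oB <-]; exact: H.
Qed.

End BorelSets.

(** * Lebesgue measure on row vectors *)

Section LebesgueRows.
Variable R : realType.

Lemma bounded_support_integrable d (T : measurableType d) (mu : {measure set T -> \bar R})
    (f : T -> R) (A : set T) (C : R) : measurable_fun setT f -> measurable A ->
  (mu A < +oo)%E -> (forall x, `|f x| <= C) -> (forall x, ~ A x -> f x = 0) ->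
  mu.-integrable setT (EFin \o f).
Proof.
move=> mf mA muA fC fA.
have [C0|C0] := leP 0 C; last first.
  apply: (eq_integrable measurableT (cst 0%E)); last exact: integrable0.
  by move=> x _; have := le_trans (normr_ge0 _) (fC x); rewrite leNgt C0.
apply: (@le_integrable _ _ _ mu setT measurableT _ (fun x => C%:E * (\1_A x)%:E)%E).
- exact/measurable_EFinP.
- move=> x _ /=; rewrite lee_fin.
  have [xA|xA] := pselect (A x).
    by rewrite indicE mem_set// mulr1 (ger0_norm C0).
  by rewrite fA// normr0.
- apply: integrableZl => //; apply/integrableP; split.
    exact/measurable_EFinP/measurable_indic.
  under eq_integral => x _ do rewrite /= ger0_norm ?indicE//.
  rewrite (_ : (fun x => _) = (fun x => (\1_A x)%:E)); last first.
    by apply/funext => x; rewrite indicE.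
  by rewrite integral_indic// setIT.
Qed.

(** Balls with rational centre and radius 1 / (k + 1) form a countable base. *)
Lemma rational_row_ball m (B : set 'rV[R]_m) (x : 'rV[R]_m) : open B -> B x ->
  exists q : 'rV[rat]_m * nat,
    ball (map_mx ratr q.1 : 'rV[R]_m) q.2.+1%:R^-1 `<=` B /\
    ball (map_mx ratr q.1 : 'rV[R]_m) q.2.+1%:R^-1 x.
Proof.
move=> oB Bx; have /nbhs_ballP[e /= e0 eB] : nbhs x B by exact: open_nbhs_nbhs.
have [k ke] : exists k : nat, k.+1%:R^-1 < e / 2.
  have [k] := @ltr_add_invr R 0 (e / 2) (divr_gt0 e0 (ltr0n R 2)).
  by rewrite add0r => ke; exists k.
pose r : R := k.+1%:R^-1; have r0 : 0 < r by rewrite invr_gt0.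
have near_q i : exists q : rat, `|ratr q - x 0 i| < r.
  have xr : x 0 i - r < x 0 i + r by lra.
  have [q] := rat_in_itvoo xr.
  by rewrite in_itv/= => /andP[q1 q2]; exists q; rewrite ltr_distl q1 q2.
pose q := \row_i (sval (cid (near_q i))).
exists (q, k) => /=; split; last first.
  rewrite -ball_normE /ball_/=.
  have : `|map_mx ratr q - x| < r.
    rewrite [`|_|]/Num.norm/= mx_normrE; apply: bigmax_lt => //= -[i j] _ /=.
    by rewrite !mxE (ord1 i); case: (cid (near_q j)).
  by [].
move=> y qy; apply: eB.
have qx : ball (map_mx ratr q : 'rV[R]_m) r x.
  split => // i j; rewrite (ord1 i) !mxE; case: (cid (near_q j)) => s /= sx.
  by rewrite -ball_normE.
have := ball_triangle (ball_sym qx) qy; apply: le_ball.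
by rewrite -/r; move: ke; rewrite -/r; lra.
Qed.

Definition rcons_row m (z : measurableTypeR R * borel 'rV[R]_m) : borel 'rV[R]_(1 + m) :=
  row_mx z.1%:M (z.2 : 'rV[R]_m).

Lemma rcons_row_l m (z : measurableTypeR R * borel 'rV[R]_m) : rcons_row z 0 (lshift m 0) = z.1.
Proof. by rewrite /rcons_row row_mxEl mxE eqxx mulr1n. Qed.

Lemma rcons_row_r m (z : measurableTypeR R * borel 'rV[R]_m) k : rcons_row z 0 (rshift 1 k) = (z.2 : 'rV[R]_m) 0 k.
Proof. by rewrite /rcons_row row_mxEr. Qed.

Lemma ball_rcons_row m (c : 'rV[R]_(1 + m)) (r : R) :
  @rcons_row m @^-1` (ball c r) = ball (c 0 (lshift m 0)) r `*` ball (rsubmx c) r.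
Proof.
apply/seteqP; split => [[t y] [r0 H]|[t y] [/= H1 [r0 H2]]].
  split => /=; first by have := H 0 (lshift m 0); rewrite rcons_row_l.
  by split => // i j; have := H i (rshift 1 j); rewrite (ord1 i) rcons_row_r mxE.
split => // i j; rewrite (ord1 i); case: (split_ordP j) => k ->.
  by rewrite (ord1 k) rcons_row_l.
by rewrite rcons_row_r; have := H2 0 k; rewrite mxE.
Qed.

(** The target carries the Borel sets of its topology, the source a product sigma-algebra. Balls of
    the sup norm pull back to products of balls, and an open set is a countable union of rational
    balls. *)
Lemma measurable_rcons_row m : measurable_fun setT (@rcons_row m).
Proof.
apply: borel_measurable_map => B oB; rewrite setTI.
pose I := [set q : 'rV[rat]_(1 + m) * nat |
  ball (map_mx ratr q.1 : 'rV[R]_(1 + m)) q.2.+1%:R^-1 `<=` B].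
pose F (q : 'rV[rat]_(1 + m) * nat) : set (measurableTypeR R * borel 'rV[R]_m) :=
  if q \in I then @rcons_row m @^-1` (ball (map_mx ratr q.1 : 'rV[R]_(1 + m)) q.2.+1%:R^-1)
  else set0.
have -> : @rcons_row m @^-1` B = \bigcup_q F q.
  apply/seteqP; split => [z Bz|z [q _]].
    have [q [qB qz]] := rational_row_ball oB Bz.
    by exists q => //; rewrite /F mem_set.
  by rewrite /F; case: ifPn => // /[!inE] qB /qB.
apply: countable_bigcupT_measurable; first exact: countableP.
move=> q; rewrite /F; case: ifP => // _.
rewrite ball_rcons_row; apply: measurableX; first exact: measurable_ball.
by apply: borel_open; exact: ball_open.
Qed.

Section Product.
Variables (m : nat) (mu : {sigma_finite_measure set (borel 'rV[R]_m) -> \bar R}).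
Local Notation lam := (@lebesgue_measure R).

(** The image of the product of Lebesgue measure on R with [mu]: the candidate in one more
    dimension. *)
Definition ext_measure (A : set (borel 'rV[R]_(1 + m))) : \bar R :=
  (lam \x mu)%E (@rcons_row m @^-1` A).

Let mpre (A : set (borel 'rV[R]_(1 + m))) : measurable A -> measurable (@rcons_row m @^-1` A).
Proof. by move=> mA; rewrite -[X in measurable X]setTI; exact: measurable_rcons_row. Qed.

Let ext0 : ext_measure set0 = 0%E.
Proof. by rewrite /ext_measure preimage_set0 measure0. Qed.

Let ext_ge0 A : (0 <= ext_measure A)%E. Proof. exact: measure_ge0. Qed.

Let ext_sigma_additive : semi_sigma_additive ext_measure.
Proof.
move=> F mF tF mUF; rewrite /ext_measure preimage_bigcup.
apply: measure_semi_sigma_additive.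
- by move=> n; exact: mpre.
- apply/trivIsetP => /= i j _ _ ij; rewrite -preimage_setI.
  by move/trivIsetP : tF => /(_ _ _ _ _ ij) ->//; rewrite preimage_set0.
- by rewrite -preimage_bigcup; exact: mpre.
Qed.

HB.instance Definition _ := isMeasure.Build _ _ _ ext_measure ext0 ext_ge0 ext_sigma_additive.

Lemma ext_measure_ball r : (mu (ball (0%R : 'rV[R]_m) r) < +oo)%E ->
  (ext_measure (ball (0%R : 'rV[R]_(1 + m)) r) < +oo)%E.
Proof.
move=> mur; rewrite /ext_measure ball_rcons_row mxE.
have -> : rsubmx (0 : 'rV[R]_(1 + m)) = 0 by apply/rowP => i; rewrite !mxE.
rewrite product_measure1E; [|exact: measurable_ball|by apply: borel_open; exact: ball_open].
rewrite lte_mul_pinfty//.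
have [r0|r0] := leP r 0.
  have -> : ball (0 : R) r = set0 by apply/ball0.
  by rewrite measure0.
by change (@lebesgue_measure R (ball (0%R : R) r) \is a fin_num); rewrite lebesgue_measure_ball ?(ltW r0).
Qed.

Lemma ge0_integral_ext (F : borel 'rV[R]_(1 + m) -> \bar R) : measurable_fun setT F ->
  (forall x, 0 <= F x)%E ->
  (\int[ext_measure]_x F x = \int[lam]_t \int[mu]_y F (rcons_row (t, y)))%E.
Proof.
move=> mF F0.
transitivity (\int[(lam \x mu)%E]_(z in @rcons_row m @^-1` setT) (F \o @rcons_row m) z)%E.
  apply: (ge0_integral_pushforward (@measurable_rcons_row m) (lam \x mu)%E measurableT mF).
  by move=> y _.
rewrite preimage_setT fubini_tonelli1//; last by move=> z; exact: F0.
by apply: measurableT_comp => //; exact: measurable_rcons_row.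
Qed.

End Product.

Lemma derive_rcons_r m (v : 'rV[R]_(1 + m) -> R) (t : R) (y : 'rV[R]_m) k :
  derivable v (row_mx t%:M y) (delta_mx 0 (rshift 1 k)) ->
  is_derive y (delta_mx 0 k : 'rV_m) (fun y => v (row_mx t%:M y)) (pd (rshift 1 k) v (row_mx t%:M y)).
Proof.
have E : (fun h : R => h^-1 *: (((fun y => v (row_mx t%:M y)) \o shift y) (h *: delta_mx 0 k)
     - v (row_mx t%:M y))) =
   (fun h : R => h^-1 *: ((v \o shift (row_mx t%:M y)) (h *: delta_mx 0 (rshift 1 k))
     - v (row_mx t%:M y))).
  apply/funext => h /=; congr (_ *: (v _ - _)).
  apply/rowP => j; rewrite [RHS]mxE; case: (split_ordP j) => l ->.
    rewrite !row_mxEl !mxE -(inj_eq val_inj)/= (ord1 l)/= mulr0 add0r//.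
  by rewrite !row_mxEr !mxE eq_rshift.
by move=> dv; split; rewrite /derivable /derive/= E.
Qed.

Lemma derive_rcons_l m (v : 'rV[R]_(1 + m) -> R) (t : R) (y : 'rV[R]_m) :
  derivable v (row_mx t%:M y) (delta_mx 0 (lshift m 0)) ->
  is_derive t 1 (fun t : R => v (row_mx t%:M y)) (pd (lshift m 0) v (row_mx t%:M y)).
Proof.
have E : (fun h : R => h^-1 *: (((fun t : R => v (row_mx t%:M y)) \o shift t) (h *: 1)
     - v (row_mx t%:M y))) =
   (fun h : R => h^-1 *: ((v \o shift (row_mx t%:M y)) (h *: delta_mx 0 (lshift m 0))
     - v (row_mx t%:M y))).
  apply/funext => h /=; congr (_ *: (v _ - _)).
  apply/rowP => j; rewrite [RHS]mxE; case: (split_ordP j) => l ->.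
    by rewrite !row_mxEl !mxE (ord1 l) !eqxx/= !mulr1n scaler1 mulr1.
  by rewrite !row_mxEr !mxE -(inj_eq val_inj)/= mulr0 add0r.
by move=> dv; split; rewrite /derivable /derive/= E.
Qed.

Lemma integral_derivative_eq0 (phi dphi : R -> R) (r : R) : (0 < r) ->
  (forall t : R, is_derive t 1 phi (dphi t)) -> continuous dphi ->
  (forall t, r <= `|t| -> phi t = 0) -> (forall t, r < `|t| -> dphi t = 0) ->
  (\int[@lebesgue_measure R]_t (dphi t)%:E = 0)%E.
Proof.
move=> r0 dphiE cd phi0 dphi0.
have rr : - r < r by rewrite gtrN.
have cphi : continuous phi.
  by move=> t; apply: differentiable_continuous; apply/derivable1_diffP; case: (dphiE t).
have := @continuous_FTC2 R dphi phi (- r) r rr.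
have p1 : phi r = 0 by apply: phi0; rewrite (ger0_norm (ltW r0)).
have p2 : phi (- r) = 0 by apply: phi0; rewrite normrN (ger0_norm (ltW r0)).
rewrite p1 p2 -EFinB subrr => FTC.
transitivity (\int[@lebesgue_measure R]_(t in `[(- r)%R, r%R]) (dphi t)%:E)%E.
  rewrite [RHS]integral_mkcond; apply: eq_integral => t _.
  rewrite patchE; case: ifPn => //; rewrite notin_setE/= in_itv/= => /negP nt.
  by rewrite dphi0// ltNge ler_norml.
apply: FTC.
- by apply: continuous_subspaceT.
- split; first by move=> t _; case: (dphiE t).
  + by apply: cvg_at_right_filter; exact: cphi.
  + by apply: cvg_at_left_filter; exact: cphi.
- by move=> t _; rewrite derive1E; case: (dphiE t).
Qed.

End LebesgueRows.

Section LebesgueRowsExistence.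
Variable R : realType.

(* The facts about Lebesgue measure on R^n that the proof needs; by Fubini they
   are inherited from n to n + 1. *)
Definition is_lebesgue n (mu : {sigma_finite_measure set (borel 'rV[R]_n) -> \bar R}) : Prop :=
  [/\ forall F : 'rV[R]_n -> \bar R, measurable_fun (setT : set (borel 'rV[R]_n)) F ->
        (forall x, 0 <= F x)%E -> iter_integral F = (\int[mu]_x F x)%E,
      forall r : R, (mu (ball (0%R : 'rV[R]_n) r) < +oo)%E &
      forall (l : 'I_n) (v : 'rV[R]_n -> R) (r : R), 0 < r ->
        (forall x, derivable v x (delta_mx 0 l)) -> continuous (pd l v) ->
        (forall x, r <= `|x| -> v x = 0) -> (\int[mu]_x (pd l v x)%:E = 0)%E].

Lemma sigma_finite_balls n (mu : set (borel 'rV[R]_n) -> \bar R) :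
  (forall r : R, (mu (ball (0%R : 'rV[R]_n) r) < +oo)%E) -> sigma_finite setT mu.
Proof.
move=> H; exists (fun k => ball (0%R : 'rV[R]_n) k%:R).
  apply/esym; rewrite -subTset => x _; exists (Num.truncn `|x|).+1 => //.
  by rewrite -ball_normE /ball_/= sub0r normrN truncnS_gt.
by move=> k; split => //; apply: borel_open; exact: ball_open.
Qed.

Lemma norm_row_mx_l m (t : R) (y : 'rV[R]_m) : `|t| <= `|row_mx t%:M y : 'rV[R]_(1 + m)|.
Proof.
have := rV_coord_le (row_mx t%:M y : 'rV[R]_(1 + m)) (lshift m 0).
by rewrite row_mxEl mxE eqxx mulr1n.
Qed.

Lemma norm_row_mx_r m (t : R) (y : 'rV[R]_m) : `|y| <= `|row_mx t%:M y : 'rV[R]_(1 + m)|.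
Proof.
apply: rV_norm_le => // i.
by have := rV_coord_le (row_mx t%:M y : 'rV[R]_(1 + m)) (rshift 1 i); rewrite row_mxEr.
Qed.

Lemma pd_out n (v : 'rV[R]_n -> R) l r x : (forall x, r <= `|x| -> v x = 0) ->
  r < `|x| -> pd l v x = 0.
Proof.
move=> v0 rx.
have oU : open [set y : 'rV[R]_n | r < `|y|].
  apply: (@open_comp _ _ (fun y : 'rV[R]_n => `|y|) [set s | r < s]); last exact: open_gt.
  by move=> y _; exact: norm_continuous.
rewrite (@pd_ext _ _ _ v (cst 0) l x oU rx); last by move=> y /ltW; exact: v0.
by rewrite /pd derive_cst.
Qed.

Lemma row_mx_l_continuous m (y : 'rV[R]_m) :
  continuous (fun t : R => row_mx t%:M y : 'rV[R]_(1 + m)).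
Proof.
move=> t B /nbhs_ballP[e /= e0 eB]; apply/nbhs_ballP; exists e => // s ts.
apply: eB; split => // i j; rewrite (ord1 i); case: (split_ordP j) => k ->.
  by rewrite !row_mxEl !mxE (ord1 k) eqxx !mulr1n.
by rewrite !row_mxEr; exact: ballxx.
Qed.

Lemma row_mx_r_continuous m (t : R) :
  continuous (fun y : 'rV[R]_m => row_mx t%:M y : 'rV[R]_(1 + m)).
Proof.
move=> y B /nbhs_ballP[e /= e0 eB]; apply/nbhs_ballP; exists e => // z [_ yz].
apply: eB; split => // i j; rewrite (ord1 i); case: (split_ordP j) => k ->.
  by rewrite !row_mxEl; exact: ballxx.
by rewrite !row_mxEr.
Qed.

Lemma bounded_continuous n (w : 'rV[R]_n -> R) (r : R) : continuous w ->
  (forall x, r < `|x| -> w x = 0) -> exists C, forall x, `|w x| <= C.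
Proof.
move=> cw w0.
(* The radius |r| + 1 is positive even when r is negative, so the closed ball is nonempty and the
   maximum is attained. *)
have [x _ xmax] : exists2 x, x \in closed_ball (0%R : 'rV[R]_n) (`|r| + 1) &
    forall t, t \in closed_ball (0%R : 'rV[R]_n) (`|r| + 1) -> `|w t| <= `|w x|.
  have r0 : 0 < `|r| + 1 by rewrite ltr_wpDl.
  apply: (@EVT_max_rV R n (fun x => `|w x|) (closed_ball (0%R : 'rV[R]_n) (`|r| + 1))).
  - by exists 0; exact: closed_ballxx.
  - apply: bounded_closed_compact; last exact: closed_ball_closed.
    exists (`|r| + 1); split; first exact: num_real.
    move=> M rM x; rewrite closed_ballE// /closed_ball_/= sub0r normrN => /le_trans; apply.
    exact: ltW.
  - apply: continuous_subspaceT => x; apply: continuous_comp; first exact: cw.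
    exact: norm_continuous.
exists `|w x| => t; have [tr|tr] := leP `|t| r.
  apply: xmax; rewrite inE closed_ballE ?ltr_wpDl// /closed_ball_/= sub0r normrN.
  by rewrite (le_trans tr)// (le_trans (ler_norm r))// lerDl.
by rewrite w0// normr0.
Qed.

Lemma lebesgue_step m (mu : {sigma_finite_measure set (borel 'rV[R]_m) -> \bar R}) :
  is_lebesgue mu -> exists nu, @is_lebesgue (1 + m) nu.
Proof.
move=> [muI muB muD].
have extB r : (ext_measure mu (ball (0%R : 'rV[R]_(1 + m)) r) < +oo)%E.
  by apply: ext_measure_ball; exact: muB.
pose nu : {sigma_finite_measure set (borel 'rV[R]_(1 + m)) -> \bar R} :=
  HB.pack (ext_measure mu)
   (Measure_isSigmaFinite.Build _ _ _ (ext_measure mu) (sigma_finite_balls extB)).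
have mrow t : measurable_fun setT (fun y : borel 'rV[R]_m => rcons_row (t, y)).
  by apply: measurableT_comp => //; exact: measurable_rcons_row.
exists nu; split => //.
- move=> F mF F0; transitivity (\int[ext_measure mu]_x F x)%E => //.
  rewrite ge0_integral_ext//=; apply: eq_integral => t _.
  by apply: (muI _ (measurableT_comp mF (mrow t))) => y; exact: F0.
- move=> l v r r0 dv cv v0.
  pose f (z : measurableTypeR R * borel 'rV[R]_m) := (pd l v (rcons_row z))%:E.
  have [C Cv] := bounded_continuous cv (fun x => pd_out l v0).
  have mpd : measurable_fun (setT : set (borel 'rV[R]_(1 + m))) (pd l v).
    apply: (@borel_measurable_continuous R 'rV[R]_(1 + m)); first exact: openT.
    by move=> x _; exact: cv.
  have intf : (@lebesgue_measure R \x mu)%E.-integrable setT f.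
    apply: (@bounded_support_integrable R _ _ _ (pd l v \o @rcons_row R m)
      (@rcons_row R m @^-1` (ball (0%R : 'rV[R]_(1 + m)) (r + 1))) C).
    + by apply: measurableT_comp => //; exact: measurable_rcons_row.
    + rewrite -[X in measurable X]setTI; apply: measurable_rcons_row => //.
      by apply: borel_open; exact: ball_open.
    + exact: extB.
    + by move=> z; exact: Cv.
    + move=> z /= nz; apply: (pd_out l v0); rewrite ltNge; apply/negP => zr; apply: nz.
      by rewrite -ball_normE /ball_/= sub0r normrN (le_lt_trans zr)// ltrDl.
  transitivity (\int[(@lebesgue_measure R \x mu)%E]_z f z)%E.
    transitivity (\int[(@lebesgue_measure R \x mu)%E]_(z in @rcons_row R m @^-1` setT)
       ((fun x => (pd l v x)%:E) \o @rcons_row R m) z)%E; last by rewrite preimage_setT.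
    apply: (integral_pushforward (@measurable_rcons_row R m)) => //.
    + exact/measurable_EFinP.
  case: (split_ordP l) => k lE.
  (* For the first coordinate, integrate first in t: this is the integral of a derivative of a
     function with bounded support. *)
  + rewrite -integral21_prod_meas1//; apply: integral0_eq => y _.
    have {}lE : l = lshift m 0 by rewrite lE (ord1 k).
    subst l; rewrite /fubini_G /f.
    apply: (@integral_derivative_eq0 R (fun t : R => v (row_mx t%:M (y : 'rV[R]_m))) _ r r0).
    * move=> t; apply: derive_rcons_l; exact: dv.
    * move=> t; apply: (@continuous_comp _ _ _ (fun t : R => row_mx t%:M (y : 'rV[R]_m)) _).
        exact: row_mx_l_continuous.
      exact: cv.
    * by move=> t rt; apply: v0; apply: le_trans rt (norm_row_mx_l _ _).
    * move=> t rt; apply: (pd_out _ v0).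
      exact: lt_le_trans rt (norm_row_mx_l _ _).
  (* For any other coordinate, integrate first over the remaining row, where the induction
     hypothesis applies to the slice of v. *)
  + rewrite -integral12_prod_meas1//; apply: integral0_eq => t _.
    subst l; rewrite /fubini_F /f.
    have dvt y : is_derive y (delta_mx 0 k : 'rV_m)
        (fun y : 'rV[R]_m => v (row_mx t%:M y)) (pd (rshift 1 k) v (row_mx t%:M y)).
      by apply: derive_rcons_r; exact: dv.
    have pdE : pd k (fun y : 'rV[R]_m => v (row_mx t%:M y)) =
        (fun y => pd (rshift 1 k) v (row_mx t%:M y)).
      by apply/funext => y; case: (dvt y).
    have := muD k (fun y : 'rV[R]_m => v (row_mx t%:M y)) r r0.
    rewrite pdE; apply.
    * by move=> y; case: (dvt y).
    * move=> y; apply: (@continuous_comp _ _ _ (fun y : 'rV[R]_m => row_mx t%:M y) _).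
        exact: row_mx_r_continuous.
      exact: cv.
    * by move=> y ry; apply: v0; apply: le_trans ry (norm_row_mx_r _ _).
Qed.

(** R^0 has a single point and [iter_integral] evaluates there, so the base case is a Dirac mass. *)
Lemma lebesgue_rV n : exists mu, @is_lebesgue n mu.
Proof.
elim: n => [|n [mu mul]]; last exact: lebesgue_step mul.
have dB (r : R) : (@dirac _ (borel 'rV[R]_0) (0%R : 'rV[R]_0) R (ball (0%R : 'rV[R]_0) r) < +oo)%E.
  by rewrite diracE ltry.
pose nu : {sigma_finite_measure set (borel 'rV[R]_0) -> \bar R} :=
  HB.pack (@dirac _ (borel 'rV[R]_0) (0%R : 'rV[R]_0) R)
    (Measure_isSigmaFinite.Build _ _ _ (@dirac _ (borel 'rV[R]_0) (0%R : 'rV[R]_0) R) (sigma_finite_balls dB)).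
exists nu; split => //; last by case.
move=> F mF F0 /=.
transitivity (\int[\d_(0%R : borel 'rV[R]_0)]_x F x)%E => //.
by rewrite integral_dirac// diracT mul1e.
Qed.

End LebesgueRowsExistence.

Lemma powR_pred (R : realType) (a s : R) : 0 < a -> a `^ s = a `^ (s - 1) * a.
Proof.
move=> a0; have := @powRD R a (s - 1) 1.
rewrite subrK (powRr1 (ltW a0)); apply.
by apply/implyP => _; rewrite gt_eqF.
Qed.

(** * Densities of the measures in a chart *)

Section Powers.
Variables (R : realType) (n : nat) (U : set 'rV[R]_n) (oU : open U).

Lemma C1_powR (F : 'rV[R]_n -> R) (s : R) : Ck 1 U F -> (forall x, U x -> 0 < F x) ->
  Ck 1 U (fun x => F x `^ s) /\
  (forall l x, U x -> pd l (fun x => F x `^ s) x = s * F x `^ (s - 1) * pd l F x).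
Proof.
move=> CF F0.
have := @C1_comp1 R n U F (@powR R ^~ s) (fun t => s * t `^ (s - 1)) oU CF; apply.
  by move=> x Ux; exact: is_derive1_powR (F0 x Ux).
move=> x Ux.
have c : {for F x, continuous (fun t : R => t `^ (s - 1))}.
  apply: differentiable_continuous; apply/derivable1_diffP.
  by have [] := is_derive1_powR (s - 1) (F0 x Ux).
exact: (cvgMl_tmp (a := s) c).
Qed.

End Powers.

Section ChartIntegral.
Variables (R : realType) (n : nat) (M : smooth_manifold R n).
Variable g : riemannian_metric M.
Variables (omega : M -> R) (omega_smooth : smooth_fun omega).
Hypothesis omega_pos : forall x, 0 < omega x.
Variable i : chart_index M.

Local Notation U := (cimg (atlas i)).
Local Notation G := (gmat g i).
Let oU : open U := @cimg_open _ _ _ (atlas i).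

(** The exponent s = - beta gives the density of [mu], and s = 1 - beta enters the flux below. The
    square root is written as a real power so that [C1_powR] treats both factors. *)
Definition chart_density (s : R) (p : 'rV[R]_n) : R :=
  omega (cinv (atlas i) p) `^ s * \det (G p) `^ 2^-1.

Let det_C1 : Ck 1 U (fun p => \det (G p)).
Proof. by apply: smooth_det => // a b; exact: gmat_smooth. Qed.

Let det_gt0 p : U p -> 0 < \det (G p).
Proof. exact: gmat_det_gt0. Qed.

Lemma chart_density_C1 s : Ck 1 U (chart_density s).
Proof.
apply: (CkM oU (F := fun p => omega (cinv (atlas i) p) `^ s)).
  have H : forall p, U p -> 0 < (omega \o cinv (atlas i)) p by move=> p _; exact: omega_pos.
  exact: (C1_powR oU s (omega_smooth i 1) H).1.
exact: (C1_powR oU 2^-1 det_C1 det_gt0).1.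
Qed.

Lemma chart_density_gt0 s p : U p -> 0 < chart_density s p.
Proof. by move=> Up; rewrite mulr_gt0// powR_gt0// det_gt0. Qed.

(** Pulling out the density of exponent s - 1 avoids dividing by [omega]. *)
Lemma chart_density_pd s l p : U p -> pd l (chart_density s) p =
  chart_density (s - 1) p * (s * pd l (omega \o cinv (atlas i)) p
    + omega (cinv (atlas i) p) * \sum_m christoffel G m m l p).
Proof.
move=> Up.
have w0 : forall p, U p -> 0 < (omega \o cinv (atlas i)) p by move=> q _; exact: omega_pos.
have [[_ Cw] Dw] := C1_powR oU s (omega_smooth i 1) w0.
have [[_ Cd] Dd] := C1_powR oU 2^-1 det_C1 det_gt0.
have dw := (Cw l).1 p Up; have dd := (Cd l).1 p Up.
have -> : pd l (chart_density s) p =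
  omega (cinv (atlas i) p) `^ s * pd l (fun q => \det (G q) `^ 2^-1) p +
  \det (G p) `^ 2^-1 * pd l (fun q => omega (cinv (atlas i) q) `^ s) p.
  exact: (deriveM dw dd).
rewrite [pd l (fun q => omega _ `^ s) p](Dw l p Up) (Dd l p Up)/=.
rewrite (pd_det_metric oU (gmat_smooth g i) (@gmat_sym _ _ _ g i) (@gmat_det _ _ _ g i) l Up).
rewrite sumrMnl mulr2n /chart_density; set w := omega _; set d := \det _.
have ws : w `^ s = w `^ (s - 1) * w by apply: powR_pred; exact: omega_pos.
have ds : d `^ 2^-1 = d `^ (2^-1 - 1) * d by apply: powR_pred; exact: det_gt0.
by rewrite ws ds; set S := \sum_m _; field.
Qed.

Variable beta : R.
Variable vol : {measure set (borel M) -> \bar R}.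
Hypothesis hvol : is_riemannian_volume g vol.
Variable mu : {measure set (borel M) -> \bar R}.
Hypothesis hmu : forall A : set (borel M), measurable A ->
     mu A = (\int[vol]_(x in A) (omega x `^ (- beta))%:E)%E.
Variable lam : {sigma_finite_measure set (borel 'rV[R]_n) -> \bar R}.
Hypothesis lamP : is_lebesgue lam.

Let D1 : set (borel M) := cdom (atlas i).
Let D2 : set (borel 'rV[R]_n) := cimg (atlas i).
Let phi : borel 'rV[R]_n -> borel M := cinv (atlas i).

Lemma measurable_cdom : measurable D1.
Proof. by apply: borel_open; exact: cdom_open. Qed.

Lemma measurable_cimg : measurable D2.
Proof. by apply: borel_open; exact: cimg_open. Qed.

Lemma measurable_cinv : measurable_fun D2 phi.
Proof.
apply: borel_measurable_map => B oB; apply: borel_open.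
rewrite openE => p [Up Bp]; apply: filterI; first exact: open_nbhs_nbhs.
by have := cinv_continuous Up; apply; exact: open_nbhs_nbhs.
Qed.

Lemma borel_measurable_Ck k (F : 'rV[R]_n -> R) : Ck k U F -> measurable_fun D2 F.
Proof.
move=> CF; apply: (@borel_measurable_continuous R 'rV[R]_n) => // x Ux.
by case: k CF => [|k] [cF _]; exact: cF.
Qed.

Lemma measurable_omega_pow (s : R) : measurable_fun setT (fun x : borel M => omega x `^ s).
Proof.
have mw : measurable_fun setT (omega : borel M -> R).
  apply: (@borel_measurable_continuous R M); first exact: openT.
  by move=> x _; apply: C1_continuous; exact: smooth_C1.
exact (measurableT_comp (@measurable_powR R s) mw).
Qed.

Lemma sqrt_det_powR p : U p -> Num.sqrt (\det (G p)) = \det (G p) `^ 2^-1.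
Proof. by move=> Up; rewrite powR12_sqrt// ltW// det_gt0. Qed.

Lemma measurable_sqrt_det : measurable_fun D2 (fun p => \det (G p) `^ 2^-1).
Proof. exact: borel_measurable_Ck (C1_powR oU 2^-1 det_C1 det_gt0).1. Qed.

Lemma vol_chart (A : set (borel M)) : measurable A ->
  vol (A `&` D1) = (\int[lam]_(p in D2) (\1_A (phi p) * \det (G p) `^ 2^-1)%:E)%E.
Proof.
move=> mA; have [lamI _ _] := lamP.
have mAD : measurable (A `&` D1) by apply: measurableI => //; exact: measurable_cdom.
have sub : A `&` D1 `<=` cdom (atlas i) by move=> x [].
rewrite (hvol mAD sub).
pose S : set (borel 'rV[R]_n) := D2 `&` phi @^-1` A.
have mS : measurable S by exact: (measurable_cinv measurable_cimg mA).
have SE p : (\1_(cimg (atlas i) `&` cinv (atlas i) @^-1` (A `&` D1)) p *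
    Num.sqrt (\det (G p)))%R = ((fun p => \det (G p) `^ 2^-1) \_ S) p.
  rewrite patchE indicE; have [pS|pS] := pselect (S p).
    have [p1 p2] := pS; rewrite (mem_set pS) mem_set ?mul1r; last first.
      by split => //; split => //; exact: cinv_dom.
    exact: sqrt_det_powR.
  rewrite (memNset pS) memNset ?mul0r// => -[p1 [p2 p3]].
  by apply: pS; split.
rewrite (_ : (fun p => _) = EFin \o ((fun p => \det (G p) `^ 2^-1) \_ S)); last first.
  by apply/funext => p; rewrite /= SE.
rewrite lamI.
- rewrite [RHS]integral_mkcond; apply: eq_integral => p _ /=.
  rewrite !patchE; have [pS|pS] := pselect (S p).
    have [p1 p2] := pS; rewrite (mem_set pS) (mem_set p1) indicE (mem_set (p2 : A (phi p))) mul1r//.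
  rewrite (memNset pS); case: ifPn => // /[!inE] p1.
  by rewrite indicE memNset ?mul0r// => p2; apply: pS; split.
- apply/measurable_EFinP; apply: (proj1 (measurable_restrictT _ mS)).
  exact (measurable_funS measurable_cimg (@subIsetl _ _ _) measurable_sqrt_det).
- by move=> p; rewrite lee_fin patchE; case: ifPn => // _; exact: powR_ge0.
Qed.

(** [integral_transfer] serves twice: with [vol], to establish the indicator hypothesis for [mu],
    and then with [mu] for F itself. *)
Lemma integral_chart (F : borel M -> R) : measurable_fun setT F ->
  (\int[mu]_(x in D1) (F x)%:E =
   \int[lam]_(p in D2) (F (phi p) * chart_density (- beta) p)%:E)%E.
Proof.
move=> mF.
apply: (@integral_transfer _ _ _ _ R mu lam D1 D2 measurable_cdom measurable_cimg phi
  measurable_cinv (chart_density (- beta))) => //.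
- exact: borel_measurable_Ck (chart_density_C1 (- beta)).
- by move=> p Up; rewrite ltW// chart_density_gt0.
move=> A mA.
have mAD : measurable (A `&` D1) by apply: measurableI => //; exact: measurable_cdom.
rewrite hmu// setIC integral_mkcondr.
transitivity (\int[vol]_(x in D1) (\1_A x * omega x `^ (- beta))%:E)%E.
  apply: eq_integral => x _; rewrite patchE indicE.
  by case: ifPn; rewrite ?mul1r ?mul0r.
rewrite (@integral_transfer _ _ _ _ R vol lam D1 D2 measurable_cdom measurable_cimg phi
  measurable_cinv (fun p => \det (G p) `^ 2^-1)).
- by apply: eq_integral => p _; rewrite /chart_density mulrA.
- exact: measurable_sqrt_det.
- by move=> p _; exact: powR_ge0.
- exact: vol_chart.
- by apply: measurable_funM; [exact: measurable_indic|exact: measurable_omega_pow].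
Qed.

End ChartIntegral.

(** * Integration by parts *)

Section LocalIntegrationByParts.
Variables (R : realType) (n : nat) (M : smooth_manifold R n).
Variable g : riemannian_metric M.
Variables (omega : M -> R) (omega_smooth : smooth_fun omega).
Hypothesis omega_pos : forall x, 0 < omega x.
Variable beta : R.
Variable vol : {measure set (borel M) -> \bar R}.
Hypothesis hvol : is_riemannian_volume g vol.
Variable mu : {measure set (borel M) -> \bar R}.
Hypothesis hmu : forall A : set (borel M), measurable A ->
     mu A = (\int[vol]_(x in A) (omega x `^ (- beta))%:E)%E.

Lemma pairing_grad (G : 'rV[R]_n -> 'M[R]_n) (u f : 'rV[R]_n -> R) p :
  pairing_loc G u f p = \sum_l grad_loc G f p 0 l * pd l u p.
Proof.
rewrite /pairing_loc; apply: eq_bigr => l _; rewrite mxE mulr_suml.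
by apply: eq_bigr => j _; rewrite mulrAC.
Qed.

Lemma dpairing_continuous u h : C1_fun u -> C1_fun h -> continuous (dpairing g u h).
Proof.
move=> Cu Ch x; pose i := chart_at x; have ix : cdom (atlas i) x := chart_atP x.
have oU := @cimg_open _ _ _ (atlas i).
pose P := pairing_loc (gmat g i) (u \o cinv (atlas i)) (h \o cinv (atlas i)).
have [cP _] : Ck 0 (cimg (atlas i)) P.
  apply: Ck_sum => // a _; apply: Ck_sum => // b _.
  apply: (CkM oU (F := fun p => invmx (gmat g i p) a b * pd a (u \o cinv (atlas i)) p)).
    apply: (CkM oU (F := fun p => invmx (gmat g i p) a b)).
      exact: (invmx_smooth oU (gmat_smooth g i) (@gmat_det _ _ _ g i)).
    by have [_ /(_ a)[]] := Cu i.
  by have [_ /(_ b)[]] := Ch i.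
apply: (@continuous_ext M (cdom (atlas i)) R (P \o cmap (atlas i)) (dpairing g u h) x) => //.
- exact: cdom_open.
- by move=> y iy; rewrite /P (dpairingE g Cu Ch iy).
- apply: continuous_comp; first exact: cmap_continuous.
  by apply: cP; exact: cmap_img.
Qed.

Lemma diffusion_smooth f : smooth_fun f -> smooth_fun (diffusion_op g beta omega f).
Proof.
move=> sf i k; have oU := @cimg_open _ _ _ (atlas i).
have s1 := smooth_funM omega_smooth (smooth_laplace g sf).
have s2 := smooth_dpairing g omega_smooth sf.
have := CkD oU (s1 i k) (CkM oU (@Ck_cst _ _ k _ (- (beta - 1))) (s2 i k)).
by apply: Ck_ext => // y _; rewrite /= /diffusion_op mulNr.
Qed.

Lemma ibp_term_continuous u f : C1_fun u -> smooth_fun f ->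
  continuous (ibp_term g omega beta u f).
Proof.
move=> Cu sf x.
have c1 := @C1_continuous _ _ _ _ Cu x.
have c2 := @C1_continuous _ _ _ _ (smooth_C1 (diffusion_smooth sf)) x.
have c3 := @C1_continuous _ _ _ _ (smooth_C1 omega_smooth) x.
have c4 := @dpairing_continuous _ _ Cu (smooth_C1 sf) x.
exact: (cvgD (cvgM c1 c2) (cvgM c3 c4)).
Qed.

Variable i : chart_index M.
Local Notation U := (cimg (atlas i)).
Local Notation G := (gmat g i).
Let oU : open U := @cimg_open _ _ _ (atlas i).

Variables (u f : M -> R) (Cu : C1_fun u) (sf : smooth_fun f).
Variables (K : set M) (cK : compact K) (KU : K `<=` cdom (atlas i)).
Hypothesis uK : forall x, ~ K x -> u x = 0.

Let uu := u \o cinv (atlas i).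
Let ff := f \o cinv (atlas i).
Let ww := omega \o cinv (atlas i).
Let K' : set 'rV[R]_n := cmap (atlas i) @` K.

Let K'_compact : compact K'.
Proof.
apply: continuous_compact => //; apply: continuous_in_subspaceT => x /[!inE] Kx.
by apply: cmap_continuous; exact: KU.
Qed.

Let K'_open : open (~` K').
Proof.
by apply: closed_openC; apply: compact_closed => //; exact: norm_hausdorff.
Qed.

Let K'U : K' `<=` U.
Proof. by move=> _ [x Kx <-]; apply: cmap_img; exact: KU. Qed.

Let uu0 p : U p -> ~ K' p -> uu p = 0.
Proof.
move=> Up K'p; apply: uK => Kx; apply: K'p.
by exists (cinv (atlas i) p) => //; rewrite cinvK.
Qed.

(** The coordinate field u omega^(1 - beta) sqrt(det g) grad f. Its Euclidean divergence is
    [ibp_term] times the density of [mu], because differentiating omega^(1 - beta) yields exactly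
    the drift of L. *)
Definition flux (l : 'I_n) (p : 'rV[R]_n) : R :=
  uu p * chart_density g omega i (1 - beta) p * grad_loc G ff p 0 l.

Let flux_C1 l : Ck 1 U (flux l).
Proof.
apply: (CkM oU (F := fun p => uu p * chart_density g omega i (1 - beta) p)).
  by apply: (CkM oU (F := uu)) => //; exact: chart_density_C1.
exact: (grad_smooth oU (gmat_smooth g i) (@gmat_det _ _ _ g i) (sf i)).
Qed.

(** Extension by zero to R^n. The image U and the complement of the compact set [K'] are open and
    cover R^n, and V vanishes on the latter, so no regularity is lost at the boundary of U. *)
Let V l := cut U (flux l).

Let V_C1 l : Ck 1 U (V l).
Proof. by apply: (Ck_ext oU _ (flux_C1 l)) => y Uy; rewrite /V cutE. Qed.

Let V0 l p : (~` K') p -> V l p = 0.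
Proof.
move=> K'p; rewrite /V; have [Up|Up] := pselect (U p); last by rewrite cut_out.
by rewrite cutE// /flux uu0// !mul0r.
Qed.

Let V_derivable l p : derivable (V l) p (delta_mx 0 l).
Proof.
have [Up|Up] := pselect (U p); first by have [_ /(_ l)[+ _]] := V_C1 l; apply.
have nK : (~` K') p by move=> /K'U.
apply: (derivable_ext K'_open nK (F := cst 0)); last exact: derivable_cst.
by move=> y yK; rewrite V0.
Qed.

Let pdV0 l p : (~` K') p -> pd l (V l) p = 0.
Proof.
move=> nK; have H y : (~` K') y -> V l y = cst 0 y by move=> yK; rewrite V0.
by rewrite (pd_ext l K'_open nK H) /pd derive_cst.
Qed.

Let pdV_continuous l : continuous (pd l (V l)).
Proof.
move=> p; have [Up|Up] := pselect (U p).
  by have [_ /(_ l)[_ [+ _]]] := V_C1 l; apply.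
have nK : (~` K') p by move=> /K'U.
apply: (continuous_ext K'_open nK (F := cst 0)); last exact: cst_continuous.
by move=> y yK; rewrite pdV0.
Qed.

Let divergence p : U p ->
  \sum_l pd l (V l) p = ibp_term g omega beta u f (cinv (atlas i) p)
     * chart_density g omega i (- beta) p.
Proof.
move=> Up; set d := chart_density g omega i (- beta) p.
have dens : chart_density g omega i (1 - beta) p = d * ww p.
  rewrite /d /chart_density (@powR_pred R _ (1 - beta)) ?omega_pos//.
  by rewrite (_ : 1 - beta - 1 = - beta); [rewrite /ww/=; ring|ring].
have E l : pd l (V l) p = d * (uu p * (ww p * (pd l (fun y => grad_loc G ff y 0 l) p +
     (\sum_m christoffel G m m l p) * grad_loc G ff p 0 l)
      + (1 - beta) * (grad_loc G ff p 0 l * pd l ww p))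
      + ww p * (grad_loc G ff p 0 l * pd l uu p)).
  have du : derivable uu p (delta_mx 0 l) by have [_ /(_ l)[+ _]] := Cu i; apply.
  have dd : derivable (chart_density g omega i (1 - beta)) p (delta_mx 0 l).
    by have [_ /(_ l)[+ _]] := chart_density_C1 g omega_smooth omega_pos i (1 - beta); apply.
  have dX : derivable (fun y => grad_loc G ff y 0 l) p (delta_mx 0 l).
    have [_ /(_ l)[+ _]] := grad_smooth oU (gmat_smooth g i) (@gmat_det _ _ _ g i) (sf i) l 1.
    exact.
  rewrite (pd_ext l oU Up (fun y Uy => cutE (flux l) Uy)).
  have -> : pd l (flux l) p =
     (uu p * chart_density g omega i (1 - beta) p) * pd l (fun y => grad_loc G ff y 0 l) p
     + grad_loc G ff p 0 l * (uu p * pd l (chart_density g omega i (1 - beta)) p +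
         chart_density g omega i (1 - beta) p * pd l uu p).
    have := deriveM (derivableM du dd) dX; rewrite (deriveM du dd); exact.
  rewrite (chart_density_pd g omega_smooth omega_pos)//.
  rewrite (_ : 1 - beta - 1 = - beta); last by ring.
  by rewrite -/d dens /ww/=; ring.
under eq_bigr do rewrite E.
rewrite -mulr_sumr mulrC; congr (_ * _).
rewrite big_split/= -!mulr_sumr big_split/= -!mulr_sumr -!pairing_grad.
rewrite -(laplace_loc_div oU (gmat_smooth g i) (@gmat_sym _ _ _ g i) (@gmat_det _ _ _ g i) (sf i) Up).
rewrite /ibp_term /diffusion_op.
rewrite -(laplace_rep g sf Up) -(dpairing_rep g Cu (smooth_C1 sf) Up).
rewrite -(dpairing_rep g (smooth_C1 omega_smooth) (smooth_C1 sf) Up) /uu /ww/=.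
ring.
Qed.

(** In the chart the integrand becomes the divergence of V, each term of which is a partial
    derivative with bounded support and integrates to 0. *)
Lemma local_ibp : (\int[mu]_x (ibp_term g omega beta u f x)%:E = 0)%E.
Proof.
have [lam lamP] := @lebesgue_rV R n.
pose F : borel M -> R := ibp_term g omega beta u f.
have mF : measurable_fun setT F.
  apply: (@borel_measurable_continuous R M); first exact: openT.
  by move=> x _; exact: ibp_term_continuous.
have KcM : closed K by apply: compact_closed => //; exact: manifold_hausdorff.
(* K is closed, so off K the function u vanishes on a whole neighbourhood and its differential
   vanishes as well. *)
have F0 x : ~ K x -> F x = 0.
  move=> Kx; rewrite /F /ibp_term uK// mul0r add0r.
  suff -> : dpairing g u f x = 0 by rewrite mulr0.
  have ix := chart_atP x; set j := chart_at x in ix.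
  rewrite (dpairingE g Cu (smooth_C1 sf) ix) pairing_grad big1// => l _.
  suff -> : pd l (u \o cinv (atlas j)) (cmap (atlas j) x) = 0 by rewrite mulr0.
  pose W := cimg (atlas j) `&` cinv (atlas j) @^-1` (~` K).
  have oW : open W.
    rewrite openE => p [jp nKp]; apply: filterI.
      by apply: open_nbhs_nbhs; split => //; exact: cimg_open.
    have := cinv_continuous jp; apply; apply: open_nbhs_nbhs; split => //.
    exact: closed_openC.
  have Wp : W (cmap (atlas j) x).
    by split; [exact: cmap_img|rewrite /preimage/= cmapK].
  have W0 y : W y -> (u \o cinv (atlas j)) y = cst 0 y by move=> [_ nK]; exact: uK.
  by rewrite (pd_ext l oW Wp W0) /pd derive_cst.
transitivity (\int[mu]_(x in (cdom (atlas i) : set (borel M))) (F x)%:E)%E.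
  rewrite [RHS]integral_mkcond; apply: eq_integral => x _; rewrite patchE.
  case: ifPn => //; rewrite notin_setE => ix.
  by rewrite -/(F x) F0// => /KU.
rewrite (integral_chart omega_smooth omega_pos i hvol hmu lamP)//.
transitivity (\int[lam]_p (\sum_l (pd l (V l) p)%:E))%E.
  rewrite integral_mkcond; apply: eq_integral => p _; rewrite patchE.
  case: ifPn => [/[!inE] Up|]; first by rewrite sumEFin divergence.
  rewrite notin_setE => Up; rewrite sumEFin big1// => l _; apply: pdV0.
  by move=> /K'U.
have [lamI lamB lamD] := lamP.
have [r r0 K'r] : exists2 r : R, 0 < r & forall p, r <= `|p| -> (~` K') p.
  have /compact_bounded[N [_ H]] := K'_compact.
  exists (`|N| + 2); first by rewrite ltr_wpDl.
  move=> p rp K'p; have := H (`|N| + 1).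
  rewrite (le_lt_trans (ler_norm N)) ?ltrDl// => /(_ isT _ K'p) pN.
  by have := le_trans rp pN; rewrite lerD2l leNgt ltr1n.
have V0r l p : r <= `|p| -> V l p = 0 by move=> /K'r; exact: V0.
rewrite integral_sum//; last first.
  move=> l.
  have [C HC] := bounded_continuous (@pdV_continuous l) (fun x => pd_out l (V0r l)).
  apply: (@bounded_support_integrable R _ _ lam (pd l (V l)) (ball (0 : 'rV[R]_n) (r + 1)) C) => //.
  - apply: (@borel_measurable_continuous R 'rV[R]_n); first exact: openT.
    by move=> x _; exact: pdV_continuous.
  - by apply: borel_open; exact: ball_open.
  - exact: lamB.
  - move=> p /= np; apply: (pd_out l (V0r l)); rewrite ltNge; apply/negP => pr; apply: np.
    by rewrite -ball_normE /ball_/= sub0r normrN (le_lt_trans pr)// ltrDl.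
by rewrite big1// => l _; apply: (lamD l (V l) r) => //; exact: V0r.
Qed.

End LocalIntegrationByParts.

(** * Bump functions of class C^1 *)

Section Plateau.
Variable R : realType.

(** The function max(t, 0)^2, whose derivative t + |t| is continuous. *)
Definition half_square (t : R) : R := t * (t + `|t|) / 2.

Lemma half_square_pos t : 0 <= t -> half_square t = t ^+ 2.
Proof. by move=> t0; rewrite /half_square ger0_norm//; field. Qed.

Lemma half_square_neg t : t <= 0 -> half_square t = 0.
Proof. by move=> t0; rewrite /half_square ler0_norm// subrr mulr0 mul0r. Qed.

Lemma half_square_ge0 t : 0 <= half_square t.
Proof.
have [t0|/ltW t0] := leP 0 t; first by rewrite half_square_pos// sqr_ge0.
by rewrite half_square_neg.
Qed.

Lemma is_derive_half_square (t : R) : is_derive t 1 half_square (t + `|t|).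
Proof.
have [t0|t0|->] := ltgtP t 0.
- rewrite ltr0_norm// subrr.
  apply: (@near_eq_is_derive R R R (cst 0) half_square t 1 0).
  apply: (@near_open R [set s : R | s < 0] t _ (@open_lt R 0) t0).
  by move=> y /= /ltW y0; rewrite half_square_neg.
- rewrite gtr0_norm//.
  have D : is_derive t 1 (fun s : R => s * s) (t + t).
    have := is_deriveM (is_derive_id t 1) (is_derive_id t 1).
    by rewrite /GRing.scale/= !mulr1.
  apply: near_eq_is_derive D.
  apply: (@near_open R [set s : R | 0 < s] t _ (@open_gt R 0) t0).
  by move=> y /= /ltW y0; rewrite half_square_pos.
- rewrite normr0 addr0.
  have H : (fun h : R => h^-1 *: ((half_square \o shift 0) (h *: 1) - half_square 0)) @ 0^' --> (0 : R).
    apply/cvgrPdist_le => e e0; near=> h.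
    have h0 : h != 0 by near: h; exact: nbhs_dnbhs_neq.
    have he : `|h| <= e by near: h; exact: dnbhs0_le.
    rewrite sub0r normrN /= addr0 scaler1 /half_square !mul0r subr0.
    rewrite [_ *: _](_ : _ = (h + `|h|) / 2); last by rewrite /GRing.scale/=; field.
    apply: le_trans he; rewrite ger0_norm.
      by rewrite ler_pdivrMr// mulr2n mulrDr mulr1 lerD// ler_norm.
    by have := ler_norm (- h); rewrite normrN => ?; lra.
  by split; [apply: cvgP H|apply: cvg_lim H].
Unshelve. all: by end_near. Qed.

Lemma half_square_derivative_continuous : continuous (fun t : R => t + `|t|).
Proof. by move=> t; apply: cvgD; [exact: cvg_id|exact: norm_continuous]. Qed.

Section Rows.
Variables (n : nat) (c : 'rV[R]_n) (delta : R).
Hypothesis delta0 : 0 < delta.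

(** The Euclidean radius is used because the norm of row vectors, a maximum, is not
    differentiable. *)
Definition sq_radius (p : 'rV[R]_n) : R := \sum_i ((p 0 i - c 0 i) / delta) ^+ 2.

Lemma sq_radius_C1 : Ck 1 setT sq_radius.
Proof.
apply: Ck_sum => [|i _]; first exact: openT.
have C : Ck 1 setT (fun p : 'rV[R]_n => (p 0 i - c 0 i) / delta).
  apply: (@CkM _ _ 1 setT (fun p => p 0 i - c 0 i) (cst delta^-1) openT); last exact: Ck_cst.
  apply: (@CkD _ _ 1 setT (fun p => p 0 i) (cst (- c 0 i)) openT); last exact: Ck_cst.
  exact: coord_smooth.
exact: (CkM openT C C).
Qed.

(** Equal to 1 where [sq_radius] is at most 1 and to 0 where it is at least 2. The two summands of
    the denominator never vanish together, since no t satisfies both t >= 2 and t <= 1. *)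
Definition plateau (p : 'rV[R]_n) : R :=
  half_square (2 - sq_radius p) / (half_square (2 - sq_radius p) + half_square (sq_radius p - 1)).

Lemma plateau_denominator (t : R) : 0 < half_square (2 - t) + half_square (t - 1).
Proof.
have [t2|t2] := ltP t 2.
  rewrite ltr_pwDl ?half_square_ge0// half_square_pos ?subr_ge0 ?ltW//.
  by rewrite exprn_gt0// subr_gt0.
rewrite ltr_wpDl ?half_square_ge0// half_square_pos ?exprn_gt0//; lra.
Qed.

Lemma plateau_C1 : Ck 1 setT plateau.
Proof.
have C1 : Ck 1 setT (fun p => 2 - sq_radius p).
  apply: (@Ck_ext _ _ 1 setT (cst 2 \+ (cst (-1) \* sq_radius))); first exact: openT.
    by move=> p _ /=; rewrite mulN1r.
  apply: (CkD openT); first exact: Ck_cst.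
  by apply: (CkM openT); [exact: Ck_cst|exact: sq_radius_C1].
have C2 : Ck 1 setT (fun p => sq_radius p - 1).
  by apply: (CkD openT sq_radius_C1); exact: Ck_cst.
have comp (F : 'rV[R]_n -> R) : Ck 1 setT F -> Ck 1 setT (half_square \o F).
  move=> CF; apply: (@C1_comp1 R n setT F half_square (fun t => t + `|t|) openT CF _ _).1.
    by move=> x _; exact: is_derive_half_square.
  by move=> x _; exact: half_square_derivative_continuous.
apply: (@CkM _ _ 1 setT (half_square \o (fun p => 2 - sq_radius p)) _ openT (comp _ C1)).
apply: CkV; first exact: openT.
  by move=> p _; rewrite gt_eqF// plateau_denominator.
exact: (CkD openT (comp _ C1) (comp _ C2)).
Qed.

Lemma plateau1 p : sq_radius p <= 1 -> plateau p = 1.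
Proof.
move=> p1; have := plateau_denominator (sq_radius p).
rewrite /plateau [half_square (_ - 1)]half_square_neg ?subr_le0// addr0 => d0.
by rewrite divff// gt_eqF.
Qed.

Lemma plateau0 p : 2 <= sq_radius p -> plateau p = 0.
Proof. by move=> p2; rewrite /plateau half_square_neg ?subr_le0// mul0r. Qed.

Lemma sq_radius_center : sq_radius c = 0.
Proof. by rewrite /sq_radius big1// => i _; rewrite subrr mul0r expr0n. Qed.

(** Sup-norm distance above 2 delta means a rescaled coordinate of size above 2, so [sq_radius]
    exceeds 4, beyond the threshold 2. *)
Lemma plateau_support p : 2 * delta < `|p - c| -> plateau p = 0.
Proof.
move=> pc; apply: plateau0; rewrite leNgt; apply/negP => N2.
move: pc; rewrite ltNge => /negP; apply; apply: rV_norm_le; first by rewrite mulr_ge0// ltW.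
move=> i; rewrite !mxE leNgt; apply/negP => pi.
have : ((p 0 i - c 0 i) / delta) ^+ 2 < 2.
  apply: le_lt_trans N2; rewrite /sq_radius (bigD1 i)//= lerDl.
  by apply: sumr_ge0 => j _; exact: sqr_ge0.
rewrite -real_normK ?num_real// normrM normfV (gtr0_norm delta0) ltNge => /negP; apply.
have h : 2 <= `|p 0 i - c 0 i| / delta by rewrite ler_pdivlMr// ltW.
nra.
Qed.

End Rows.
End Plateau.

Section LocalSmoothness.
Variable R : realType.

Lemma Ck_local n k (U : set 'rV[R]_n) (F : 'rV[R]_n -> R) :
  (forall x, U x -> exists V, [/\ open V, V x & Ck k V F]) -> Ck k U F.
Proof.
elim: k F => [|k IH] F H; split.
- by move=> x /H[V [_ Vx [cF _]]]; exact: cF.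
- by [].
- by move=> x /H[V [_ Vx [cF _]]]; exact: cF.
- move=> i; split; first by move=> x /H[V [_ Vx [_ /(_ i)[d _]]]]; exact: d.
  by apply: IH => x /H[V [oV Vx [_ /(_ i)[_ C]]]]; exists V.
Qed.

Lemma C1_compose n m (V : set 'rV[R]_m) (U : set 'rV[R]_n) (F : 'rV[R]_n -> R)
    (tau : 'rV[R]_m -> 'rV[R]_n) : open V -> open U -> (forall p, V p -> U (tau p)) ->
  (forall p, V p -> {for p, continuous tau}) ->
  (forall b, Ck 1 V (fun p => tau p 0 b)) -> Ck 1 U F -> Ck 1 V (F \o tau).
Proof.
move=> oV oU VU ct Ct CF; have [cF dF] := CF.
have D a p : V p -> is_derive p (delta_mx 0 a : 'rV_m) (F \o tau)
    (\sum_b pd a (fun y => tau y 0 b) p * pd b F (tau p)).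
  move=> Vp; apply: (pd_comp oU CF (VU p Vp)) => b.
  by have [_ /(_ a)[+ _]] := Ct b; apply.
split; first by move=> p Vp; apply: continuous_comp; [exact: ct|apply: cF; exact: VU].
move=> a; split; first by move=> p Vp; case: (D a p Vp).
apply: (@Ck_ext _ _ 0 V (fun p => \sum_b pd a (fun y => tau y 0 b) p * pd b F (tau p))) => //.
  by move=> p Vp; rewrite /pd; case: (D a p Vp).
apply: Ck_sum => // b _.
apply: (@CkM _ _ 0 V (pd a (fun y => tau y 0 b)) (pd b F \o tau) oV).
  by have [_ /(_ a)[]] := Ct b.
split => // p Vp; apply: continuous_comp; first exact: ct.
by have [_ [+ _]] := dF b; apply; exact: VU.
Qed.

End LocalSmoothness.

Section Bumps.
Variables (R : realType) (n : nat) (M : smooth_manifold R n).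

(** A plateau in the chart at x, extended by zero. The support K is compact, hence closed in the
    Hausdorff space M, and this is what makes the extension C^1 in every other chart. *)
Lemma bump_exists (x : M) : exists (psi : M -> R) (K N : set M),
  [/\ C1_fun psi, compact K, K `<=` cdom (atlas (chart_at x)),
      (forall y, ~ K y -> psi y = 0) & [/\ open N, N x & forall y, N y -> psi y = 1]].
Proof.
set i := chart_at x; have ix : cdom (atlas i) x := chart_atP x.
pose c := cmap (atlas i) x.
have oU := @cimg_open _ _ _ (atlas i).
have /nbhs_ballP[e /= e0 eU] : nbhs c (cimg (atlas i)).
  by apply: open_nbhs_nbhs; split => //; exact: cmap_img.
(* Keeps the closed ball of radius 2 delta inside the chart image. *)
pose delta := e / 3; have delta0 : 0 < delta by rewrite divr_gt0.
have d20 : 0 < 2 * delta by rewrite mulr_gt0.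
pose B := closed_ball c (2 * delta).
have BU : B `<=` cimg (atlas i).
  move=> p; rewrite /B closed_ballE// /closed_ball_/= => pc; apply: eU.
  by rewrite -ball_normE /ball_/= (le_lt_trans pc)// /delta; lra.
have cB : compact B.
  apply: bounded_closed_compact; last exact: closed_ball_closed.
  exists (2 * delta + `|c|); split; first exact: num_real.
  move=> r rM p; rewrite /B closed_ballE// /closed_ball_/= => pc.
  rewrite (le_trans _ (ltW rM))// -[p](subrK c) addrC.
  by rewrite (le_trans (ler_normD _ _))// addrC lerD2r distrC.
pose K : set M := cinv (atlas i) @` B.
have cK : compact K.
  apply: continuous_compact => //; apply: continuous_in_subspaceT => p /[!inE] Bp.
  by apply: cinv_continuous; exact: BU.
have Kcl : closed K by apply: compact_closed => //; exact: manifold_hausdorff.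
pose psi y := if y \in cdom (atlas i) then plateau c delta (cmap (atlas i) y) else 0.
have psiE y : cdom (atlas i) y -> psi y = plateau c delta (cmap (atlas i) y).
  by move=> iy; rewrite /psi mem_set.
have psi0 y : ~ K y -> psi y = 0.
  move=> nK; rewrite /psi; case: ifPn => // /[!inE] iy; apply: plateau_support => //.
  rewrite ltNge; apply/negP => yc; apply: nK; exists (cmap (atlas i) y); last by rewrite cmapK.
  by rewrite /B closed_ballE// /closed_ball_/= distrC.
have opre (O : set 'rV[R]_n) : open O -> open (cdom (atlas i) `&` cmap (atlas i) @^-1` O).
  move=> oO; rewrite openE => y [iy Oy]; apply: filterI.
    by apply: open_nbhs_nbhs; split => //; exact: cdom_open.
  by have := cmap_continuous iy; apply; exact: open_nbhs_nbhs.
pose N := cdom (atlas i) `&` cmap (atlas i) @^-1` [set p | sq_radius c delta p < 1].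
exists psi, K, N; split => //.
- move=> j; apply: Ck_local => q jq.
  (* A point of the domain of chart i sees the plateau composed with a transition map; any other
     point lies off K, where the bump is locally zero. *)
  have [qi|qi] := pselect (cdom (atlas i) (cinv (atlas j) q)).
    exists (overlap j i); split; [exact: overlap_open|by split|].
    apply: (@Ck_ext _ _ 1 _ (plateau c delta \o transition j i)); first exact: overlap_open.
      by move=> p [jp ip] /=; rewrite psiE.
    apply: (@C1_compose R n n _ setT) => //; first exact: overlap_open.
    + exact: openT.
    + move=> p [jp ip]; apply: continuous_comp; first exact: cinv_continuous.
      exact: cmap_continuous.
    + by move=> b; exact: transition_smooth.
    + exact: plateau_C1.
  exists (cimg (atlas j) `&` cinv (atlas j) @^-1` (~` K)).
  have oW : open (cimg (atlas j) `&` cinv (atlas j) @^-1` (~` K)).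
    rewrite openE => p [jp nKp]; apply: filterI.
      by apply: open_nbhs_nbhs; split => //; exact: cimg_open.
    have := cinv_continuous jp; apply; apply: open_nbhs_nbhs; split => //.
    exact: closed_openC.
  split => //.
    split => //; rewrite /preimage/= => -[p Bp pE]; apply: qi; rewrite -pE.
    by apply: cinv_dom; exact: BU.
  apply: (Ck_ext oW _ (@Ck_cst _ _ 1 _ 0)) => p [jp nK].
  by rewrite /= psi0.
- by move=> _ [p Bp <-]; apply: cinv_dom; exact: BU.
- split.
  + apply: opre; apply: (@open_comp _ _ (sq_radius c delta) [set s | s < 1]); last exact: open_lt.
    by move=> p _; have [cs _] := sq_radius_C1 c delta; exact: cs.
  + by split => //; rewrite /preimage/= sq_radius_center ltr01.
  + by move=> y [iy y1]; rewrite psiE// plateau1// ltW.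
Qed.

End Bumps.

(** * Integration by parts on the manifold *)

Section GlobalIntegrationByParts.
Variables (R : realType) (n : nat) (M : smooth_manifold R n).
Variable g : riemannian_metric M.
Variables (omega : M -> R) (omega_smooth : smooth_fun omega).
Hypothesis omega_pos : forall x, 0 < omega x.
Variable beta : R.
Variable vol : {measure set (borel M) -> \bar R}.
Hypothesis hvol : is_riemannian_volume g vol.
Variable mu : probability (borel M) R.
Hypothesis hmu : forall A : set (borel M), measurable A ->
     mu A = (\int[vol]_(x in A) (omega x `^ (- beta))%:E)%E.

Local Notation L := (diffusion_op g beta omega).
Local Notation N := (ibp_term g omega beta).

Lemma compact_closed_manifold (K : set M) : compact K -> closed K.
Proof. by apply: compact_closed; exact: manifold_hausdorff. Qed.

Lemma chart_preimage_open i (A : set M) : open A ->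
  open (cimg (atlas i) `&` cinv (atlas i) @^-1` A).
Proof.
move=> oA; rewrite openE => p [jp Ap]; apply: filterI.
  by apply: open_nbhs_nbhs; split => //; exact: cimg_open.
by have := cinv_continuous jp; apply; apply: open_nbhs_nbhs.
Qed.

Lemma dpairing_local u u' f f' (A : set M) x : C1_fun u -> C1_fun u' -> C1_fun f -> C1_fun f' ->
  open A -> A x -> (forall y, A y -> u y = u' y) -> (forall y, A y -> f y = f' y) ->
  dpairing g u f x = dpairing g u' f' x.
Proof.
move=> Cu Cu' Cf Cf' oA Ax uu ff; pose i := chart_at x.
have ix : cdom (atlas i) x := chart_atP x.
rewrite (dpairingE g Cu Cf ix) (dpairingE g Cu' Cf' ix).
apply: (pairing_ext _ (@chart_preimage_open i A oA)).
- by split; [exact: cmap_img|rewrite /preimage/= cmapK].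
- by move=> y [_ Ay]; exact: uu.
- by move=> y [_ Ay]; exact: ff.
Qed.

Lemma laplace_local f f' (A : set M) x : smooth_fun f -> smooth_fun f' ->
  open A -> A x -> (forall y, A y -> f y = f' y) -> laplace g f x = laplace g f' x.
Proof.
move=> Cf Cf' oA Ax ff; pose i := chart_at x.
have ix : cdom (atlas i) x := chart_atP x.
rewrite (laplaceE g Cf ix) (laplaceE g Cf' ix).
apply: (laplace_ext _ (@chart_preimage_open i A oA)).
- by split; [exact: cmap_img|rewrite /preimage/= cmapK].
- by move=> y [_ Ay]; exact: ff.
Qed.

Lemma dpairing_cst (c : R) u x : dpairing g (fun=> c) u x = 0.
Proof.
rewrite /dpairing /pairing_loc big1// => i _; rewrite big1// => j _.
by rewrite /pd [X in _ * X * _]derive_cst mulr0 mul0r.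
Qed.

Lemma laplace_cst (c : R) x : laplace g (fun=> c) x = 0.
Proof.
rewrite /laplace /laplace_loc big1// => i _; rewrite big1// => j _.
rewrite mxE (_ : pd j _ = cst 0); last first.
  by apply/funext => y; rewrite /pd [LHS]derive_cst.
rewrite /pd derive_cst big1 ?subr0 ?mulr0// => k _.
by rewrite [X in _ * X]derive_cst mulr0.
Qed.

Lemma smooth_fun_cst (c : R) : smooth_fun (fun _ : M => c).
Proof. by move=> i k; exact: Ck_cst. Qed.

Lemma dpairing_out u f (K : set M) x : compact K -> C1_fun u -> C1_fun f ->
  (forall y, ~ K y -> f y = 0) -> ~ K x -> dpairing g u f x = 0.
Proof.
move=> cK Cu Cf fK Kx; rewrite dpairingC -[RHS](dpairing_cst 0 u x).
by apply: (@dpairing_local _ _ _ _ (~` K)) => //; [exact: C1_cst|apply: closed_openC; exact: compact_closed_manifold].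
Qed.

Lemma diffusion_out f (K : set M) x : compact K -> smooth_fun f ->
  (forall y, ~ K y -> f y = 0) -> ~ K x -> L f x = 0.
Proof.
move=> cK sf fK Kx; rewrite /diffusion_op.
rewrite (dpairing_out cK (smooth_C1 omega_smooth) (smooth_C1 sf) fK Kx) mulr0 subr0.
rewrite (@laplace_local f (fun=> 0) (~` K)) ?laplace_cst ?mulr0//.
  exact: smooth_fun_cst.
by apply: closed_openC; exact: compact_closed_manifold.
Qed.

Lemma compact_support_integrable (F : M -> R) (K : set M) : continuous F -> compact K ->
  (forall x, ~ K x -> F x = 0) -> mu.-integrable setT (EFin \o (F : borel M -> R)).
Proof.
move=> cF cK F0.
have [C FC] : exists C, forall x, `|F x| <= C.
  have cFK : compact (F @` K) by apply: continuous_compact => //; exact: continuous_subspaceT.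
  have [B [_ H]] := compact_bounded cFK.
  exists (`|B| + 1) => x; have [Kx|Kx] := pselect (K x).
    by apply: (H (`|B| + 1)); [rewrite (le_lt_trans (ler_norm B))// ltrDl|exists x].
  by rewrite F0// normr0 addr_ge0.
apply: (@bounded_support_integrable R _ _ mu F setT C) => //.
- apply: (@borel_measurable_continuous R M); first exact: openT.
  by move=> x _; exact: cF.
- by change (mu setT < +oo)%E; rewrite probability_setT ltry.
- by move=> x /(_ Logic.I).
Qed.

Lemma ibp_out u f (K : set M) x : compact K -> C1_fun u -> smooth_fun f ->
  (forall y, ~ K y -> u y = 0) -> ~ K x -> N u f x = 0.
Proof.
move=> cK Cu sf uK Kx; rewrite /ibp_term uK// mul0r add0r dpairingC.
by rewrite (dpairing_out cK (smooth_C1 sf) Cu uK Kx) mulr0.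
Qed.

Lemma C1_oneminus u : C1_fun u -> @C1_fun R n M (fun x => 1 - u x).
Proof.
move=> Cu i; have := C1D (@C1_cst R n M 1) (C1M (@C1_cst R n M (-1)) Cu) i.
apply: Ck_ext; first exact: cimg_open.
by move=> p _ /=; rewrite mulN1r.
Qed.

Lemma dpairing_addl u v f x : C1_fun u -> C1_fun v ->
  dpairing g (u \+ v) f x = dpairing g u f x + dpairing g v f x.
Proof.
move=> Cu Cv; pose i := chart_at x; have ix : cdom (atlas i) x := chart_atP x.
have ip := cmap_img ix.
rewrite /dpairing /pairing_loc -big_split/=; apply: eq_bigr => a _.
rewrite -big_split/=; apply: eq_bigr => b _.
have [_ /(_ a)[/(_ _ ip) du _]] := Cu i; have [_ /(_ a)[/(_ _ ip) dv _]] := Cv i.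
have -> : pd a (local_rep (u \+ v) x) (Defs.coord x) =
    pd a (local_rep u x) (Defs.coord x) + pd a (local_rep v x) (Defs.coord x).
  exact: (deriveD du dv).
by rewrite mulrDr mulrDl.
Qed.

Lemma ibp_addl u v f x : C1_fun u -> C1_fun v ->
  N (u \+ v) f x = N u f x + N v f x.
Proof. by move=> Cu Cv; rewrite /ibp_term dpairing_addl//=; ring. Qed.

Section Cover.
Variable psi : M -> (M -> R).
Hypothesis psi_C1 : forall c, C1_fun (psi c).
Variable supp : M -> set M.
Hypothesis supp_compact : forall c, compact (supp c).
Hypothesis supp_chart : forall c, supp c `<=` cdom (atlas (chart_at c)).
Hypothesis psi_out : forall c y, ~ supp c y -> psi c y = 0.

(** Vanishes wherever some bump of the list equals 1. Splitting u by these factors one after another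
    replaces a partition of unity. *)
Definition cutoff (s : seq M) (y : M) : R := \prod_(c <- s) (1 - psi c y).

Lemma cutoff_C1 s : C1_fun (cutoff s).
Proof.
elim: s => [|c s IH] i.
  apply: (@Ck_ext _ _ 1 _ (cst 1)); [exact: cimg_open| |exact: Ck_cst].
  by move=> p _; rewrite /= /cutoff big_nil.
have := C1M (C1_oneminus (psi_C1 c)) IH i.
apply: Ck_ext; first exact: cimg_open.
by move=> p _; rewrite /= /cutoff big_cons.
Qed.

Lemma cutoff_out s y : (forall c, c \in s -> ~ supp c y) -> cutoff s y = 1.
Proof.
move=> H; rewrite /cutoff big_seq big1// => c cs.
by rewrite psi_out ?subr0//; exact: H.
Qed.

(* Peels off one bump at a time: [u psi_c] is supported in a single chart. *)
Lemma ibp_cover s u f (K : set M) : compact K -> C1_fun u -> smooth_fun f ->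
  (forall y, ~ K y -> u y = 0) -> (forall y, u y * cutoff s y = 0) ->
  (\int[mu]_x (N u f x)%:E = 0)%E.
Proof.
elim: s u => [|c s IH] u cK Cu sf uK u0.
  have u00 y : u y = 0 by have := u0 y; rewrite /cutoff big_nil mulr1.
  apply: integral0_eq => x _; rewrite (@ibp_out u f set0 x) //.
  exact: compact0.
pose u1 := u \* psi c; pose u2 := u \* (fun y => 1 - psi c y).
have C1 : C1_fun u1 by exact: C1M.
have C2 : C1_fun u2 by apply: C1M => //; exact: C1_oneminus.
have u2K y : ~ K y -> u2 y = 0 by move=> Ky; rewrite /u2/= uK// mul0r.
have u1K y : ~ K y -> u1 y = 0 by move=> Ky; rewrite /u1/= uK// mul0r.
have uE : u = u1 \+ u2 by apply/funext => y; rewrite /u1 /u2/=; ring.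
have I1 := compact_support_integrable (@ibp_term_continuous R n M g omega omega_smooth beta _ f C1 sf) cK
  (fun x => @ibp_out u1 f K x cK C1 sf u1K).
have I2 := compact_support_integrable (@ibp_term_continuous R n M g omega omega_smooth beta _ f C2 sf) cK
  (fun x => @ibp_out u2 f K x cK C2 sf u2K).
transitivity (\int[mu]_x ((N u1 f x)%:E + (N u2 f x)%:E))%E.
  by apply: eq_integral => x _; rewrite uE ibp_addl.
rewrite integralD//.
have -> : (\int[mu]_x (N u1 f x)%:E = 0)%E.
  apply: (local_ibp omega_smooth omega_pos hvol hmu C1 sf (@supp_compact c) (@supp_chart c)).
  by move=> y ny; rewrite /u1/= psi_out// mulr0.
rewrite add0e; apply: (IH u2) => // y.
by have := u0 y; rewrite /u2/= /cutoff big_cons mulrA.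
Qed.

End Cover.

Lemma bump_cover (K : set M) : compact K ->
  exists (psi : M -> M -> R) (supp : M -> set M) (s : seq M) (A : set M),
    [/\ forall c, C1_fun (psi c), forall c, compact (supp c),
        forall c, supp c `<=` cdom (atlas (chart_at c)),
        forall c y, ~ supp c y -> psi c y = 0 &
        [/\ open A, K `<=` A & forall y, A y -> cutoff psi s y = 0]].
Proof.
move=> cK.
pose B (c : M) := cid (bump_exists c).
pose psi c := sval (B c).
pose BK c := cid (svalP (B c)).
pose supp c := sval (BK c).
pose BN c := cid (svalP (BK c)).
pose nb c := sval (BN c).
have P c : [/\ C1_fun (psi c), compact (supp c), supp c `<=` cdom (atlas (chart_at c)),
    (forall y, ~ supp c y -> psi c y = 0) &
    [/\ open (nb c), nb c c & forall y, nb c y -> psi c y = 1]].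
  exact: (svalP (BN c)).
have cvK : cover_compact K by rewrite -compact_cover.
have [D _ KD] : finite_subset_cover setT nb K.
  apply: cvK.
  - by move=> c _; have [_ _ _ _ []] := P c.
  - by move=> c Kc; exists c => //; have [_ _ _ _ []] := P c.
exists psi, supp, (finmap.enum_fset D), (cover [set` finmap.enum_fset D] nb); split.
- by move=> c; case: (P c).
- by move=> c; case: (P c).
- by move=> c; case: (P c).
- by move=> c; case: (P c).
- split=> //.
    by apply: bigcup_open => c _; have [_ _ _ _ []] := P c.
  move=> y [c /= cs cy]; rewrite /cutoff (big_rem c)//=.
  have [_ _ _ _ [_ _ ->]] := P c => //.
  by rewrite subrr mul0r.
Qed.

Lemma ibp_compact u f (K : set M) : compact K -> C1_fun u -> smooth_fun f ->
  (forall y, ~ K y -> u y = 0) -> (\int[mu]_x (N u f x)%:E = 0)%E.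
Proof.
move=> cK Cu sf uK; have [psi [supp [s [A [C1 cS SU S0 [oA KA A0]]]]]] := bump_cover cK.
apply: (@ibp_cover psi C1 supp cS SU S0 s u f K) => // y.
have [Ky|Ky] := pselect (K y); last by rewrite uK// mul0r.
by rewrite A0 ?mulr0//; exact: KA.
Qed.

(** One minus the product [cutoff] is 1 near K, where a factor vanishes, and 0 off the finitely many
    supports, where all factors are 1. *)
Lemma compact_plateau (K : set M) : compact K -> exists (eta : M -> R) (K2 A : set M),
  [/\ C1_fun eta, compact K2, (forall y, ~ K2 y -> eta y = 0), open A & K `<=` A /\
    forall y, A y -> eta y = 1].
Proof.
move=> cK; have [psi [supp [s [A [C1 cS SU S0 [oA KA A0]]]]]] := bump_cover cK.
exists (fun y => 1 - cutoff psi s y), (\big[setU/set0]_(c <- s) supp c), A; split => //.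
- by apply: C1_oneminus; exact: cutoff_C1.
- apply: (big_ind (fun S : set M => compact S)); [exact: compact0|exact: compactU|by move=> c _; exact: cS].
- move=> y ny; rewrite (cutoff_out S0) ?subrr// => c cs sy.
  by apply: ny; rewrite -bigcup_seq; exists c.
- by split=> // y Ay; rewrite A0 ?subr0.
Qed.

(** Multiplying u by a plateau [eta] that is 1 near K makes it compactly supported without changing
    the integrand, since every term carries Lf or df. *)
Lemma ibp_compact_target u f (K : set M) : compact K -> C1_fun u -> smooth_fun f ->
  (forall y, ~ K y -> f y = 0) -> (\int[mu]_x (N u f x)%:E = 0)%E.
Proof.
move=> cK Cu sf fK; have [eta [K2 [A [C1 cK2 eta0 oA [KA eta1]]]]] := compact_plateau cK.
have CM : C1_fun (eta \* u) by exact: C1M.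
transitivity (\int[mu]_x (N (eta \* u) f x)%:E)%E; last first.
  by apply: (ibp_compact cK2 CM sf) => y ny; rewrite /= eta0// mul0r.
apply: eq_integral => x _; congr EFin; rewrite /ibp_term.
have [Ax|nA] := pselect (A x).
  rewrite /= eta1// mul1r; congr (_ + _ * _); symmetry.
  apply: (@dpairing_local _ _ _ _ A) => //; try exact: smooth_C1.
  by move=> y Ay /=; rewrite eta1// mul1r.
have nK : ~ K x by move=> /KA.
by rewrite (diffusion_out cK sf fK nK) !(dpairing_out cK _ (smooth_C1 sf) fK nK)// !mulr0.
Qed.

End GlobalIntegrationByParts.

(** * Essentially self-adjoint operators and semigroups *)

Lemma discriminant_le0 (R : realFieldType) (a b c : R) : 0 <= c ->
  (forall t, 0 <= a + 2 * b * t + c * t ^+ 2) -> b ^+ 2 <= a * c.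
Proof.
rewrite le_eqVlt => /predU1P[<- H|c0 H].
  rewrite mulr0; have [->|b0] := eqVneq b 0; first by rewrite expr0n.
  have := H (- (a + 1) / (2 * b)); rewrite mul0r addr0.
  by rewrite (_ : _ + _ = -1); [rewrite oppr_ge0 ler10|field].
have := H (- b / c).
rewrite (_ : _ + _ = (a * c - b ^+ 2) / c); last by field; rewrite gt_eqF.
by rewrite pmulr_lge0 ?invr_gt0// subr_ge0.
Qed.

Lemma cvg_dist_le (R : realType) (a b : nat -> R) (l : R) :
  (forall k, `|a k - l| <= b k) -> b @ \oo --> 0 -> a @ \oo --> l.
Proof.
move=> ab b0; apply: (@squeeze_cvgr _ _ _ _ (fun k => l - b k) (fun k => l + b k)).
- by near=> k; rewrite -ler_distl.
- by rewrite -[X in _ --> X]subr0; apply: cvgB b0; exact: cvg_cst.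
- by rewrite -[X in _ --> X]addr0; apply: cvgD b0; exact: cvg_cst.
Unshelve. all: by end_near. Qed.

Section SemiInnerProduct.
Variables (R : realType) (V : lmodType R) (ip : V -> V -> R).
Hypothesis ipC : forall x y, ip x y = ip y x.
Hypothesis ipDl : forall x y z, ip (x + y) z = ip x z + ip y z.
Hypothesis ipZl : forall a x y, ip (a *: x) y = a * ip x y.
Hypothesis ip_ge0 : forall x, 0 <= ip x x.

(** Square integrable functions are not identified almost everywhere, so [ip] is only semidefinite;
    equality of vectors appears below as a vanishing seminorm of the difference. *)
Definition seminorm (x : V) : R := Num.sqrt (ip x x).
Local Notation nm := seminorm.

Definition norm_cvg (u : nat -> V) (x : V) : Prop := nm (u k - x) @[k --> \oo] --> 0.

Lemma ipDr x y z : ip x (y + z) = ip x y + ip x z.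
Proof. by rewrite ipC ipDl ipC (ipC z). Qed.

Lemma ipZr a x y : ip x (a *: y) = a * ip x y.
Proof. by rewrite ipC ipZl ipC. Qed.

Lemma ipNl x y : ip (- x) y = - ip x y.
Proof. by rewrite -scaleN1r ipZl mulN1r. Qed.

Lemma ipNr x y : ip x (- y) = - ip x y.
Proof. by rewrite ipC ipNl ipC. Qed.

Lemma ip0l y : ip 0 y = 0.
Proof. by rewrite -(scale0r (0 : V)) ipZl mul0r. Qed.

Definition ipE := (ipDl, ipDr, ipZl, ipZr, ipNl, ipNr).

Lemma seminorm_ge0 x : 0 <= nm x.
Proof. exact: sqrtr_ge0. Qed.

Lemma seminorm_sqr x : nm x ^+ 2 = ip x x.
Proof. by rewrite sqr_sqrtr. Qed.

Lemma seminormZ a x : nm (a *: x) = `|a| * nm x.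
Proof. by rewrite /seminorm !ipE mulrA -expr2 sqrtrM ?sqr_ge0// sqrtr_sqr. Qed.

Lemma seminormN x : nm (- x) = nm x.
Proof. by rewrite -scaleN1r seminormZ normrN1 mul1r. Qed.

Lemma seminormC x y : nm (x - y) = nm (y - x).
Proof. by rewrite -seminormN opprB. Qed.

Lemma cauchy_schwarz x y : `|ip x y| <= nm x * nm y.
Proof.
rewrite -(ler_pXn2r (n := 2)) ?nnegrE ?mulr_ge0 ?seminorm_ge0//.
rewrite real_normK ?num_real// exprMn !seminorm_sqr.
apply: discriminant_le0 => // t; have := ip_ge0 (x + t *: y).
by rewrite !ipE (ipC y x); congr (0 <= _); ring.
Qed.

Lemma seminorm_triangle x y : nm (x + y) <= nm x + nm y.
Proof.
rewrite -(ler_pXn2r (n := 2)) ?nnegrE ?addr_ge0 ?seminorm_ge0//.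
rewrite sqrrD !seminorm_sqr !ipE (ipC y x).
have := le_trans (ler_norm _) (cauchy_schwarz x y); lra.
Qed.

Lemma seminorm_dist x y z : nm (x - z) <= nm (x - y) + nm (y - z).
Proof. by rewrite -[x - z](_ : x - y + (y - z) = _) ?seminorm_triangle// addrA subrK. Qed.

Lemma seminorm_distr x y : nm x <= nm y + nm (x - y).
Proof. by rewrite -[X in nm X <= _](subrK y) addrC seminorm_triangle//. Qed.

Lemma norm_cvg_cst x : norm_cvg (fun=> x) x.
Proof. by rewrite /norm_cvg subrr /seminorm ip0l sqrtr0; exact: cvg_cst. Qed.

Lemma norm_cvg_seminorm u x : norm_cvg u x -> nm (u k) @[k --> \oo] --> nm x.
Proof.
move=> ux; apply: cvg_dist_le ux => k.
rewrite ler_distl; apply/andP; split; last exact: seminorm_distr.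
by rewrite lerBlDr seminormC; exact: seminorm_distr.
Qed.

Lemma norm_cvg_ip u v x y : norm_cvg u x -> norm_cvg v y ->
  ip (u k) (v k) @[k --> \oo] --> ip x y.
Proof.
move=> ux vy; have H k : `|ip (u k) (v k) - ip x y| <=
    nm (u k - x) * nm (v k) + nm x * nm (v k - y).
  rewrite (_ : _ - _ = ip (u k - x) (v k) + ip x (v k - y)); last by rewrite !ipE; ring.
  by rewrite (le_trans (ler_normD _ _))// lerD ?cauchy_schwarz.
apply: cvg_dist_le H _.
rewrite [X in _ --> X](_ : 0 = 0 * nm y + nm x * 0); last by rewrite mul0r mulr0 addr0.
by apply: cvgD; apply: cvgM => //; [exact: norm_cvg_seminorm|exact: cvg_cst].
Qed.

Lemma norm_cvg_lin u v x y a : norm_cvg u x -> norm_cvg v y ->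
  norm_cvg (fun k => a *: u k + v k) (a *: x + y).
Proof.
move=> ux vy.
have Z : (fun k => `|a| * nm (u k - x) + nm (v k - y)) @ \oo --> 0.
  rewrite -[X in _ --> X](addr0 0) -[X in _ --> X + _](mulr0 `|a|).
  by apply: cvgD => //; apply: cvgM => //; exact: cvg_cst.
apply: cvg_dist_le Z => k; rewrite subr0 ger0_norm ?seminorm_ge0//.
rewrite -seminormZ (le_trans _ (seminorm_triangle _ _))//.
by rewrite opprD addrACA scalerBr.
Qed.

Lemma norm_cvg_ext u v x : norm_cvg u x -> (forall k, u k = v k) -> norm_cvg v x.
Proof. by move=> ux uv; rewrite (_ : v = u)//; apply/funext. Qed.

Hypothesis complete : forall u : nat -> V,
  (forall e : R, 0 < e -> exists N, forall j k, (N <= j)%N -> (N <= k)%N -> nm (u j - u k) < e) ->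
  exists x, norm_cvg u x.

Section Operator.
Variable A : V -> V -> Prop.
Hypothesis A_sa : forall f h, A f h <-> forall u v, A u v -> ip f v = ip h u.

Lemma sa_linear a f h f' h' : A f h -> A f' h' -> A (a *: f + f') (a *: h + h').
Proof.
move=> /A_sa H /A_sa H'; apply/A_sa => u v uv.
by rewrite !ipE (H u v uv) (H' u v uv).
Qed.

Lemma sa_sym f h f' h' : A f h -> A f' h' -> ip f h' = ip h f'.
Proof. by move=> /A_sa H /H. Qed.

(* The residual of the projection of [f] on the closure of the range lies in the
   kernel, because [A] is its own adjoint. *)
Lemma sa_range_dense f : (forall z, A z 0 -> ip f z = 0) ->
  exists u v : nat -> V, (forall k, A (u k) (v k)) /\ norm_cvg v f.
Proof.
move=> fker.
have A00 : A 0 0 by apply/A_sa => u v _; rewrite !ip0l.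
pose E := [set r : R | exists u v, A u v /\ r = ip (f - v) (f - v)].
have E0 : has_inf E.
  by split; [exists (ip (f - 0) (f - 0)), 0, 0|exists 0 => _ [u [v [_ ->]]]; exact: ip_ge0].
pose d := inf E.
have dle u v : A u v -> d <= ip (f - v) (f - v).
  by move=> uv; apply: ge_inf; [case: E0|exists u, v].
have /choice[w wP] k : exists w : V * V, A w.1 w.2 /\ ip (f - w.2) (f - w.2) < d + k.+1%:R^-1.
  have k0 : 0 < k.+1%:R^-1 :> R by rewrite invr_gt0.
  have [_ [u [v [uv ->]]] H] := inf_adherent k0 E0.
  by exists (u, v).
pose v k := (w k).2.
(* Parallelogram law: the midpoint of [v j] and [v k] is in the range, hence at squared distance at
   least d from f. *)
have dist j k : ip (v j - v k) (v j - v k) <= 2 * (j.+1%:R^-1 + k.+1%:R^-1).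
  have [Aj dj] := wP j; have [Ak dk] := wP k.
  have := dle _ _ (sa_linear 2^-1 Aj (sa_linear (2^-1) Ak A00)).
  move: dj dk; rewrite -/(v j) -/(v k) !addr0 !ipE !(ipC (v k)) !(ipC _ f).
  move: (j.+1%:R^-1) (k.+1%:R^-1) => s t.
  lra.
have [e e0|p vp] := complete (u := v).
  have [N] := @ltr_add_invr R 0 (e ^+ 2 / 4) (divr_gt0 (exprn_gt0 _ e0) (ltr0Sn _ 3)).
  rewrite add0r => Ne; exists N => j k Nj Nk.
  rewrite -(ltr_pXn2r (n := 2)) ?nnegrE ?seminorm_ge0 ?ltW// seminorm_sqr.
  have le_inv m : (N <= m)%N -> m.+1%:R^-1 <= N.+1%:R^-1 :> R.
    by move=> Nm; rewrite lef_pV2 ?posrE// ler_nat.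
  have := dist j k; have := le_inv _ Nj; have := le_inv _ Nk.
  move: Ne; move: (j.+1%:R^-1) (k.+1%:R^-1) (N.+1%:R^-1) => s t r; lra.
have fv (w' : V) t : norm_cvg (fun k => t *: w' + (f - v k)) (t *: w' + (f - p)).
  apply: norm_cvg_lin; first exact: norm_cvg_cst.
  apply: (norm_cvg_ext (u := fun k => -1 *: v k + f)) => [|k].
    rewrite (_ : f - p = -1 *: p + f); last by rewrite scaleN1r addrC.
    by apply: norm_cvg_lin => //; exact: norm_cvg_cst.
  by rewrite scaleN1r addrC.
have dp : ip (f - p) (f - p) <= d.
  have c1 := norm_cvg_ip (fv 0 0) (fv 0 0).
  have c2 : d + k.+1%:R^-1 @[k --> \oo] --> d.
    by rewrite -[X in _ --> X]addr0; apply: cvgD; [exact: cvg_cst|exact: cvg_harmonic].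
  have := ler_cvg_to c1 c2.
  rewrite scaler0 add0r; apply; near=> k; rewrite add0r.
  by have [_ /ltW] := wP k.
(* Moving p within the closure of the range by t w' cannot bring it closer to f; nonnegativity of
   this quadratic in t kills the linear coefficient. *)
have orth u w' : A u w' -> ip (f - p) w' = 0.
  move=> uw.
  have H t : 0 <= 0 + 2 * ip (f - p) w' * t + ip w' w' * t ^+ 2.
    have c1 := norm_cvg_ip (fv w' t) (fv w' t).
    have : d <= ip (t *: w' + (f - p)) (t *: w' + (f - p)).
      apply: (ler_cvg_to (cvg_cst d) c1); near=> k.
      have [Ak _] := wP k.
      have := dle _ _ (sa_linear (- t) uw Ak).
      by rewrite (_ : f - _ = t *: w' + (f - v k))// opprD scaleNr opprK addrCA.
    by move: dp; rewrite !ipE (ipC _ w') (ipC _ w'); lra.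
  have := discriminant_le0 (ip_ge0 w') H; rewrite mul0r => H2.
  by apply/eqP; rewrite -sqrf_eq0 eq_le H2 sqr_ge0.
(* The residual f - p is orthogonal to the range, hence in the kernel by self-adjointness, and the
   hypothesis on f applies to it. *)
have r0 : ip f (f - p) = 0.
  by apply: fker; apply/A_sa => u w' uw; rewrite ip0l (orth u).
have p0 : ip p (f - p) = 0.
  have c1 := norm_cvg_ip vp (norm_cvg_cst (f - p)).
  have c2 : (fun k => ip (v k) (f - p)) @ \oo --> 0.
    rewrite (_ : (fun _ => _) = cst 0); first exact: cvg_cst.
    by apply/funext => k; rewrite ipC (orth (w k).1)//; case: (wP k).
  exact: (cvg_unique _ c1 c2).
exists (fun k => (w k).1), v; split; first by move=> k; case: (wP k).
have nfp : nm (p - f) = 0 by rewrite seminormC /seminorm !ipDl ipNl r0 p0 subrr sqrtr0.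
apply: cvg_dist_le vp => k; rewrite subr0 ger0_norm ?seminorm_ge0//.
by rewrite (le_trans (seminorm_dist _ p _))// nfp addr0.
Unshelve. all: by end_near. Qed.

Variables (one : V) (c : R).
Hypothesis c_gt0 : 0 < c.
Hypothesis one1 : ip one one = 1.
Hypothesis A_mean : forall f h, A f h -> ip h one = 0.
Hypothesis A_energy : forall f h, A f h -> 0 <= - ip f h.
Hypothesis A_gap : forall f h, A f h -> c * - ip f h <= ip h h.
Hypothesis A_ker : forall z, A z 0 -> exists k, nm (z - k *: one) = 0.

Lemma sa_gap_centered f h : A f h -> ip f one = 0 -> c * ip f f <= - ip f h.
Proof.
move=> fh f1.
have [z /A_ker[k zk]|u [v [uv vf]]] := @sa_range_dense f.
  have := cauchy_schwarz f (z - k *: one); rewrite zk mulr0 normr_le0 !ipE f1.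
  by rewrite mulr0 subr0 => /eqP.
have H k : c * ip f (v k) ^+ 2 <= - ip f h * ip (v k) (v k).
  have Auv := uv k; have G := A_gap Auv.
  have E : ip f (v k) ^+ 2 <= - ip f h * - ip (u k) (v k).
    rewrite -sqrrN; apply: discriminant_le0 => [|t]; first exact: A_energy.
    have := A_energy (sa_linear t Auv fh).
    rewrite !ipE (ipC (u k) h) -(sa_sym fh Auv); congr (0 <= _); ring.
  apply: le_trans (ler_wpM2l (ltW c_gt0) E) _.
  by rewrite mulrCA ler_wpM2l//; exact: A_energy.
have c1 : c * ip f (v k) ^+ 2 @[k --> \oo] --> c * ip f f ^+ 2.
  apply: cvgM; first exact: cvg_cst.
  have c3 := norm_cvg_ip (norm_cvg_cst f) vf.
  by rewrite expr2; exact: (cvgM c3 c3).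
have c2 : - ip f h * ip (v k) (v k) @[k --> \oo] --> - ip f h * ip f f.
  by apply: cvgM; [exact: cvg_cst|exact: norm_cvg_ip].
have L : c * ip f f ^+ 2 <= - ip f h * ip f f.
  by apply: (ler_cvg_to c1 c2); near=> k; exact: H.
have [f0|] := eqVneq (ip f f) 0; first by rewrite f0 mulr0; exact: A_energy.
move=> fn0; have fp : 0 < ip f f by rewrite lt_neqAle eq_sym fn0 ip_ge0.
by move: L; rewrite expr2 mulrA ler_pM2r.
Unshelve. all: by end_near. Qed.

(** The vector [one] is orthogonal to the range, so by self-adjointness it lies in the kernel;
    subtracting the mean of f therefore changes neither h nor the energy. *)
Lemma sa_gap f h : A f h -> c * (ip f f - ip f one ^+ 2) <= - ip f h.
Proof.
move=> fh.
have A1 : A one 0 by apply/A_sa => u v /A_mean; rewrite ipC ip0l.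
have C : ip (- ip f one *: one + f) one = 0 by rewrite !ipE one1; ring.
have := sa_gap_centered (sa_linear (- ip f one) A1 fh) C.
rewrite scaler0 add0r !ipE one1 (ipC one f) (ipC one h) (A_mean fh).
by rewrite mulr0 add0r; congr (c * _ <= _); ring.
Qed.

End Operator.

Section Closure.
Variable A0 : V -> V -> Prop.

Definition graph_closure f h : Prop := exists u v : nat -> V,
  (forall k, A0 (u k) (v k)) /\ norm_cvg u f /\ norm_cvg v h.

Lemma graph_closure_eq0 one f h : (forall f h, A0 f h -> ip h one = 0) ->
  graph_closure f h -> ip h one = 0.
Proof.
move=> H [u [v [uv [uf vh]]]]; have c1 := norm_cvg_ip vh (norm_cvg_cst one).
have c2 : (fun k => ip (v k) one) @ \oo --> 0.
  by rewrite (_ : (fun _ => _) = cst 0); [exact: cvg_cst|apply/funext => k; exact: H (uv k)].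
exact: (cvg_unique _ c1 c2).
Qed.

(** Two inequalities pass to the closure in this form: nonnegative energy with (c, d) = (-1, 0), and
    the gap estimate with d = 1. *)
Lemma graph_closure_le c d f h : (forall f h, A0 f h -> c * - ip f h <= d * ip h h) ->
  graph_closure f h -> c * - ip f h <= d * ip h h.
Proof.
move=> H [u [v [uv [uf vh]]]].
have c1 : c * - ip (u k) (v k) @[k --> \oo] --> c * - ip f h.
  by apply: cvgM; [exact: cvg_cst|apply: cvgN; exact: norm_cvg_ip].
have c2 : d * ip (v k) (v k) @[k --> \oo] --> d * ip h h.
  by apply: cvgM; [exact: cvg_cst|exact: norm_cvg_ip].
by apply: (ler_cvg_to c1 c2); near=> k; exact: H.
Unshelve. all: by end_near. Qed.

End Closure.

(** Since 2 y = (x + y) - (x - y), any center can be shifted by plus or minus y to a point where q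
    is at least q y. *)
Lemma seminorm_shift (q : V -> R) x y : (forall x y, q (x + y) <= q x + q y) ->
  (forall a x, q (a *: x) = `|a| * q x) -> q y <= q (x + y) \/ q y <= q (x - y).
Proof.
move=> qD qZ; have qN z : q (- z) = q z by rewrite -scaleN1r qZ normrN1 mul1r.
have : 2 * q y <= q (x + y) + q (x - y).
  rewrite -(qN (x - y)) -[2]ger0_norm// -qZ (le_trans _ (qD _ _))//.
  by rewrite opprB [x + y]addrC -addrA [x + _]addrC subrK scaler_nat mulr2n.
by have [|h1 h2] := leP (q y) (q (x + y)); [left|right; lra].
Qed.

(* Nested balls, as in the proof of Baire's theorem. *)
Lemma no_resonance (q : nat -> V -> R) :
  (forall m x y, q m (x + y) <= q m x + q m y) ->
  (forall m a x, q m (a *: x) = `|a| * q m x) ->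
  (forall m, exists C, forall x, q m x <= C * nm x) ->
  (forall x, exists B m0, forall m, (m0 <= m)%N -> q m x <= B) ->
  ~ (forall m, exists x, m%:R * nm x < q m x).
Proof.
move=> qD qZ qC qB H.
have step j (b : V * R) : 0 < b.2 -> exists b' : V * R,
    [/\ 0 < b'.2, b'.2 <= j.+1%:R^-1, nm (b'.1 - b.1) + b'.2 <= b.2 &
      exists2 m, (j <= m)%N & forall z, nm (z - b'.1) <= b'.2 -> j%:R <= q m z].
  case: b => y r /= r0; pose e := r / 2; have e0 : 0 < e by rewrite divr_gt0.
  (* Large enough that a vector of length e can reach the value j + 1 under [q m]. *)
  pose m := maxn j (Num.truncn ((j%:R + 1) / e)).+1.
  have me : j%:R + 1 <= m%:R * e.
    rewrite -ler_pdivrMr// (le_trans (ltW (truncnS_gt _)))// ler_nat.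
    exact: leq_maxr.
  have [x xm] := H m; have [C qmC] := qC m.
  have x0 : 0 < nm x.
    rewrite lt_neqAle seminorm_ge0 andbT; apply/eqP => x0.
    by have := qmC x; move: xm; rewrite -x0 !mulr0 ltNge => /negP.
  pose e' := (e / nm x) *: x.
  have en0 : 0 <= e / nm x by rewrite divr_ge0 ?ltW.
  have ne' : nm e' = e by rewrite seminormZ ger0_norm// divfK// gt_eqF.
  have qe' : j%:R + 1 <= q m e'.
    rewrite qZ ger0_norm// (le_trans me)//.
    rewrite [X in X <= _]mulrC -[X in _ <= X]mulrA (ler_pM2l e0).
    by rewrite mulrC ltW// ltr_pdivlMr.
  (* The new center lies at distance e from the old one, on the side where [q m] is large. *)
  have [y' ny' qy'] : exists2 y', nm (y' - y) = e & j%:R + 1 <= q m y'.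
    have [h|h] := seminorm_shift y e' (qD m) (qZ m).
      by exists (y + e'); [rewrite addrC addKr|exact: le_trans qe' h].
    by exists (y - e'); [rewrite addrC addKr seminormN|exact: le_trans qe' h].
  (* The three bounds keep the ball nested, force the radii to 0, and let [q m] drop by at most 1 on
     the new ball, so that it stays above j. *)
  pose r' := Num.min e (Num.min j.+1%:R^-1 (`|C| + 1)^-1).
  have C0 : 0 < `|C| + 1 by rewrite ltr_pwDr.
  have r'0 : 0 < r' by rewrite !lt_min e0 !invr_gt0 C0 ltr0Sn.
  have r'C : r' * (`|C| + 1) <= 1 by rewrite -ler_pdivlMr// div1r /r' !ge_min lexx !orbT.
  exists (y', r') => /=; split => //.
  - by rewrite /r' !ge_min lexx !orbT.
  - rewrite ny'; have : r' <= e by rewrite /r' ge_min lexx.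
    by rewrite /e; lra.
  exists m; first exact: leq_maxl.
  move=> z zy'; have := qD m z (y' - z); rewrite addrC subrK => qq.
  have := qmC (y' - z); rewrite seminormC => q1.
  have q2 : C * nm (z - y') <= `|C| * r'.
    by rewrite (le_trans (ler_wpM2r (seminorm_ge0 _) (ler_norm C)))// ler_wpM2l.
  have := r'0; have := normr_ge0 C; lra.
have /choice[F FP] (w : nat * (V * R)) : exists b' : V * R, 0 < w.2.2 ->
    [/\ 0 < b'.2, b'.2 <= w.1.+1%:R^-1, nm (b'.1 - w.2.1) + b'.2 <= w.2.2 &
      exists2 m, (w.1 <= m)%N & forall z, nm (z - b'.1) <= b'.2 -> w.1%:R <= q m z].
  have [w0|w0] := pselect (0 < w.2.2); last by exists 0.
  by have [b' b'P] := step w.1 w.2 w0; exists b'.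
pose s j := iteri j (fun j b => F (j, b)) (0, 1).
have s0 j : 0 < (s j).2.
  by elim: j => [|j IH]; rewrite ?ltr01//; have [] := FP (j, s j) IH.
have sP j := FP (j, s j) (s0 j); rewrite /= in sP.
have nest j i : nm ((s (i + j)%N).1 - (s j).1) + (s (i + j)%N).2 <= (s j).2.
  elim: i => [|i IH]; first by rewrite add0n subrr /seminorm ip0l sqrtr0 add0r.
  have [_ _ h _] := sP (i + j)%N; rewrite addSn.
  have := seminorm_dist (s (i + j).+1).1 (s (i + j)%N).1 (s j).1.
  by move: h IH; rewrite /=; lra.
have near_center j i : (j.+1 <= i)%N -> nm ((s i).1 - (s j.+1).1) <= j.+1%:R^-1.
  move=> ji; have [_ h _ _] := sP j; apply: le_trans h.
  have := nest j.+1 (i - j.+1)%N; rewrite subnK//; have := s0 i; lra.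
have [e e0|x xP] := complete (u := fun j => (s j).1).
  have [N] := @ltr_add_invr R 0 (e / 2) (divr_gt0 e0 (ltr0Sn _ 1)).
  rewrite add0r => Ne; exists N.+1 => j k Nj Nk.
  have := seminorm_dist (s j).1 (s N.+1).1 (s k).1.
  have := near_center N j Nj; have := near_center N k Nk.
  rewrite (seminormC (s k).1); cbv beta; move: (N.+1%:R^-1) Ne => r; lra.
have inball j : nm (x - (s j.+1).1) <= (s j.+1).2.
  have c1 : nm ((s k).1 - (s j.+1).1) @[k --> \oo] --> nm (x - (s j.+1).1).
    apply: (norm_cvg_seminorm (u := fun k => (s k).1 - (s j.+1).1)).
    have := norm_cvg_lin 1 xP (norm_cvg_cst (- (s j.+1).1)); rewrite scale1r => c0.
    by apply: (norm_cvg_ext c0) => k; rewrite scale1r.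
  apply: (ler_cvg_to c1 (cvg_cst _)); exists j.+1 => // k /= jk.
  by have := nest j.+1 (k - j.+1)%N; rewrite subnK//; have := s0 k; lra.
have [B [m0 HB]] := qB x.
pose j := maxn m0 (Num.truncn B).+1.
have [_ _ _ [m jm /(_ _ (inball j))]] := sP j.
have Bj : B < j%:R by rewrite (lt_le_trans (truncnS_gt _))// ler_nat leq_maxr.
have := HB m (leq_trans (leq_maxl _ _) jm); lra.
Qed.

Lemma seminorm_eq x y : nm (x - y) = 0 -> nm x = nm y.
Proof.
move=> xy; apply/eqP; rewrite eq_le; apply/andP; split.
  by rewrite (le_trans (seminorm_distr x y))// xy addr0.
by rewrite (le_trans (seminorm_distr y x))// seminormC xy addr0.
Qed.

(** * Strongly continuous semigroups and the kernel of the generator *)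

Section Semigroup.
Variable P : R -> V -> V.
Hypothesis P_lin : forall t a f h, 0 <= t ->
  nm (P t (a *: f + h) - (a *: P t f + P t h)) = 0.
Hypothesis P_bounded : forall t, 0 <= t -> exists C, forall f, nm (P t f) <= C * nm f.
Hypothesis P_0 : forall f, nm (P 0 f - f) = 0.
Hypothesis P_D : forall s t f, 0 <= s -> 0 <= t -> nm (P (s + t) f - P s (P t f)) = 0.
Hypothesis P_continuous : forall f, nm (P t f - f) @[t --> (0 : R)^'+] --> 0.

Lemma semigroup_add t x y : 0 <= t -> nm (P t (x + y)) <= nm (P t x) + nm (P t y).
Proof.
move=> t0; have := seminorm_eq (P_lin 1 x y t0).
by rewrite !scale1r => ->; exact: seminorm_triangle.
Qed.

Lemma semigroup_scale t a x : 0 <= t -> nm (P t (a *: x)) = `|a| * nm (P t x).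
Proof.
move=> t0; have Z : nm (P t 0) = 0.
  have := seminorm_eq (P_lin 1 0 0 t0).
  by rewrite !scale1r addr0 -mulr2n -scaler_nat seminormZ ger0_norm//; lra.
rewrite -seminormZ -[a *: x]addr0; apply: seminorm_eq.
have h1 := P_lin a x 0 t0.
have := seminorm_dist (P t (a *: x + 0)) (a *: P t x + P t 0) (a *: P t x).
rewrite h1 add0r [a *: P t x + _]addrC addrK Z => h2.
by apply/eqP; rewrite eq_le h2 seminorm_ge0.
Qed.

(** Strong continuity bounds [P t x] near time 0 for each x separately, and [P_bounded] bounds each
    operator separately; [no_resonance] makes the bound uniform. Its failure would give times t_m <=
    1 / (m + 1) with operator norms above m. *)
Lemma semigroup_locally_bounded : exists (d C : R), 0 < d /\
  forall t x, 0 <= t <= d -> nm (P t x) <= C * nm x.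
Proof.
apply: contrapT => nb.
have /choice[t tP] m : exists t, 0 <= t <= m.+1%:R^-1 /\ exists x, m%:R * nm x < nm (P t x).
  apply: contrapT => nt; apply: nb; exists (m.+1%:R^-1), m%:R.
  rewrite invr_gt0; split => // t x tm; rewrite leNgt; apply/negP => h.
  by apply: nt; exists t; split => //; exists x.
have t0 m : 0 <= t m by have [/andP[]] := tP m.
apply: (@no_resonance (fun m x => nm (P (t m) x))).
- by move=> m x y; exact: semigroup_add.
- by move=> m a x; exact: semigroup_scale.
- by move=> m; exact: P_bounded.
- move=> x; exists (nm x + 1).
  have /cvgrPdist_lt/(_ 1 ltr01)[d /= d0 dP] := P_continuous x.
  have [m0] := ltr_add_invr d0; rewrite add0r => m0d; exists m0 => m mm.
  rewrite (le_trans (seminorm_distr _ x))// lerD2l.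
  (* The right limit at 0 says nothing at time 0 itself. *)
  have [|tm] := eqVneq (t m) 0; first by move=> ->; rewrite P_0.
  have tm0 : 0 < t m by rewrite lt_neqAle eq_sym tm t0.
  have := dP (t m); rewrite /= !sub0r !normrN (ger0_norm (t0 m)) => /(_ _ tm0).
  rewrite ger0_norm ?seminorm_ge0// => h; apply/ltW/h.
  have [/andP[_ tm1] _] := tP m; rewrite (le_lt_trans tm1)// (le_lt_trans _ m0d)//.
  by rewrite lef_pV2 ?posrE// ler_nat.
- by move=> m; have [_] := tP m.
Qed.

Lemma semigroup_step u s z : 0 <= u -> 0 <= s ->
  nm (P (u + s) z - z) <= nm (P u (P s z - z)) + nm (P u z - z).
Proof.
move=> u0 s0; have h1 := seminorm_dist (P (u + s) z) (P u (P s z)) z.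
have h2 := seminorm_dist (P u (P s z)) (P u z) z.
have h3 : nm (P u (P s z - z)) = nm (P u (P s z) - P u z).
  have := P_lin (-1) z (P s z) u0; rewrite !scaleN1r ![- _ + _]addrC => h.
  exact: seminorm_eq.
by move: h1 h2; rewrite P_D// h3; lra.
Qed.

Lemma semigroup_iter_le (d C s : R) z k : (forall t x, 0 <= t <= d -> nm (P t x) <= C * nm x) ->
  0 <= s -> k%:R * s <= d -> nm (P (k%:R * s) z - z) <= k%:R * (C * nm (P s z - z)).
Proof.
move=> bd s0; elim: k => [|k IH] kd; first by rewrite !mul0r P_0.
have ks0 : 0 <= k%:R * s by rewrite mulr_ge0.
have kd' : k%:R * s <= d by rewrite (le_trans _ kd)// ler_wpM2r// ler_nat.
rewrite -natr1 !mulrDl !mul1r.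
have h1 := semigroup_step z ks0 s0.
have h2 : nm (P (k%:R * s) (P s z - z)) <= C * nm (P s z - z) by apply: bd; rewrite ks0 kd'.
by have := IH kd'; move: h1 h2; lra.
Qed.

(** Cut [0, t] into equal steps of length s. Each moves z by at most C times the seminorm of
    [P s z - z], which is o(s), so the total displacement is t times o(1). *)
Lemma semigroup_fixes z : nm (t^-1 *: (P t z - z)) @[t --> (0 : R)^'+] --> 0 ->
  forall t, 0 <= t -> nm (P t z - z) = 0.
Proof.
move=> gz; have [d [C [d0 bd]]] := semigroup_locally_bounded.
have small t : 0 <= t <= d -> nm (P t z - z) = 0.
  move=> /andP[t0 td]; have [->|tn] := eqVneq t 0; first exact: P_0.
  have tp : 0 < t by rewrite lt_neqAle eq_sym tn.
  have Ct0 : 0 < `|C| * t + 1 by rewrite ltr_pwDr// mulr_ge0.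
  apply/eqP; rewrite eq_le seminorm_ge0 andbT leNgt; apply/negP => X0.
  (* With this e the displacement X would be at most |C| t e = X - e, which is less than X. *)
  set X := nm _ in X0; pose e := X / (`|C| * t + 1).
  have e0 : 0 < e by rewrite divr_gt0.
  have /cvgrPdist_lt/(_ e e0)[r /= r0 rP] := gz.
  have [m] := ltr_add_invr (divr_gt0 r0 tp); rewrite add0r => mr.
  pose s := t / m.+1%:R.
  have s0 : 0 < s by rewrite divr_gt0.
  have sr : s < r by rewrite /s mulrC -ltr_pdivlMr.
  have ts : m.+1%:R * s = t by rewrite /s mulrC divfK.
  have := rP s; rewrite /= !sub0r !normrN (gtr0_norm s0) => /(_ sr s0).
  rewrite ger0_norm ?seminorm_ge0// seminormZ gtr0_norm ?invr_gt0// => h.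
  have := @semigroup_iter_le d C s z m.+1 bd (ltW s0); rewrite ts -/X => /(_ td) XC.
  have XE : X <= `|C| * (t * (s^-1 * nm (P s z - z))).
    apply: (le_trans XC); rewrite mulrCA.
    rewrite (_ : t * (s^-1 * _) = m.+1%:R * nm (P s z - z)); last first.
      by rewrite mulrA -ts mulfK// gt_eqF.
    by rewrite ler_wpM2r ?ler_norm// mulr_ge0// seminorm_ge0.
  have : `|C| * (t * (s^-1 * nm (P s z - z))) <= `|C| * t * e.
    by rewrite -mulrA ler_wpM2l// ler_wpM2l// ltW.
  have Ee : e * (`|C| * t) + e = X by rewrite -{2}[e]mulr1 -mulrDr /e divfK// gt_eqF.
  by move: XE Ee e0; rewrite (mulrC e); lra.
(* Larger times are reached by steps no longer than d; the numerator t + 1 stays positive at t =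
   0. *)
move=> t t0; have [m] := ltr_add_invr (divr_gt0 d0 (ltr_wpDl t0 (ltr01 : 0 < 1 :> R))).
rewrite add0r => md; pose s := t / m.+1%:R.
have s0 : 0 <= s by rewrite divr_ge0.
have sd : s <= d.
  have t1 : 0 < t + 1 by rewrite ltr_wpDl.
  rewrite (le_trans (y := (t + 1) / m.+1%:R))//; first by rewrite ler_wpM2r// lerDl.
  by rewrite mulrC -ler_pdivlMr// ltW.
have H k : nm (P (k%:R * s) z - z) = 0.
  elim: k => [|k IH]; first by rewrite mul0r P_0.
  have ks0 : 0 <= k%:R * s by rewrite mulr_ge0.
  apply/eqP; rewrite eq_le seminorm_ge0 andbT -natr1 mulrDl mul1r.
  rewrite (le_trans (semigroup_step z ks0 s0))// IH addr0.
  have [C' C'P] := P_bounded ks0.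
  by rewrite (le_trans (C'P _))// small ?s0 ?sd// mulr0.
by have := H m.+1; rewrite /s mulrC divfK.
Qed.

End Semigroup.

End SemiInnerProduct.

(** * The space of square integrable functions *)

Section SquareIntegrable.
Context {d : measure_display} {T : measurableType d} {R : realType}.
Variable mu : probability T R.
Implicit Types f h : T -> R.

Lemma L2norm_sqr f : L2norm mu f = poweR (\int[mu]_x (f x ^+ 2)%:E)%E 2^-1.
Proof.
rewrite /L2norm unlock; congr poweR; apply: eq_integral => x _.
by rewrite /= powR_mulrn// real_normK// num_real.
Qed.

Lemma L2P f : L2 mu f <-> measurable_fun setT f /\ (\int[mu]_x (f x ^+ 2)%:E < +oo)%E.
Proof.
split=> [L2f|[mf f2]].
  split; first by move: L2f; rewrite /L2 inE => /andP[]; rewrite inE.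
  by have /integrableP[_] := Lfun2_integrable_sqr L2f; under eq_integral do rewrite /= ger0_norm ?sqr_ge0//.
rewrite /L2 inE; apply/andP; split; rewrite inE//= /finite_norm.
by rewrite [ltLHS]L2norm_sqr poweR_lty.
Qed.

Lemma L2_measurable f : L2 mu f -> measurable_fun setT f.
Proof. by case/L2P. Qed.

Lemma L2_mul_integrable f h : L2 mu f -> L2 mu h ->
  mu.-integrable setT (EFin \o (fun x => f x * h x)).
Proof.
by move=> Lf Lh; apply/Lfun1_integrable; exact: (Lfun2_mul_Lfun1 Lf Lh).
Qed.

Lemma L2normE f : L2 mu f -> L2norm mu f = (Num.sqrt (\int[mu]_x (f x * f x)))%:E.
Proof.
move=> Lf; have I := L2_mul_integrable Lf Lf.
rewrite L2norm_sqr; have -> : (\int[mu]_x (f x ^+ 2)%:E)%E = (\int[mu]_x (f x * f x))%:E.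
  rewrite /Rintegral fineK; first by apply: eq_integral => x _; rewrite expr2.
  exact: integrable_fin_num.
rewrite poweR_EFin powR12_sqrt//.
by apply: Rintegral_ge0 => x _; rewrite -expr2 sqr_ge0.
Qed.

Lemma le1_2 : (1 <= 2%:E :> \bar R)%E.
Proof. by rewrite lee_fin ler1n. Qed.

Local Notation V := (LfunType mu le1_2).

Definition L2elt f (Lf : L2 mu f) : V := Lfun_Sub le1_2 Lf.

Lemma elt_L2 (F : V) : L2 mu F.
Proof. exact: LfunP. Qed.

Definition L2ip (F H : V) : R := L2inner mu F H.

Lemma L2ipC F H : L2ip F H = L2ip H F.
Proof. by apply: eq_Rintegral => x _; rewrite mulrC. Qed.

Lemma L2ipDl F G H : L2ip (F + G) H = L2ip F H + L2ip G H.
Proof.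
rewrite /L2ip /L2inner -RintegralD//; try exact: L2_mul_integrable (elt_L2 _) (elt_L2 _).
by apply: eq_Rintegral => x _; rewrite -mulrDl.
Qed.

Lemma L2ipZl a F H : L2ip (a *: F) H = a * L2ip F H.
Proof.
rewrite /L2ip /L2inner -RintegralZl//; last exact: L2_mul_integrable (elt_L2 _) (elt_L2 _).
by apply: eq_Rintegral => x _; rewrite mulrA.
Qed.

Lemma L2ip_ge0 F : 0 <= L2ip F F.
Proof. by apply: Rintegral_ge0 => x _; rewrite -expr2 sqr_ge0. Qed.

Lemma L2norm_elt (F : V) : L2norm mu F = (seminorm L2ip F)%:E.
Proof. exact: (L2normE (elt_L2 F)). Qed.

(** Hoelder's inequality against the constant 1, which has norm 1 for a probability measure. *)
Lemma integral_abs_le_L2norm f : measurable_fun setT f ->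
  (\int[mu]_x (`|f x|%R)%:E <= L2norm mu f)%E.
Proof.
move=> mf; have := @hoelder _ _ _ mu f (cst 1) 2 2 mf (measurable_cst _).
have S1 : (mu : {measure set T -> \bar R}) setT = 1%E by exact: probability_setT.
have N1 : L2norm mu (cst 1) = 1%E.
  by rewrite /L2norm (eq_Lnorm _ _ (g := cst 1%E))// Lnorm_cst1 S1 poweR1r.
rewrite /L2norm in N1; rewrite N1 mule1 Lnorm1 => H.
have E : (\int[mu]_x (`|f x|%R)%:E = \int[mu]_x `|(EFin \o (f \* cst 1)%R) x|)%E.
  by apply: eq_integral => x _ /=; rewrite mulr1.
by rewrite E; apply: H => //; lra.
Qed.

Lemma L2_fatou (v : nat -> T -> R) (w : T -> R) (c : \bar R) :
  (forall k, measurable_fun setT (v k)) -> measurable_fun setT w ->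
  {ae mu, forall x, v k x @[k --> \oo] --> w x} ->
  (forall k, (\int[mu]_x (v k x ^+ 2)%:E <= c)%E) -> (\int[mu]_x (w x ^+ 2)%:E <= c)%E.
Proof.
move=> mv mw vw vc.
have mv2 k : measurable_fun setT (fun x => (v k x ^+ 2)%:E).
  by apply/measurable_EFinP; exact: measurable_funX.
have -> : (\int[mu]_x (w x ^+ 2)%:E = \int[mu]_x limn_einf (fun k => (v k x ^+ 2)%:E))%E.
  apply: ge0_ae_eq_integral => //.
  - by apply/measurable_EFinP; exact: measurable_funX.
  - rewrite /limn_einf; apply: measurableT_comp => //.
    by apply: measurable_fun_limn_esup => k; apply: measurableT_comp.
  - by move=> x _; rewrite lee_fin sqr_ge0.
  - move=> x _; rewrite limn_einf_lim; apply: lime_ge; first exact: is_cvg_einfs.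
    by near=> k; apply: le_ereal_inf_tmp => _ [j _ <-]; rewrite lee_fin sqr_ge0.
  apply: filterS vw => x vwx _; symmetry.
  have : (v k x ^+ 2)%:E @[k --> \oo] --> (w x ^+ 2)%:E.
    by apply: cvg_EFin; [exact: nearW|rewrite !expr2; exact: (cvgM vwx vwx)].
  by move/cvg_limn_einf_sup => [].
apply: (le_trans (fatou _ _ _ _)) => //.
  by move=> k x _; rewrite lee_fin sqr_ge0.
rewrite limn_einf_lim; apply: lime_le; first exact: is_cvg_einfs.
near=> k; apply: (le_trans _ (vc k)).
by apply: ereal_inf_lbound; exists k => /=.
Unshelve. all: by end_near. Qed.

(** The integrals of the absolute increments sum to at most 1, so their series is integrable, hence
    finite almost everywhere, and the sequence converges there. *)
Lemma L2_rapid_cvg (v : nat -> T -> R) : (forall k, measurable_fun setT (v k)) ->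
  (forall k, (L2norm mu (v k.+1 \- v k)%R <= (1 / (2 ^ k.+1)%:R)%:E)%E) ->
  exists2 w : T -> R, measurable_fun setT w & {ae mu, forall x, v k x @[k --> \oo] --> w x}.
Proof.
move=> mv vr.
(* An upper limit is measurable on the whole space, whether or not the sequence converges at x. *)
exists (fun x => fine (limn_esup (fun k => (v k x)%:E))).
  apply: measurableT_comp => //; apply: measurable_fun_limn_esup => k.
  exact/measurable_EFinP.
pose D k (x : T) : \bar R := EFin `|v k.+1 x - v k x|.
have mD k : measurable_fun setT (D k).
  apply/measurable_EFinP; apply: measurableT_comp => //; exact: measurable_funB.
have iD : (\int[mu]_x (\sum_(k <oo) D k x) <= 1)%E.
  rewrite integral_nneseries//; last by move=> k x _; rewrite lee_fin normr_ge0.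
  apply: (@le_trans _ _ (\sum_(k <oo) (1 / (2 ^ k.+1)%:R)%:E)%E); last first.
    exact: epsilon_trick0.
  apply: lee_nneseries => [k _ _|k _].
    by apply: integral_ge0 => x _; rewrite lee_fin normr_ge0.
  apply: (le_trans (integral_abs_le_L2norm _)); first exact: measurable_funB.
  exact: vr.
have mS : measurable_fun setT (fun x => \sum_(k <oo) D k x)%E.
  apply: (@ge0_emeasurable_sum _ _ _ setT D predT) => //.
  by move=> k x _ _; rewrite lee_fin normr_ge0.
have IS : mu.-integrable setT (fun x => \sum_(k <oo) D k x)%E.
  apply/integrableP; split => //.
  have -> : (\int[mu]_x `|\sum_(k <oo) D k x| = \int[mu]_x (\sum_(k <oo) D k x))%E.
    apply: eq_integral => x _; rewrite gee0_abs//.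
    by apply: nneseries_ge0 => k _ _; rewrite lee_fin normr_ge0.
  by rewrite (le_lt_trans iD)// ltry.
have := integrable_ae measurableT IS; apply: filterS => x /(_ I) Sx.
have cv : cvgn (fun k => v k x).
  have cS : cvgn (series (fun k => v k.+1 x - v k x)).
    apply: normed_cvg; apply: nondecreasing_is_cvgn.
      by apply/nondecreasing_seqP => k; rewrite /= !seriesEnat/= big_nat_recr//= lerDl.
    exists (fine (\sum_(k <oo) D k x)%E) => _ [k _ <-] /=.
    rewrite -lee_fin fineK// seriesEnat/= -sumEFin.
    by apply: nneseries_lim_ge => j _ _; rewrite lee_fin.
  have := telescopeK (fun k => v k x); rewrite /telescope => tE.
  rewrite tE in cS.
  have -> : (fun k => v k x) = (fun k => (v k x - v 0%N x) + v 0%N x).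
    by apply/funext => k; rewrite subrK.
  by apply: is_cvgD => //; exact: is_cvg_cst.
have E : (v k x)%:E @[k --> \oo] --> (limn (fun k => v k x))%:E.
  by apply: cvg_EFin => //; exact: nearW.
by have [_ ->] := cvg_limn_einf_sup E.
Qed.

Lemma L2_add f h a : L2 mu f -> L2 mu h -> L2 mu (fun x => a * f x + h x).
Proof. by move=> Lf Lh; exact: (elt_L2 (a *: L2elt Lf + L2elt Lh)). Qed.

(** Riesz-Fischer: a rapidly converging subsequence has an almost everywhere limit, Fatou bounds the
    distance to it, and the Cauchy property carries the convergence over to the whole sequence. *)
Lemma L2_complete (u : nat -> V) :
  (forall e : R, 0 < e -> exists N, forall j k, (N <= j)%N -> (N <= k)%N ->
     seminorm L2ip (u j - u k) < e) ->
  exists x, norm_cvg L2ip u x.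
Proof.
move=> cu; pose r k : R := 1 / (2 ^ k.+1)%:R.
have r0 k : 0 < r k by rewrite divr_gt0// ltr0n expn_gt0.
have /choice[N NP] k := cu (r k) (r0 k).
(* A sum dominates every [N j] with j <= k, so the thresholds can be used without ordering them. *)
pose phi k := (\sum_(i < k.+1) N i)%N.
have Nphi j k : (j <= k)%N -> (N j <= phi k)%N.
  move=> jk; rewrite /phi (bigD1 (Ordinal (jk : (j < k.+1)%N)))//=; exact: leq_addr.
pose v k := u (phi k).
have vr j k : (j <= k)%N -> seminorm L2ip (v k - v j) < r j.
  by move=> jk; apply: NP; exact: Nphi.
have mv k : measurable_fun setT (v k : T -> R) by exact: L2_measurable (elt_L2 _).
have [k|w mw vw] := @L2_rapid_cvg (fun k => v k : T -> R) mv.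
  rewrite (_ : (_ \- _)%R = (v k.+1 - v k : V))// L2norm_elt lee_fin; apply/ltW.
  exact: vr.
have sqr_elt (F : V) : (\int[mu]_x (F x ^+ 2)%:E)%E = (seminorm L2ip F ^+ 2)%:E.
  rewrite sqr_sqrtr ?L2ip_ge0// /L2ip /L2inner /Rintegral fineK.
    by apply: eq_integral => x _; rewrite expr2.
  exact: integrable_fin_num (L2_mul_integrable (elt_L2 F) (elt_L2 F)).
have close j : (\int[mu]_x ((w x - v j x) ^+ 2)%:E <= (r j ^+ 2)%:E)%E.
  apply: (@L2_fatou (fun k => (v (j + k)%N - v j : V) : T -> R)).
  - by move=> k; exact: L2_measurable (elt_L2 _).
  - by apply: measurable_funB.
  - apply: filterS vw => x vwx; apply: cvgB; last exact: cvg_cst.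
    by have := vwx; rewrite -(cvg_shiftn j); under eq_fun do rewrite addnC.
  - move=> k; rewrite sqr_elt lee_fin ler_pXn2r ?nnegrE ?sqrtr_ge0 ?ltW//.
    by apply: vr; rewrite leq_addr.
(* So far w is only measurable; it is square integrable as the sum of [v 0] and a difference bounded
   by [close]. *)
have Lw : L2 mu w.
  have Lwv : L2 mu (fun x => w x - v 0%N x).
    apply/L2P; split; first exact: measurable_funB.
    by rewrite (le_lt_trans (close 0%N))// ltry.
  have := L2_add 1 Lwv (elt_L2 (v 0%N)).
  by congr (L2 mu _); apply/funext => x; rewrite mul1r subrK.
exists (L2elt Lw).
have close' j : seminorm L2ip (v j - L2elt Lw) <= r j.
  rewrite seminormC; try exact: L2ipC; try exact: L2ipZl.
  rewrite -(ler_pXn2r (n := 2)) ?nnegrE ?sqrtr_ge0 ?(ltW (r0 j))// -lee_fin -sqr_elt.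
  exact: close.
apply/cvgrPdist_lt => e e0.
have [m] := @ltr_add_invr R 0 (e / 2) (divr_gt0 e0 (ltr0Sn _ 1)); rewrite add0r => me.
have rm : r m <= m.+1%:R^-1.
  by rewrite /r div1r lef_pV2 ?posrE ?ltr0n ?expn_gt0// ler_nat ltnW// ltn_expl.
exists (N m) => // i /= Ni; rewrite sub0r normrN ger0_norm ?sqrtr_ge0//.
have h1 : seminorm L2ip (u i - v m) < r m by apply: NP => //; exact: Nphi.
have h2 := close' m.
have h3 := @seminorm_dist _ _ _ L2ipC L2ipDl L2ipZl L2ip_ge0 (u i) (v m) (L2elt Lw).
apply: (le_lt_trans h3); apply: (lt_le_trans (ltr_leD h1 h2)).
clear -me rm; move: (m.+1%:R^-1) (r m) me rm => t s; lra.
Qed.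

End SquareIntegrable.

(** * The spectral gap *)

Section CoreInequalities.
Variables (R : realType) (n : nat) (M : smooth_manifold R n).
Variable g : riemannian_metric M.
Variables (omega : M -> R) (omega_smooth : smooth_fun omega).
Hypothesis omega_pos : forall x, 0 < omega x.
Variable beta : R.
Variable vol : {measure set (borel M) -> \bar R}.
Hypothesis hvol : is_riemannian_volume g vol.
Variable mu : probability (borel M) R.
Hypothesis hmu : forall A : set (borel M), measurable A ->
     mu A = (\int[vol]_(x in A) (omega x `^ (- beta))%:E)%E.

Local Notation L := (diffusion_op g beta omega).
Local Notation N := (ibp_term g omega beta).

Variable f : M -> R.
Hypothesis f_core : smooth_compact_support f.
Let K := closure [set x | f x != 0].
Let sf : smooth_fun f := f_core.1.
Let cK : compact K := f_core.2.

Let f_out y : ~ K y -> f y = 0.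
Proof.
move=> nK; have [//|fy] := eqVneq (f y) 0.
by case: nK; apply: subset_closure.
Qed.

Let smooth_continuous h : @smooth_fun R n M h -> continuous h.
Proof. by move=> sh; apply: C1_continuous; exact: smooth_C1. Qed.

Let Lf_out y : ~ K y -> L f y = 0.
Proof. by move=> nK; exact: (@diffusion_out R n M g omega omega_smooth beta f K y cK sf f_out nK). Qed.

Let pairing_out h y : smooth_fun h -> ~ K y -> dpairing g h f y = 0.
Proof. by move=> sh nK; exact: (dpairing_out g cK (smooth_C1 sh) (smooth_C1 sf) f_out nK). Qed.

Let ibp_integrable u h : C1_fun u -> smooth_fun h ->
  (forall y, ~ K y -> N u h y = 0) -> mu.-integrable setT (EFin \o (N u h : borel M -> R)).
Proof.
move=> Cu sh; apply: (compact_support_integrable mu _ cK).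
exact: (@ibp_term_continuous R n M g omega omega_smooth beta u h Cu sh).
Qed.

Lemma core_integrable (F : M -> R) : continuous F -> (forall y, ~ K y -> F y = 0) ->
  mu.-integrable setT (EFin \o (F : borel M -> R)).
Proof. by move=> cF; exact: (compact_support_integrable mu cF cK). Qed.

Lemma core_continuous : continuous f.
Proof. exact: smooth_continuous. Qed.

Lemma core_diffusion_continuous : continuous (L f).
Proof. exact/smooth_continuous/diffusion_smooth. Qed.

Let continuous_L2 (F : M -> R) : continuous F -> (forall y, ~ K y -> F y = 0) ->
  L2 mu (F : borel M -> R).
Proof.
move=> cF F0; apply/L2P; split.
  by apply: (@borel_measurable_continuous R M); [exact: openT|move=> x _; exact: cF].
have /integrableP[_] : mu.-integrable setT (EFin \o (fun x : borel M => F x ^+ 2)).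
  apply: (core_integrable (F := fun x => F x ^+ 2)).
    by move=> x; exact: (cvgM (cF x) (cF x)).
  by move=> y nK; rewrite F0// expr0n.
by under eq_integral do rewrite /= ger0_norm ?sqr_ge0//.
Qed.

Lemma core_L2 : L2 mu (f : borel M -> R).
Proof. by apply: continuous_L2 f_out; exact: core_continuous. Qed.

Lemma core_diffusion_L2 : L2 mu (L f : borel M -> R).
Proof. by apply: continuous_L2 Lf_out; exact: core_diffusion_continuous. Qed.

Lemma core_mean : \int[mu]_x L f x = 0.
Proof.
have := ibp_compact_target omega_smooth omega_pos hvol hmu cK (@C1_cst R n M 1) sf f_out.
move/(congr1 (@fine R)) => /= <-; apply: eq_Rintegral => x _.
by rewrite /ibp_term dpairing_cst mulr0 addr0 mul1r.
Qed.

Let energy := fun x : borel M => omega x * dpairing g f f x.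

Let energy_continuous : continuous (energy : M -> R).
Proof. exact/smooth_continuous/smooth_funM/smooth_dpairing. Qed.

Let energy_integrable : mu.-integrable setT (EFin \o energy).
Proof.
apply: core_integrable; first exact: energy_continuous.
by move=> y nK; rewrite /energy pairing_out// mulr0.
Qed.

Lemma core_energy : \int[mu]_x (- f x * L f x) = \int[mu]_x energy x.
Proof.
have := ibp_compact_target omega_smooth omega_pos hvol hmu cK (smooth_C1 sf) sf f_out.
move/(congr1 (@fine R)) => /= E.
rewrite -[RHS]subr0 -[0 in RHS]E -RintegralB//.
  by apply: eq_Rintegral => x _; rewrite /ibp_term /energy; ring.
apply: ibp_integrable => //; first exact: smooth_C1.
by move=> y nK; rewrite /ibp_term f_out// pairing_out// mul0r mulr0 addr0.
Qed.

Lemma core_energy_ge0 : 0 <= \int[mu]_x (- f x * L f x).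
Proof.
rewrite core_energy; apply: Rintegral_ge0 => x _.
by rewrite mulr_ge0 ?dpairing_ge0// ltW.
Qed.

Lemma core_gap (c : R) : (2 <= n)%N -> 1 <= beta -> beta <= n%:R + 1 ->
  (forall x, qform_le (c *: metric_at g x)
        ((n%:R / (n%:R - 1) * omega x) *: Ric g x
         + (beta - 1) *: Hess g omega x
         + ((n%:R + 1 - beta) / (n%:R - 1)) *:
             (Hess g omega x - laplace g omega x *: metric_at g x))) ->
  c * \int[mu]_x (- f x * L f x) <= \int[mu]_x (L f x ^+ 2).
Proof.
move=> n2 b1 bn H; rewrite core_energy.
pose u1 := omega \* laplace g f; pose u3 := dpairing g omega f.
pose u4 := dpairing g f f.
have s1 : smooth_fun u1 by apply: smooth_funM => //; exact: smooth_laplace.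
have s3 : smooth_fun u3 by exact: smooth_dpairing.
have s4 : smooth_fun u4 by exact: smooth_dpairing.
have o4 y : ~ K y -> u4 y = 0 by exact: pairing_out.
have Z1 : \int[mu]_x N u1 f x = 0.
  by rewrite /Rintegral (ibp_compact_target omega_smooth omega_pos hvol hmu cK (smooth_C1 s1) sf f_out).
have Z2 : \int[mu]_x N omega u4 x = 0.
  by rewrite /Rintegral (ibp_compact_target omega_smooth omega_pos hvol hmu cK (smooth_C1 omega_smooth) s4 o4).
have Z3 : \int[mu]_x N u3 f x = 0.
  by rewrite /Rintegral (ibp_compact_target omega_smooth omega_pos hvol hmu cK (smooth_C1 s3) sf f_out).
(* Here the compact support is that of the test function |df|^2, not of the function [omega] that L
   acts on. *)
have Z4 : \int[mu]_x N u4 omega x = 0.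
  by rewrite /Rintegral (ibp_compact omega_smooth omega_pos hvol hmu cK (smooth_C1 s4) omega_smooth o4).
have I1 : mu.-integrable setT (EFin \o (N u1 f : borel M -> R)).
  apply: ibp_integrable => //; first exact: smooth_C1.
  by move=> y nK; rewrite /ibp_term Lf_out// pairing_out// !mulr0 addr0.
have I2 : mu.-integrable setT (EFin \o (N omega u4 : borel M -> R)).
  apply: ibp_integrable => //; first exact: smooth_C1.
  move=> y nK; rewrite /ibp_term (@diffusion_out R n M g omega omega_smooth beta u4 K y cK s4 o4 nK).
  by rewrite (dpairing_out g cK (smooth_C1 omega_smooth) (smooth_C1 s4) o4 nK) !mulr0 addr0.
have I3 : mu.-integrable setT (EFin \o (N u3 f : borel M -> R)).
  apply: ibp_integrable => //; first exact: smooth_C1.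
  by move=> y nK; rewrite /ibp_term Lf_out// pairing_out// !mulr0 addr0.
have I4 : mu.-integrable setT (EFin \o (N u4 omega : borel M -> R)).
  apply: ibp_integrable => //; first exact: smooth_C1.
  by move=> y nK; exact: (@ibp_out R n M g omega beta u4 omega K y cK (smooth_C1 s4) omega_smooth o4 nK).
have I0 : mu.-integrable setT (EFin \o (fun x : borel M => L f x ^+ 2)).
  apply: core_integrable.
    have cL := core_diffusion_continuous.
    by move=> x; exact: (cvgM (cL x) (cL x)).
  by move=> y nK; rewrite Lf_out// expr0n.
have IZ (a : R) (F : borel M -> R) : mu.-integrable setT (EFin \o F) ->
    mu.-integrable setT (EFin \o (fun x => a * F x)) by move=> IF; exact (integrableZl measurableT a IF).
have IB (F G : borel M -> R) : mu.-integrable setT (EFin \o F) -> mu.-integrable setT (EFin \o G) ->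
    mu.-integrable setT (EFin \o (fun x => F x - G x)) by move=> IF IG; exact (integrableB measurableT IF IG).
have ID (F G : borel M -> R) : mu.-integrable setT (EFin \o F) -> mu.-integrable setT (EFin \o G) ->
    mu.-integrable setT (EFin \o (fun x => F x + G x)) by move=> IF IG; exact (integrableD measurableT IF IG).
have : 0 <= \int[mu]_x (L f x ^+ 2 - c * energy x
    - (n%:R / (n%:R - 1) * N u1 f x
       - n%:R / (2 * (n%:R - 1)) * N omega u4 x
       - (beta - 1 + (n%:R + 1 - beta) / (n%:R - 1)) * N u3 f x
       + (n%:R + 1 - beta) / (n%:R - 1) * N u4 omega x)).
  apply: Rintegral_ge0 => x _.
  exact: (curvature_ineq omega_smooth n2 b1 bn sf (omega_pos x) (H x)).
move: (n%:R / (n%:R - 1)) (n%:R / (2 * (n%:R - 1))) => a1 a2.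
move: ((n%:R + 1 - beta) / _) => a4; move: (beta - 1 + a4) => a3.
have J1 := IZ a1 _ I1; have J2 := IZ a2 _ I2; have J3 := IZ a3 _ I3; have J4 := IZ a4 _ I4.
have J12 := IB _ _ J1 J2; have J123 := IB _ _ J12 J3; have J := ID _ _ J123 J4.
have JE := IZ c _ energy_integrable; have J0 := IB _ _ I0 JE.
rewrite (RintegralB measurableT J0 J) (RintegralB measurableT I0 JE).
rewrite (RintegralD measurableT J123 J4) (RintegralB measurableT J12 J3).
rewrite (RintegralB measurableT J1 J2) (RintegralZl a1 measurableT I1).
rewrite (RintegralZl a2 measurableT I2) (RintegralZl a3 measurableT I3).
rewrite (RintegralZl a4 measurableT I4) (RintegralZl c measurableT energy_integrable).
by rewrite Z1 Z2 Z3 Z4 !mulr0 !subr0 addr0 subr0 subr_ge0.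
Qed.

End CoreInequalities.

Section ErgodicGap.
Context {d : measure_display} {T : measurableType d} {R : realType}.
Variable mu : probability T R.
Local Notation V := (LfunType mu (@le1_2 R)).
Local Notation ip := (@L2ip d T R mu).
Local Notation nm := (seminorm ip).

(** Agreement is asked only eventually along the filter because the lifted semigroup below matches P
    at nonnegative times only. *)
Lemma L2norm_cvg0 (I : Type) (F : set_system I) {FF : Filter F} (f : I -> T -> R) (a : I -> V) :
  (\forall t \near F, f t = a t) -> L2norm mu (f t) @[t --> F] --> 0%E ->
  nm (a t) @[t --> F] --> 0.
Proof.
move=> fa f0; apply: cvg_trans (fine_cvg f0); apply: near_eq_cvg.
by apply: filterS fa => t /= ->; rewrite L2norm_elt.
Qed.

Lemma L2ip_eq0 (F : V) : nm F = 0 <-> {ae mu, forall x, F x = 0}.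
Proof.
have mF2 : measurable_fun setT (fun x => (F x * F x)%:E).
  by have /integrableP[] := L2_mul_integrable (elt_L2 F) (elt_L2 F).
have E : nm F = 0 <-> (\int[mu]_x (F x * F x)%:E = 0)%E.
  have I := L2_mul_integrable (elt_L2 F) (elt_L2 F).
  have fk : (\int[mu]_x (F x * F x)%:E)%E = (ip F F)%:E.
    by rewrite /L2ip /L2inner /Rintegral fineK//; exact: integrable_fin_num I.
  rewrite fk /seminorm; split=> [/eqP|[->]]; last exact: sqrtr0.
  by rewrite sqrtr_eq0 => h; congr EFin; apply/eqP; rewrite eq_le h L2ip_ge0.
rewrite E.
have E2 : (\int[mu]_x (F x * F x)%:E = \int[mu]_x `|(F x * F x)%:E|)%E.
  by apply: eq_integral => x _; rewrite gee0_abs// lee_fin -expr2 sqr_ge0.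
rewrite E2; have /= [h1 h2] := ae_eq_integral_abs mu measurableT mF2.
split=> [/h1|F0].
  apply: filterS => x /(_ Logic.I) /= [] /eqP; rewrite mulf_eq0 => /orP[]/eqP //.
by apply: h2; apply: filterS F0 => x -> _ /=; rewrite mulr0.
Qed.

Lemma L2ip_sub_eq0 (F G : V) : nm (F - G) = 0 <-> {ae mu, forall x, F x = G x}.
Proof.
rewrite L2ip_eq0; split; apply: filterS => x /eqP; [rewrite subr_eq0|] => /eqP //.
by move=> FG; rewrite /= /GRing.add/= FG subrr.
Qed.

Variable A0 : (T -> R) -> (T -> R) -> Prop.
Hypothesis A0_L2 : forall f h, A0 f h -> L2 mu f /\ L2 mu h.
Hypothesis A_sa : selfadjoint mu (op_closure mu A0).

Let A (F H : V) : Prop := op_closure mu A0 F H.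
Let A0' (F H : V) : Prop := A0 F H.

Let one : V := L2elt (Lfun_cst mu 1 2 : L2 mu (cst 1)).

Let one_one : ip one one = 1.
Proof.
rewrite /L2ip /L2inner (_ : (fun x => _) = cst 1); last first.
  by apply/funext => x; rewrite /= mulr1.
by rewrite Rintegral_cst//= probability_setT/= mul1r.
Qed.

Let ip_one f (Lf : L2 mu f) : ip (L2elt Lf) one = \int[mu]_x f x.
Proof. by apply: eq_Rintegral => x _; rewrite /= mulr1. Qed.

Lemma op_closure_graph (F H : V) : A F H -> graph_closure ip A0' F H.
Proof.
move=> [_ [_ [u [v [uv [uF vH]]]]]].
have Lu k : L2 mu (u k) by have [] := A0_L2 (uv k).
have Lv k : L2 mu (v k) by have [] := A0_L2 (uv k).
exists (fun k => L2elt (Lu k)), (fun k => L2elt (Lv k)); split; first exact: uv.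
split; [apply: L2norm_cvg0 uF|apply: L2norm_cvg0 vH]; exact: nearW.
Qed.

Lemma selfadjoint_ip (F H : V) : A F H <-> forall U W : V, A U W -> ip F W = ip H U.
Proof.
split=> [/A_sa[_ [_ H0]] U W /H0//|H0].
apply/A_sa; split; [exact: elt_L2|split; first exact: elt_L2].
move=> u v uv; have [Lu [Lv _]] := uv.
exact: (H0 (L2elt Lu) (L2elt Lv)).
Qed.

Variable P : R -> (T -> R) -> (T -> R).
Hypothesis hP : semigroup_generated_by mu (op_closure mu A0) P.
Hypothesis P_ergodic : ergodic mu P.

(** Lifts P to the space of square integrable functions. The value 0 at negative times is a default,
    as only nonnegative times and right limits at 0 occur. *)
Let P' t (F : V) : V := match pselect (0 <= t) with
  | left t0 => L2elt (sg_L2 hP t0 (elt_L2 F))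
  | right _ => 0
  end.

Let P'E t F : 0 <= t -> P' t F = P t F :> (T -> R).
Proof. by move=> t0; rewrite /P'; case: pselect. Qed.

Lemma generator_kernel (Z : V) : A Z 0 -> exists k, nm (Z - k *: one) = 0.
Proof.
move=> AZ.
have Z0 t : 0 <= t -> nm (P' t Z - Z) = 0.
  apply: (@semigroup_fixes _ _ ip (@L2ipC _ _ _ mu) (@L2ipDl _ _ _ mu) (@L2ipZl _ _ _ mu)
    (@L2ip_ge0 _ _ _ mu) (@L2_complete _ _ _ mu)).
  - move=> s a f h s0; apply/L2ip_sub_eq0.
    have := sg_linear hP a s0 (elt_L2 f) (elt_L2 h).
    by apply: filterS => x; rewrite P'E//= => ->; rewrite -(P'E f s0) -(P'E h s0).
  - move=> s s0; have [C HC] := sg_bounded hP s0; exists C => f.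
    have := HC f (elt_L2 f); rewrite -(P'E f s0) !L2norm_elt -EFinM lee_fin; exact.
  - by move=> f; apply/L2ip_sub_eq0; rewrite P'E//; exact (sg0 hP (elt_L2 f)).
  - move=> s u f s0 u0; apply/L2ip_sub_eq0; rewrite P'E ?addr_ge0// P'E// P'E//.
    exact (sgD hP s0 u0 (elt_L2 f)).
  - move=> f; apply: (L2norm_cvg0 _ (sg_continuous hP (elt_L2 f))).
    near=> s; rewrite -(P'E f)//; apply: ltW; near: s; exact: nbhs_right_gt.
  - have := (sg_generator hP (elt_L2 Z) (elt_L2 0)).1 AZ.
    apply: L2norm_cvg0; near=> s; apply/funext => x; rewrite -(P'E Z).
      by rewrite subr0.
    by apply: ltW; near: s; exact: nbhs_right_gt.
have PZ t : 0 <= t -> {ae mu, forall x, P t Z x = Z x}.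
  by move=> t0; have /L2ip_sub_eq0 := Z0 t t0; rewrite P'E.
have [k Zk] := P_ergodic (elt_L2 Z) PZ; exists k; apply/L2ip_sub_eq0.
by apply: filterS Zk => x ->; exact: (esym (mulr1 k)).
Unshelve. all: by end_near. Qed.

Hypothesis A0_mean : forall f h, A0 f h -> \int[mu]_x h x = 0.
Hypothesis A0_energy : forall f h, A0 f h -> 0 <= \int[mu]_x (- f x * h x).

Let energyE (F H : V) : \int[mu]_x (- F x * H x) = - ip F H.
Proof.
rewrite -mulN1r /L2ip /L2inner -RintegralZl//; last exact: L2_mul_integrable (elt_L2 F) (elt_L2 H).
by apply: eq_Rintegral => x _; rewrite mulN1r mulNr.
Qed.

Lemma generator_energy_ge0 f h : op_closure mu A0 f h -> 0 <= \int[mu]_x (- f x * h x).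
Proof.
move=> fh; have [Lf [Lh _]] := fh; have G : A (L2elt Lf) (L2elt Lh) by [].
rewrite (energyE (L2elt Lf) (L2elt Lh)).
have := @graph_closure_le _ _ ip (@L2ipC _ _ _ mu) (@L2ipDl _ _ _ mu) (@L2ipZl _ _ _ mu)
    (@L2ip_ge0 _ _ _ mu) A0' (-1) 0 _ _ _ (op_closure_graph G).
rewrite mul0r mulN1r oppr_le0; apply => U W UW.
by rewrite mul0r mulN1r -energyE oppr_le0; exact: A0_energy UW.
Qed.

Lemma L2variance_ge0 f : L2 mu f -> 0 <= L2variance mu f.
Proof.
move=> Lf; rewrite /L2variance subr_ge0 -(ip_one Lf).
have -> : \int[mu]_x (f x ^+ 2) = ip (L2elt Lf) (L2elt Lf).
  by apply: eq_Rintegral => x _; rewrite expr2.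
have := @cauchy_schwarz _ _ ip (@L2ipC _ _ _ mu) (@L2ipDl _ _ _ mu) (@L2ipZl _ _ _ mu)
  (@L2ip_ge0 _ _ _ mu) (L2elt Lf) one.
rewrite /seminorm one_one sqrtr1 mulr1 => h.
by rewrite -real_normK ?num_real// -[leRHS]sqr_sqrtr ?L2ip_ge0// ler_pXn2r ?nnegrE ?sqrtr_ge0.
Qed.

Lemma generator_gap (c : R) : 0 < c ->
  (forall f h, A0 f h -> c * \int[mu]_x (- f x * h x) <= \int[mu]_x (h x ^+ 2)) ->
  forall f h, op_closure mu A0 f h -> c * L2variance mu f <= \int[mu]_x (- f x * h x).
Proof.
move=> c0 A0_gap f h fh; have [Lf [Lh _]] := fh.
have G : A (L2elt Lf) (L2elt Lh) by [].
rewrite (energyE (L2elt Lf) (L2elt Lh)) /L2variance -(ip_one Lf).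
have -> : \int[mu]_x (f x ^+ 2) = ip (L2elt Lf) (L2elt Lf).
  by apply: eq_Rintegral => x _; rewrite expr2.
apply: (@sa_gap _ _ ip (@L2ipC _ _ _ mu) (@L2ipDl _ _ _ mu) (@L2ipZl _ _ _ mu)
    (@L2ip_ge0 _ _ _ mu) (@L2_complete _ _ _ mu) A selfadjoint_ip one c c0 one_one) => //.
- move=> F H FH.
  apply: (@graph_closure_eq0 _ _ ip (@L2ipC _ _ _ mu) (@L2ipDl _ _ _ mu) (@L2ipZl _ _ _ mu)
    (@L2ip_ge0 _ _ _ mu) A0' one F H _ (op_closure_graph FH)) => U W /A0_mean W0.
  by rewrite -[RHS]W0; exact: (ip_one (elt_L2 W)).
- by move=> F H FH; rewrite -energyE; exact: generator_energy_ge0 FH.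
- move=> F H FH; rewrite -[X in _ <= X]mul1r.
  apply: (@graph_closure_le _ _ ip (@L2ipC _ _ _ mu) (@L2ipDl _ _ _ mu) (@L2ipZl _ _ _ mu)
    (@L2ip_ge0 _ _ _ mu) A0' c 1 F H _ (op_closure_graph FH)) => U W UW.
  by rewrite mul1r -energyE (le_trans (A0_gap _ _ UW)).
- exact: generator_kernel.
Qed.

Lemma le_spectral_gap (c : R) :
  (forall f h, op_closure mu A0 f h -> c * L2variance mu f <= \int[mu]_x (- f x * h x)) ->
  (c%:E <= spectral_gap mu (op_closure mu A0))%E.
Proof.
move=> H; apply: le_ereal_inf_tmp => _ [f [h [fh v0 ->]]].
have [Lf _] := fh.
by rewrite lee_fin ler_pdivlMr ?H// lt_neqAle eq_sym v0 L2variance_ge0.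
Qed.

End ErgodicGap.

Theorem theorem4p10 (R : realType) (n : nat) (hn : (2 <= n)%N)
  (M : smooth_manifold R n) (g : riemannian_metric M)
  (hcomplete : complete_manifold g)
  (omega : M -> R) (omega_smooth : smooth_fun omega)
  (omega_pos : forall x, 0 < omega x)
  (beta : R) (hbeta : n%:R / 2 < beta <= n%:R + 1)
  (vol : {measure set (borel M) -> \bar R})
  (hvol : is_riemannian_volume g vol)
  (mu : probability (borel M) R)
  (hmu : forall A : set (borel M), measurable A ->
     mu A = (\int[vol]_(x in A) (omega x `^ (- beta))%:E)%E)
  (hesa : essentially_selfadjoint mu (diffusion_core g beta omega))
  (P : R -> (borel M -> R) -> (borel M -> R))
  (hP : semigroup_generated_by mu (diffusion_generator g beta omega mu) P)
  (hergodic : ergodic mu P) :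
  (forall c : R, 0 < c ->
     (forall x : M, qform_le
        (c *: metric_at g x)
        ((n%:R / (n%:R - 1) * omega x) *: Ric g x
         + (beta - 1) *: Hess g omega x
         + ((n%:R + 1 - beta) / (n%:R - 1)) *:
             (Hess g omega x - laplace g omega x *: metric_at g x))) ->
     (c%:E <= spectral_gap mu (diffusion_generator g beta omega mu))%E)
  /\
  (forall rhom rhop : R, 0 < rhom -> rhom <= rhop ->
     (forall x : M, qform_le 0 (Ric g x)) ->
     (forall x : M, qform_le (rhom *: metric_at g x) (Hess g omega x)) ->
     (forall x : M, qform_le (Hess g omega x) (rhop *: metric_at g x)) ->
     let kappa := rhop / rhom in
     (n%:R * (n%:R + 1) * kappa - 2) / (n%:R * (kappa + 1) - 2) <= beta <= n%:R + 1 ->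
     ((rhom * (beta - 1 - (n%:R + 1 - beta) / (n%:R - 1) * (n%:R * kappa - 1)))%:E
        <= spectral_gap mu (diffusion_generator g beta omega mu))%E).
Proof.
have n1 : (1 : R) < n%:R by rewrite ltr1n.
have n0 : (0 : R) < n%:R - 1 by rewrite subr_gt0.
have bn : beta <= n%:R + 1 by case/andP: hbeta.
(* With n >= 2, n/2 < beta gives beta > 1, which fixes the sign of the coefficients of Hess omega
   and of the Cauchy-Schwarz term. *)
have b1 : 1 <= beta.
  have : (2 : R) <= n%:R by rewrite ler_nat.
  by case/andP: hbeta; lra.
have core_sqr f h : diffusion_core g beta omega f h -> L2 mu f /\ L2 mu h.
  by move=> [cf ->]; split; [exact: core_L2|exact: core_diffusion_L2].
have mean f h : diffusion_core g beta omega f h -> \int[mu]_x h x = 0.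
  by move=> [cf ->]; exact (core_mean omega_smooth omega_pos hvol hmu cf).
have energy f h : diffusion_core g beta omega f h -> 0 <= \int[mu]_x (- f x * h x).
  by move=> [cf ->]; exact (core_energy_ge0 omega_smooth omega_pos hvol hmu cf).
have part1 (c : R) : 0 < c ->
     (forall x : M, qform_le
        (c *: metric_at g x)
        ((n%:R / (n%:R - 1) * omega x) *: Ric g x
         + (beta - 1) *: Hess g omega x
         + ((n%:R + 1 - beta) / (n%:R - 1)) *:
             (Hess g omega x - laplace g omega x *: metric_at g x))) ->
     (c%:E <= spectral_gap mu (diffusion_generator g beta omega mu))%E.
  move=> c0 H; apply: le_spectral_gap.
  apply: (generator_gap core_sqr hesa hP hergodic mean energy c0) => f h [cf ->].
  exact (core_gap omega_smooth omega_pos hvol hmu cf hn b1 bn H).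
split => // rm rp rm0 rmp Ric0 Hm Hp kappa _.
set c := rm * _.
(* Part (1) asks for a positive constant; a nonpositive one bounds the gap because energy and
   variance are nonnegative. *)
have [c0|c0] := leP c 0.
  apply: le_spectral_gap => f h fh.
  apply: (le_trans (y := 0)); last exact: generator_energy_ge0 core_sqr energy f h fh.
  by rewrite mulr_le0_ge0// L2variance_ge0//; case: fh.
apply: part1 => // x v.
rewrite !(qformD, qformN, qformZ).
have := Ric0 x v; rewrite qform0 => r0.
have := Hm x v; rewrite qformZ => hm.
have lp := laplace_le (Hp x).
have m0 : 0 <= qform (metric_at g x) v.
  have [->|vn] := eqVneq v 0; first by rewrite /qform !mul0mx mxE.
  exact/ltW/local_metric_pos.
set s := (n%:R + 1 - beta) / (n%:R - 1).
have s0 : 0 <= s by rewrite divr_ge0 ?subr_ge0// ltW.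
(* In this form c is what the bounds deliver: (beta - 1 + s) rho_- from the Hessian, minus s n rho_+
   from the Laplacian of omega. *)
have -> : c = rm * (beta - 1) - s * (n%:R * rp - rm).
  by rewrite /c /kappa -/s; field; rewrite gt_eqF.
have t1 : 0 <= n%:R / (n%:R - 1) * omega x * qform (Ric g x) v.
  by rewrite !mulr_ge0// ?invr_ge0 ltW.
have t2 := ler_wpM2l (_ : 0 <= beta - 1 + s) hm.
have t3 := ler_wpM2l s0 (ler_wpM2r m0 lp).
have := t2 (addr_ge0 (_ : 0 <= beta - 1) s0); rewrite subr_ge0 => /(_ b1) t4.
move: t1 t3 t4; move: (_ * qform (Ric g x) v) => t; lra.
Qed.
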